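(* Let $\Omega_0,\mathbb{Y}^1,\dots,\mathbb{Y}^n$ be standard Borel spaces with prior $\zeta$ on $\Omega_0$, and let $\mu,\nu$ be information structures (probability measures on $\Omega_0\times\prod_{k=1}^n\mathbb{Y}^k$ with $\Omega_0$-marginal $\zeta$). Assume $\mu\ll\mu_0\otimes\bigotimes_{k=1}^n\bar Q^k$ for some probability measures $\mu_0$ on $\Omega_0$ and $\bar Q^k$ on $\mathbb{Y}^k$ (so that $L_C(\mu)$ is closed). Then $\mu$ is more informative than $\nu$ for all team problems in $\mathcal{E}$, i.e. $J^*(c,\mu)\le J^*(c,\nu)$ for every team problem $(c,\mathbb{U}^1,\dots,\mathbb{U}^n)\in\mathcal{E}$, if and only if $\nu$ is a correlated garbling of $\mu$ with potentially common randomness.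
   Context: A team problem (game) $G=(c,\mathbb{U}^1,\dots,\mathbb{U}^n)$ consists of standard Borel action spaces $\mathbb{U}^k$ and a measurable bounded cost $c:\Omega_0\times\prod_k\mathbb{U}^k\to\mathbb{R}$; $\mathcal{E}$ is the set of team problems with compact action spaces and costs continuous in the players' actions for every $\omega_0$. For an information structure $\mu$, $J^*(c,\mu)=\inf_{\bar\gamma}E^{\mu}[c(\omega_0,\gamma^1(y^1),\dots,\gamma^n(y^n))]$, the infimum over team policies $\gamma^k:\mathbb{Y}^k\to\mathbb{U}^k$ measurable. $\nu$ is a correlated garbling of $\mu$ with potentially common randomness if there exist $\eta\in\mathcal{P}([0,1]^n)$ and stochastic kernels $\Pi^k$ from $\mathbb{Y}^k\times[0,1]^n$ to $\mathbb{Y}^k$ such that $\nu(B)=\int_{B\times[0,1]^n}\eta(dz)\mu(d\omega_0,d\bar y)\prod_k\Pi^k(d\tilde y^k|y^k,z)$ for all Borel $B\subset\Omega_0\times\prod_k\mathbb{Y}^k$ (here $B$ is evaluated at $(\omega_0,\tilde y^1,\dots,\tilde y^n)$); equivalently $\tilde y^k=h^k(y^k,Z)$ for a randomness $Z$ independent of $(\omega_0,y^1,\dots,y^n)$ possibly common to all players. *)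

(* Defs.v *)
From HB Require Import structures.
From mathcomp Require Import all_boot all_order all_algebra.
From mathcomp Require Import all_classical all_reals all_analysis.
Set Implicit Arguments. Unset Strict Implicit. Unset Printing Implicit Defensive.
Import Order.TTheory GRing.Theory Num.Theory.
Local Open Scope classical_set_scope.
Local Open Scope ring_scope.

(** Standard Borel space: Borel-isomorphic to a Borel subset of R
    (Kuratowski: every standard Borel space is of this form, and conversely). *)
Definition standard_borel (R : realType) d (T : measurableType d) : Prop :=
  exists f : T -> R, [/\ injective f, measurable_fun setT f,
     measurable (range f) & forall A, measurable A -> measurable (f @` A)].

Definition cyl_gen (n : nat) (X : 'I_n -> Type) (G : forall k, set (set (X k)))
  : set (set (forall k, X k)) :=
  [set C | exists k, exists2 A, G k A & C = (fun x => x k) @^-1` A].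

Definition prodY (n : nat) (dY : 'I_n -> measure_display)
  (Y : forall k, measurableType (dY k)) :=
  g_sigma_algebraType (cyl_gen (fun k => @measurable _ (Y k))).

Definition prodU (R : realType) (n : nat) (U : 'I_n -> pseudoPMetricType R) :=
  g_sigma_algebraType (T := prod_topology U) (cyl_gen (fun k => @open (U k))).

(** [0,1]^n, carried by R^n with product Borel sigma-algebra *)
Definition prodRn (R : realType) (n : nat) :=
  g_sigma_algebraType (cyl_gen (fun _ : 'I_n => @measurable _ R)).

Definition unit_cube (R : realType) (n : nat) : set (prodRn R n) :=
  [set z | forall k, (0 <= z k <= 1)%R].

Definition has_marginal (R : realType) d0 (Om : measurableType d0) (n : nat) (dY : 'I_n -> measure_display)
  (Y : forall k, measurableType (dY k))
  (mu : probability (Om * prodY Y)%type R) (zeta : probability Om R) : Prop :=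
  forall A : set Om, measurable A -> mu (A `*` setT) = zeta A.

(** Team problems in E: compact (metric, Hausdorff, hence standard Borel)
    action spaces U^k, bounded measurable cost continuous in the actions. *)
Definition team_problem_in_E (R : realType) d0 (Om : measurableType d0) (n : nat)
  (U : 'I_n -> pseudoPMetricType R) (c : Om -> (forall k, U k) -> R) : Prop :=
  [/\ forall k, compact [set: U k] /\ hausdorff_space (U k),
      measurable_fun setT (fun p : (Om * prodU U)%type => c p.1 p.2),
      (exists M : R, forall w u, `|c w u| <= M)
    & forall w, continuous (c w : prod_topology U -> R^o)].

Definition team_policy (R : realType) (n : nat) (dY : 'I_n -> measure_display) (Y : forall k, measurableType (dY k))
  (U : 'I_n -> pseudoPMetricType R) (g : forall k, Y k -> U k) : Prop :=
  forall k (O : set (U k)), open O -> measurable (g k @^-1` O).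

Definition Jstar (R : realType) d0 (Om : measurableType d0) (n : nat) (dY : 'I_n -> measure_display)
  (Y : forall k, measurableType (dY k)) (U : 'I_n -> pseudoPMetricType R)
  (c : Om -> (forall k, U k) -> R) (mu : probability (Om * prodY Y)%type R)
  : \bar R :=
  ereal_inf [set (\int[mu]_x (c x.1 (fun k => g k (x.2 k)))%:E)%E
            | g in [set g | @team_policy R n dY Y U g]].

(** nu is a correlated garbling of mu with potentially common randomness:
    there are eta on [0,1]^n and kernels Pi^k from Y^k x [0,1]^n to Y^k with
    nu(B) = \int eta(dz) mu(dw,dy) prod_k Pi^k(dy~^k | y^k, z) 1_B(w, y~).
    Both sides are probability measures in B, so this is stated on the
    generating pi-system of measurable rectangles A x prod_k B_k. *)
Definition correlated_garbling (R : realType) d0 (Om : measurableType d0) (n : nat) (dY : 'I_n -> measure_display)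
  (Y : forall k, measurableType (dY k))
  (mu nu : probability (Om * prodY Y)%type R) : Prop :=
  exists (eta : probability (prodRn R n) R)
         (Pi : forall k, R.-pker (Y k * prodRn R n)%type ~> Y k),
    eta (@unit_cube R n) = 1%E /\
    forall (A : set Om) (B : forall k, set (Y k)),
      measurable A -> (forall k, measurable (B k)) ->
      nu (A `*` [set y : prodY Y | forall k, B k (y k)]) =
      (\int[eta]_z \int[mu]_x
         ((\1_A x.1)%:E * \prod_(k < n) Pi k (x.2 k, z) (B k)))%E.

Definition is_product_prob (R : realType) (n : nat) (dY : 'I_n -> measure_display) (Y : forall k, measurableType (dY k))
  (Q : forall k, probability (Y k) R) (P : probability (prodY Y) R) : Prop :=
  forall B : forall k, set (Y k), (forall k, measurable (B k)) ->
    P [set y : prodY Y | forall k, B k (y k)] = (\prod_(k < n) Q k (B k))%E.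

(* Main.v *)
Require Import Defs.
From HB Require Import structures.
From mathcomp Require Import all_boot all_order all_algebra.
From mathcomp Require Import all_classical all_reals all_analysis.
From mathcomp Require Import finmap measurable_realfun ring lra.
Set Implicit Arguments. Unset Strict Implicit. Unset Printing Implicit Defensive.
Import Order.TTheory GRing.Theory Num.Theory.
Import numFieldNormedType.Exports.
Local Open Scope classical_set_scope.
Local Open Scope ring_scope.

(** Suppose [nu] is a garbling of [mu].  A policy for [nu] composed with the kernels
    is a randomized policy for [mu] with the same cost.  After quantizing the actions
    by finite nets, the common randomness is frozen at a value no worse than average
    and the players are derandomized one at a time; continuity of the cost and
    dominated convergence remove the quantization.

    Conversely, code states and signals by infinite bit sequences.  In the games where
    each player announces [L] bits, a greedy separation argument turns the hypothesis
    on [J*] into finite mixtures of policies for [mu] whose laws approximate the law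
    of the first [L] bits under [nu].  Let [L] tend to infinity along an ultrafilter.
    The averages of a policy over cells of a signal space have as limit a random table,
    parametrized by a single uniform variable [t], and each of its values is
    a conditional law given the signal.  Domination by a product measure makes this
    passage possible: there the integral of a product over the players is the product
    of the integrals, and the convergence then transfers to [mu] through its density.
    The limiting conditional laws are the kernels, and [t] is the common randomness. *)

(** The obstacle is that deterministic policies have no deterministic limit: rapidly oscillating
    ones become random. What passes to the limit are numbers, namely the masses that a policy gives
    to pairs of a signal cell and an announced cell. Averages of products over the players are kept
    rather than separate averages, because the index of the mixture, shared by all the players, is
    what becomes the common randomness.

    An ultrafilter replaces subsequences because limits are needed at once for every measurable set,
    an uncountable family. It is used twice: for the growing number of announced bits, and for the
    refinement of the signal cells, where it stands in for martingale convergence.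

    The density of [mu] is only integrable, so convergence on coded rectangles has to be
    strengthened in two stages, first to all measurable sets and then to integrable weights. The
    first stage relies on a weak-star limit that exists beforehand and is identified on the
    rectangles. *)

Lemma ultra_cvg_ex (R : realType) (F : set_system nat) (FF : UltraFilter F)
    (u : nat -> R) (M : R) :
  (forall n, `|u n| <= M) -> exists l : R, u @ F --> l.
Proof.
move=> uM.
have [|l [_ ul]] := @segment_compact R (- M) M (u @ F) _.
  by apply: (@filterS _ F _ setT); [move=> n _; rewrite /= in_itv /= -ler_norml|exact: filterT].
exists l => V Vl; have [//|FnV] := in_ultra_setVsetC (u @^-1` V) FF.
by have [x []] := ul (~` V) V FnV Vl.
Qed.

Lemma exists_ultra_eventually :
  exists F : set_system nat, UltraFilter F /\ \oo `<=` F.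
Proof.
by have [G [GU sub]] := @ultraFilterLemma nat \oo _; exists G.
Qed.

(** * Finite mixtures from a greedy separation argument *)

Section frank_wolfe.
Variables (R : realType) (C : finType) (K : set (C -> R)) (tau : C -> R).
Hypothesis K01 : forall v, K v -> forall c, 0 <= v c <= 1.
Hypothesis tau01 : forall c, 0 <= tau c <= 1.
(** The slack 1 allows for an infimum that is not attained; it adds only a bounded amount to the
    squared error at each step. *)
Hypothesis separating : forall S : C -> R, exists2 v, K v &
  \sum_c S c * v c <= \sum_c S c * tau c + 1.

(* The greedy choice [v] against the running error [S] makes the cross term in
   [|S + v - tau|^2] at most [2]. *)
Lemma greedy_mixture (T : nat) : exists v : nat -> C -> R, (forall i, K (v i)) /\
  \sum_c (\sum_(i < T) (v i c - tau c)) ^+ 2 <= T%:R * (2 + #|C|%:R).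
Proof.
elim: T => [|T [v [Kv IH]]].
  have [v Kv _] := separating (fun=> 0).
  exists (fun=> v); split => //.
  by rewrite mul0r big1// => c _; rewrite big_ord0 expr0n.
have [w Kw wle] := separating (fun c => \sum_(i < T) (v i c - tau c)).
exists (fun i => if (i < T)%N then v i else w); split; first by move=> i; case: ifP.
under eq_bigr do rewrite big_ord_recr /= ltnn.
under eq_bigr => c _.
  have -> : \sum_(i < T) ((if (i < T)%N then v i else w) c - tau c) =
    \sum_(i < T) (v i c - tau c) by apply: eq_bigr => i _; rewrite ltn_ord.
  rewrite sqrrD; over.
rewrite !big_split/= -natr1 mulrDl mul1r -addrA lerD//.
have step : \sum_c (\sum_(i < T) (v i c - tau c)) * (w c - tau c) <= 1.
  under eq_bigr do rewrite mulrBr.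
  by rewrite sumrB lerBlDl.
apply: lerD; first by rewrite -[leRHS]/(1 + 1) lerD.
have -> : #|C|%:R = \sum_(c : C) (1 : R) by rewrite sumr_const.
apply: ler_sum => c _; have := K01 Kw c; have := tau01 c.
by move=> /andP[? ?] /andP[? ?]; rewrite expr2; nra.
Qed.

(** The accumulated squared error grows linearly in [T], so after division by [T ^+ 2] the squared
    error of the mean decays like [1 / T]. *)
Lemma frank_wolfe (eps : R) : 0 < eps -> exists (T : nat) (v : nat -> C -> R),
  [/\ (0 < T)%N, forall i, K (v i) &
  \sum_c `|T%:R^-1 * (\sum_(i < T) v i c) - tau c| <= eps].
Proof.
move=> e0; set N : R := #|C|%:R.
have N0 : 0 <= N by rewrite /N.
have eN : 0 < eps / (N + 1) by rewrite divr_gt0// ltr_wpDl.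
(* Error allowed in each coordinate; [N + 1] keeps the quotient meaningful when [C] is empty. *)
pose d := eps / (N + 1).
(* Enough steps for [(2 + N) / T <= d ^+ 2]; the successor makes [T] positive. *)
pose T := (Num.Def.archi_bound ((2 + N) / d ^+ 2)).+1.
have [v [Kv vle]] := greedy_mixture T.
exists T, v; split => //.
have T0 : 0 < T%:R :> R by rewrite ltr0n.
have TN : (2 + N) / d ^+ 2 <= T%:R.
  rewrite (le_trans (ltW (archi_boundP _)))// ?ler_nat//.
  by rewrite divr_ge0// ?addr_ge0// sqr_ge0.
have each c : `|T%:R^-1 * (\sum_(i < T) v i c) - tau c| <= d.
  have -> : T%:R^-1 * (\sum_(i < T) v i c) - tau c =
     T%:R^-1 * (\sum_(i < T) (v i c - tau c)).
    rewrite sumrB sumr_const card_ord mulrBr -(mulr_natl (tau c)) mulrA mulVf ?mul1r//.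
    by rewrite gt_eqF.
  rewrite -(@ler_pXn2r _ 2)// ?nnegrE ?(ltW eN) // real_normK ?num_real//.
  rewrite exprMn exprVn.
  rewrite [leLHS]mulrC ler_pdivrMr ?exprn_gt0//.
  have : (\sum_(i < T) (v i c - tau c)) ^+ 2 <= T%:R * (2 + N).
    apply: le_trans vle; rewrite (bigD1 c)//= lerDl.
    by apply: sumr_ge0 => ? _; rewrite sqr_ge0.
  move=> /le_trans; apply; rewrite [X in _ <= _ * X]expr2 mulrCA ler_pM2l//.
  by rewrite mulrC -ler_pdivrMr ?exprn_gt0.
apply: (@le_trans _ _ (\sum_(c : C) d)); first by apply: ler_sum => c _.
rewrite sumr_const -mulr_natl -/N /d mulrA ler_pdivrMr ?ltr_wpDl// mulrC.
by rewrite ler_pM2l// lerDl.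
Qed.

End frank_wolfe.

(** * The uniform law on the unit interval *)

Section unit_uniform.
Variable R : realType.

(** A probability on the whole line. The interval is half open so that the half-open intervals
    allotted to the words of a given length tile it exactly. *)
Definition unif01 : set R -> \bar R :=
  mrestr (@lebesgue_measure R) (measurable_itv `[0%R, 1%R[).

Let unif01_set0 : unif01 set0 = 0%E.
Proof. exact: measure0. Qed.

Let unif01_ge0 A : (0 <= unif01 A)%E.
Proof. exact: measure_ge0. Qed.

Let unif01_sigma_additive : semi_sigma_additive unif01.
Proof.
pose m : {measure set (measurableTypeR R) -> \bar R} :=
  mrestr (@lebesgue_measure R) (measurable_itv `[0%R, 1%R[).
exact: (@measure_semi_sigma_additive _ _ _ m).
Qed.

HB.instance Definition _ := isMeasure.Build _ _ _ unif01
  unif01_set0 unif01_ge0 unif01_sigma_additive.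

Let unif01_setT : unif01 setT = 1%E.
Proof.
by rewrite /unif01 /mrestr setTI lebesgue_measure_itv/= lte_fin ltr01 oppr0 adde0.
Qed.

HB.instance Definition _ := Measure_isProbability.Build _ _ _ unif01 unif01_setT.

Lemma unif01_itv (x y : R) : 0 <= x -> y <= 1 -> x <= y ->
  unif01 `[x, y[%classic = (y - x)%:E.
Proof.
move=> x0 y1 xy; rewrite /unif01 /mrestr setIidl; last first.
  move=> z /=; rewrite !in_itv/= => /andP[xz zy].
  by rewrite (le_trans x0 xz) (lt_le_trans zy y1).
rewrite lebesgue_measure_itv/= lte_fin; case: ltP => //= yx.
by rewrite (le_anti (_ : x <= y <= x)) ?subrr// xy yx.
Qed.

Lemma unif01_itvE (A : set R) : unif01 A = unif01 (A `&` `[0, 1[).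
Proof. by rewrite /unif01 /mrestr -setIA setIid. Qed.

End unit_uniform.
Arguments unif01 {R}.

(* A word lists the bits read so far with the newest one first. *)
Fixpoint mt (b : nat -> bool) (s : seq bool) : bool :=
  if s is c :: s' then (b (size s') == c) && mt b s' else true.

Fixpoint rpre (b : nat -> bool) (m : nat) : seq bool :=
  if m is m'.+1 then b m' :: rpre b m' else [::].

Lemma size_rpre b m : size (rpre b m) = m.
Proof. by elim: m => //= m ->. Qed.

Lemma mt_rpre b s : mt b s = (rpre b (size s) == s).
Proof. by elim: s => //= c s ->; rewrite eqseq_cons. Qed.

Lemma mt_rpre_same b m : mt b (rpre b m).
Proof. by rewrite mt_rpre size_rpre. Qed.

Lemma rpre_eq b b' m : (forall i, (i < m)%N -> b i = b' i) -> rpre b m = rpre b' m.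
Proof.
elim: m => //= m IH bb'; rewrite bb'// IH// => i im; apply: bb'.
exact: ltnW.
Qed.

Lemma mt_eq_bits b b' s : mt b s -> mt b' s ->
  forall i, (i < size s)%N -> b i = b' i.
Proof.
elim: s => //= c s IH /andP[/eqP bc bs] /andP[/eqP bc' bs'] i.
rewrite ltnS leq_eqVlt => /orP[/eqP ->|]; first by rewrite bc bc'.
exact: IH.
Qed.

(** * Sampling bit sequences by inverse transform *)

Section tree_sampling.
Variable R : realType.
Implicit Type w : seq bool -> R.

(** These are the cell masses of a probability on infinite bit sequences: [w s] is the chance of
    starting with the word [s]. *)
Definition is_tree w := [/\ w [::] = 1, forall s, 0 <= w s &
  forall s, w s = w (false :: s) + w (true :: s)].

(* The subinterval of [[0, 1[] allotted to the word [s] starts at [tree_lo w s]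
   and has length [w s]. *)
Fixpoint tree_lo w (s : seq bool) : R :=
  if s is c :: s' then tree_lo w s' + (if c then w (false :: s') else 0) else 0.

(** Quantile descent: the interval of [s] is split at [tree_lo w s + w (false :: s)], and the next
    bit tells whether [t] is at or beyond the split. *)
Fixpoint tree_word w (t : R) (m : nat) : seq bool :=
  if m is m'.+1 then
    let s := tree_word w t m' in (w (false :: s) <= t - tree_lo w s) :: s
  else [::].

Definition samp w (t : R) (m : nat) : bool := head false (tree_word w t m.+1).

Lemma rpre_samp w t m : rpre (samp w t) m = tree_word w t m.
Proof. by elim: m => //= m ->. Qed.

Lemma mt_samp_cons w t c s : mt (samp w t) (c :: s) =
  ((w (false :: s) <= t - tree_lo w s) == c) && mt (samp w t) s.
Proof.
rewrite /=; case: (boolP (mt _ s)); rewrite ?andbF// !andbT.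
by rewrite mt_rpre rpre_samp /samp/= => /eqP ->.
Qed.

(** By additivity the intervals of the two children tile that of [s], and one comparison with the
    split point selects the child. The bounds on [t] are the case of the empty word. *)
Lemma mt_sampP w t s : is_tree w -> 0 <= t < 1 ->
  mt (samp w t) s = (tree_lo w s <= t < tree_lo w s + w s).
Proof.
move=> [w1 w0 wD] t01; elim: s => [|c s IH]; first by rewrite /= w1 add0r.
rewrite mt_samp_cons IH /=; have := w0 (false :: s); have := w0 (true :: s).
have := wD s; set a := w (false :: s); set b := w (true :: s) => -> a0 b0.
case: c; rewrite ?eqb_id ?eqbF_neg -?ltNge ?addr0 -?/a -?/b.
  by apply/andP/andP => [[? /andP[? ?]]|[? ?]]; split; try (apply/andP; split); lra.
by apply/andP/andP => [[? /andP[? ?]]|[? ?]]; split; try (apply/andP; split); lra.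
Qed.

Lemma tree_lo_ge0 w s : is_tree w -> 0 <= tree_lo w s.
Proof.
move=> [_ w0 _]; elim: s => //= c s IH; rewrite addr_ge0//.
by case: c.
Qed.

Lemma tree_hi_le1 w s : is_tree w -> tree_lo w s + w s <= 1.
Proof.
move=> [w1 w0 wD]; elim: s => [|c s]; first by rewrite /= w1 add0r.
rewrite wD /=; have := w0 (false :: s); have := w0 (true :: s).
by case: c; lra.
Qed.

Lemma tree_le1 w s : is_tree w -> w s <= 1.
Proof.
move=> tw; apply: le_trans (tree_hi_le1 s tw).
by rewrite lerDr tree_lo_ge0.
Qed.

(** One uniform variable thus realises any law on bit sequences, as the interval of [s] has length
    [w s] and lies inside [0, 1[. *)
Lemma unif01_samp w s : is_tree w ->
  unif01 [set t | mt (samp w t) s] = (w s)%:E.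
Proof.
move=> tw; have -> : (w s)%:E = (tree_lo w s + w s - tree_lo w s)%:E.
  by congr (_%:E); lra.
have w0 : 0 <= w s by case: tw.
rewrite -unif01_itv ?tree_lo_ge0 ?tree_hi_le1 ?lerDl//.
rewrite unif01_itvE [RHS]unif01_itvE; congr (unif01 _).
apply/seteqP; split => t /= [] + t01; rewrite !in_itv/= in t01 *.
  by rewrite mt_sampP.
by rewrite -mt_sampP.
Qed.

Section measurable_samp.
Context d (P : measurableType d) (w : P -> seq bool -> R).
Hypothesis mw : forall s, measurable_fun setT (w ^~ s).

Lemma measurable_tree_lo s : measurable_fun setT (fun p => tree_lo (w p) s).
Proof.
elim: s => [|c s IH] /=; first exact: measurable_cst.
apply: measurable_funD => //; case: c; first exact: mw.
exact: measurable_cst.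
Qed.

(** Parameter and seed enter through maps [f] and [g], so that the same statement serves a fixed
    tree and a tree that depends on a signal and on the common randomness. *)
Lemma measurable_samp d' (Q : measurableType d') (f : Q -> P) (g : Q -> R) s :
  measurable_fun setT f -> measurable_fun setT g ->
  measurable [set q | mt (samp (w (f q)) (g q)) s].
Proof.
move=> mf mg; elim: s => [|c s IH].
  by rewrite (_ : [set _ | _] = setT) //; apply/seteqP; split.
rewrite (_ : [set _ | _] = [set q | (w (f q) (false :: s) <= g q - tree_lo (w (f q)) s) == c]
    `&` [set q | mt (samp (w (f q)) (g q)) s]); last first.
  by apply/seteqP; split => q /=; rewrite -/(mt _ (c :: s)) mt_samp_cons => /andP.
apply: measurableI => //.
have mle : measurable_fun setT (fun q => w (f q) (false :: s) <= g q - tree_lo (w (f q)) s).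
  apply: measurable_fun_ler.
    exact: (measurableT_comp (mw _) mf).
  apply: measurable_funB => //.
  exact: (measurableT_comp (measurable_tree_lo s) mf).
have := mle measurableT [set c] I; rewrite setTI.
by congr measurable; apply/seteqP; split => q /= /eqP.
Qed.

End measurable_samp.
End tree_sampling.

(** * Induction on nonnegative measurable functions *)

Section ge0_fun_induction.
Context d (Z : measurableType d) (R : realType) (P : (Z -> \bar R) -> Prop).
Hypothesis Pindic : forall (k : R) A, 0 <= k -> measurable A ->
  P (fun z => (k * \1_A z)%:E).
Hypothesis PD : forall f g : Z -> \bar R,
  (forall z, (0 <= f z)%E) -> (forall z, (0 <= g z)%E) ->
  measurable_fun setT f -> measurable_fun setT g -> P f -> P g ->
  P (fun z => f z + g z)%E.
Hypothesis Plim : forall (u : nat -> Z -> \bar R) (f : Z -> \bar R),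
  (forall m z, (0 <= u m z)%E) -> (forall m, measurable_fun setT (u m)) ->
  (forall z, {homo u^~ z : m n / (m <= n)%N >-> (m <= n)%E}) ->
  (forall z, u^~ z @ \oo --> f z) -> (forall m, P (u m)) -> P f.

Import HBNNSimple.

Lemma ge0_fun_induction (f : Z -> \bar R) :
  (forall z, (0 <= f z)%E) -> measurable_fun setT f -> P f.
Proof.
move=> f0 mf; pose f_ := nnsfun_approx measurableT mf.
apply: (Plim (u := fun m z => (f_ m z)%:E)).
- by move=> m z; rewrite lee_fin.
- by move=> m; exact/measurable_EFinP.
- by move=> z a b ab; rewrite lee_fin; exact/lefP/nd_nnsfun_approx.
- by move=> z; exact: cvg_nnsfun_approx.
move=> m; set g := f_ m.
(* A simple approximant is a sum over its finitely many values. They are peeled off one by one,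
   while remembering that each is nonnegative. *)
rewrite (_ : (fun _ => _) = fun z => \sum_(y <- fset_set (range g))
    (y * \1_(g @^-1` [set y]) z)%:E); last first.
  by apply/funext => z; rewrite fimfunE fsbig_finite//= sumEFin.
have : forall y, y \in enum_fset (fset_set (range g)) -> 0 <= y.
  move=> y; rewrite -[_ \in _]/(y \in fset_set (range g)).
  by rewrite in_fset_set; [move=> /set_mem[z _ <-]|exact: fimfunP].
elim: (enum_fset _) => [_|y s IH].
  rewrite (_ : (fun _ => _) = fun z => (0 * \1_(set0 : set Z) z)%:E).
    exact: Pindic.
  by apply/funext => z; rewrite big_nil mul0r.
move=> ys; rewrite (_ : (fun _ => _) = fun z => (y * \1_(g @^-1` [set y]) z)%:E +
    \sum_(y <- s) (y * \1_(g @^-1` [set y]) z)%:E)%E; last first.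
  by apply/funext => z; rewrite big_cons.
have y0 : 0 <= y by apply: ys; rewrite mem_head.
have s0 : forall y, y \in s -> 0 <= y by move=> x xs; apply: ys; rewrite in_cons xs orbT.
apply: PD.
- by move=> z; rewrite lee_fin mulr_ge0.
- move=> z; rewrite sumEFin lee_fin big_seq; apply: sumr_ge0 => x xs.
  by rewrite mulr_ge0// s0.
- by apply/measurable_EFinP; exact: measurable_funM.
- by apply: emeasurable_sum => x; apply/measurable_EFinP; exact: measurable_funM.
- exact: Pindic.
- exact: IH.
Qed.

End ge0_fun_induction.

(** * Mixtures of measures and change of variables *)

Section mixture_measure.
Local Open Scope ereal_scope.
Context d d' (X : measurableType d) (Z : measurableType d') (R : realType).
Variables (M : {measure set X -> \bar R}) (kap : X -> {measure set Z -> \bar R}).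
Variable h : X -> R.
Hypothesis mkap : forall C, measurable C -> measurable_fun setT (kap ^~ C).
Hypothesis h0 : forall x, (0 <= h x)%R.
Hypothesis mh : measurable_fun setT h.

(** The side conditions are arguments of the function so that the measure structure, whose axioms
    depend on them, can be attached to it. *)
Definition mixm of (forall C, measurable C -> measurable_fun setT (kap ^~ C)) &
  (forall x, (0 <= h x)%R) & measurable_fun setT h :=
  fun C : set Z => \int[M]_x ((h x)%:E * kap x C).

Notation m := (mixm mkap h0 mh).

Let m_set0 : m set0 = 0.
Proof. by rewrite /m integral0_eq// => x _; rewrite measure0 mule0. Qed.

Let m_ge0 C : 0 <= m C.
Proof. by apply: integral_ge0 => x _; apply: mule_ge0; rewrite ?lee_fin. Qed.

Let m_sigma_additive : semi_sigma_additive m.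
Proof.
move=> U mU tU mUU; rewrite /mixm [X in _ --> X](_ : _ =
  \int[M]_x (\sum_(n <oo) ((h x)%:E * kap x (U n)))); last first.
  apply: eq_integral => x _; rewrite nneseriesZl//; congr (_ * _).
  by apply/esym/cvg_lim => //; exact/measure_semi_sigma_additive.
apply/cvg_closeP; split.
  by apply: is_cvg_nneseries => n _ _; apply: integral_ge0 => x _; apply: mule_ge0; rewrite ?lee_fin.
rewrite closeE// integral_nneseries// => [n|n x _]; last by apply: mule_ge0; rewrite ?lee_fin.
by apply: emeasurable_funM; [exact/measurable_EFinP|exact: mkap].
Qed.

HB.instance Definition _ := isMeasure.Build _ _ R m m_set0 m_ge0 m_sigma_additive.

Lemma integral_mixm (f : Z -> \bar R) : (forall z, 0 <= f z) -> measurable_fun setT f ->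
  \int[m]_z f z = \int[M]_x ((h x)%:E * \int[kap x]_z f z).
Proof.
move: f; apply: ge0_fun_induction => [k A k0 mA|f g f0 g0 mf mg IHf IHg|u f u0 mu ndu uf IHu].
- rewrite (_ : (fun _ => _) = fun z => k%:E * (\1_A z)%:E)//.
  have mI : measurable_fun setT (EFin \o (\1_A : Z -> R)) by apply/measurable_EFinP.
  rewrite ge0_integralZl_EFin// integral_indic// setIT.
  under eq_integral => x _ do rewrite ge0_integralZl_EFin// integral_indic// setIT muleCA.
  rewrite ge0_integralZl_EFin//; first by move=> x _; apply: mule_ge0; rewrite ?lee_fin.
  by apply: emeasurable_funM; [exact/measurable_EFinP|exact: mkap].
- rewrite ge0_integralD// IHf IHg -ge0_integralD//.
  + apply: eq_integral => x _; by rewrite ge0_integralD// [RHS]ge0_muleDr//; apply: integral_ge0.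
  + by move=> x _; apply: mule_ge0; [by rewrite lee_fin|exact: integral_ge0].
  + by apply: emeasurable_funM; [exact/measurable_EFinP|exact: measurable_fun_integral_kernel].
  + by move=> x _; apply: mule_ge0; [by rewrite lee_fin|exact: integral_ge0].
  + by apply: emeasurable_funM; [exact/measurable_EFinP|exact: measurable_fun_integral_kernel].
- have I0 n x : 0 <= \int[kap x]_z u n z by exact: integral_ge0.
  have Inc x : {homo (fun n => \int[kap x]_z u n z) : m n / (m <= n)%N >-> m <= n}.
    by move=> a b ab; apply: ge0_le_integral => // z _; exact: ndu.
  rewrite (eq_integral (fun z => limn (u^~ z))); last first.
    by move=> z _; exact/esym/cvg_lim.
  rewrite monotone_convergence//.
  under eq_fun do rewrite IHu.
  rewrite -monotone_convergence//; last 3 first.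
  + move=> n; apply: emeasurable_funM; [exact/measurable_EFinP|exact: measurable_fun_integral_kernel].
  + by move=> n x _; apply: mule_ge0; rewrite ?lee_fin.
  + by move=> x _ a b ab; apply: lee_wpmul2l; [rewrite lee_fin|exact: Inc].
  apply: eq_integral => x _.
  rewrite limeMl//; last exact: ereal_nondecreasing_is_cvgn (Inc x).
  congr (_ * _).
  rewrite -monotone_convergence//.
  by apply: eq_integral => z _; exact/cvg_lim.
Qed.

End mixture_measure.

Section weighted_transfer.
Local Open Scope ereal_scope.
Context d1 d2 d (X1 : measurableType d1) (X2 : measurableType d2)
  (Z : measurableType d) (R : realType).
Variables (M1 : {measure set X1 -> \bar R}) (M2 : {measure set X2 -> \bar R}).
Variables (e1 : X1 -> Z) (e2 : X2 -> Z) (h1 : X1 -> R) (h2 : X2 -> R).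
Hypotheses (me1 : measurable_fun setT e1) (me2 : measurable_fun setT e2).
Hypotheses (h10 : forall x, (0 <= h1 x)%R) (h20 : forall x, (0 <= h2 x)%R).
Hypotheses (mh1 : measurable_fun setT h1) (mh2 : measurable_fun setT h2).
Hypothesis h12 : forall C, measurable C ->
  \int[M1]_x ((h1 x)%:E * (\1_C (e1 x))%:E) = \int[M2]_x ((h2 x)%:E * (\1_C (e2 x))%:E).

(** Each side is an integral against a mixture of Dirac masses, that is, a weighted image measure,
    and the two measures coincide by [h12]. Densities, coordinate projections and changes of seed
    are all instances. *)
Lemma weighted_transfer (f : Z -> \bar R) :
  (forall z, 0 <= f z) -> measurable_fun setT f ->
  \int[M1]_x ((h1 x)%:E * f (e1 x)) = \int[M2]_x ((h2 x)%:E * f (e2 x)).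
Proof.
move=> f0 mf.
have dm d' (X : measurableType d') (e : X -> Z) : measurable_fun setT e ->
    forall C, measurable C -> measurable_fun setT (fun x => \d_(e x) C : \bar R).
  by move=> me C mC; exact: (measurableT_comp (@measurable_fun_dirac _ Z R setT C mC) me).
pose m1 : {measure set Z -> \bar R} := mixm M1 (dm _ _ _ me1) h10 mh1.
pose m2 : {measure set Z -> \bar R} := mixm M2 (dm _ _ _ me2) h20 mh2.
have intE d' (X : measurableType d') (M : {measure set X -> \bar R}) (e : X -> Z)
    (me : measurable_fun setT e) (h : X -> R) (hh : forall x, (0 <= h x)%R) (mh : measurable_fun setT h) :
    \int[M]_x ((h x)%:E * f (e x)) = \int[mixm M (dm _ _ _ me) hh mh]_z f z.
  rewrite integral_mixm//; apply: eq_integral => x _.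
  by rewrite integral_dirac// diracT mul1e.
rewrite (intE _ _ _ _ me1 _ h10 mh1) (intE _ _ _ _ me2 _ h20 mh2).
by apply: eq_measure_integral => C mC _; exact: h12.
Qed.

End weighted_transfer.

(** Exchange of a limit with an approximation that is uniform in the index, by the usual three
    errors [e / 3]. *)
Lemma cvg_approx (R : realType) (F : set_system nat) {FF : Filter F}
    (a : nat -> R) (l : R) :
  (forall e, 0 < e -> exists (b : nat -> R) (lb : R),
    [/\ b @ F --> lb, forall n, `|a n - b n| <= e & `|l - lb| <= e]) ->
  a @ F --> l.
Proof.
move=> H; apply/cvgrPdist_le => e e0.
have [b [lb [blb ab llb]]] := H (e / 3) (divr_gt0 e0 (ltr0Sn _ 2)).
move/cvgrPdist_le : blb => /(_ (e / 3) (divr_gt0 e0 (ltr0Sn _ 2))).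
apply: filterS => n bn.
have -> : l - a n = (l - lb) + (lb - b n) + (b n - a n) by ring.
rewrite (le_trans (ler_normD _ _))// (splitr e) -[leRHS]/(e / 2 + e / 2).
rewrite (_ : e / 2 + e / 2 = (e / 3 + e / 3) + e / 3); last by field.
by rewrite lerD// ?(distrC (b n)) ?ab// (le_trans (ler_normD _ _))// lerD.
Qed.

Lemma cvgR_unique (R : realType) (F : set_system nat) {FF : ProperFilter F}
    (u : nat -> R) (a b : R) : u @ F --> a -> u @ F --> b -> a = b.
Proof. by move=> ua ub; apply: (cvg_unique _ ua ub); exact: norm_hausdorff. Qed.

Section probability_01.
Context d (X : measurableType d) (R : realType) (P : probability X R).

Lemma bounded_integrable (M : R) E (u : X -> R) : measurable E ->
  measurable_fun setT u -> (forall x, `|u x| <= M) -> P.-integrable E (EFin \o u).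
Proof.
move=> mE mu uM; apply: measurable_bounded_integrable => //.
- by rewrite (le_lt_trans (probability_le1 P mE)) ?ltry.
- exact: measurable_funTS.
- exists M; split; first exact: num_real.
  by move=> y My x _; exact: le_trans (uM x) (ltW My).
Qed.

Lemma integrable01 E (u : X -> R) : measurable E ->
  measurable_fun setT u -> (forall x, 0 <= u x <= 1) -> P.-integrable E (EFin \o u).
Proof.
move=> mE mu u01; apply: (@bounded_integrable 1) => // x.
by have /andP[u0 u1] := u01 x; rewrite ger0_norm.
Qed.

Lemma Rintegral01 E (u : X -> R) : measurable E ->
  measurable_fun setT u -> (forall x, 0 <= u x <= 1) ->
  0 <= \int[P]_(x in E) u x <= fine (P E).
Proof.
move=> mE mu u01; apply/andP; split.
  by apply: Rintegral_ge0 => x _; case/andP: (u01 x).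
rewrite -[leRHS]mul1r -(Rintegral_cst _ mE) le_Rintegral//.
- exact: integrable01.
- by apply: (@integrable01 _ (cst 1)) => //= _; rewrite ler01 lexx.
- by move=> x _; case/andP: (u01 x).
Qed.

Lemma Rintegral01_le1 E (u : X -> R) : measurable E ->
  measurable_fun setT u -> (forall x, 0 <= u x <= 1) ->
  `|\int[P]_(x in E) u x| <= 1.
Proof.
move=> mE mu u01; have /andP[I0 I1] := Rintegral01 mE mu u01.
rewrite ger0_norm// (le_trans I1)//.
by rewrite -lee_fin fineK ?fin_num_measure// probability_le1.
Qed.

End probability_01.

(** * Weak-star limits along an ultrafilter *)

Section weak_star_limit.
Context d (X : measurableType d) (R : realType) (P : probability X R).
Variables (F : set_system nat) (UF : UltraFilter F).
Variable g : nat -> X -> R.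
Hypothesis mg : forall L, measurable_fun setT (g L).
Hypothesis g01 : forall L x, 0 <= g L x <= 1.

Let I E L := \int[P]_(x in E) g L x.

(** Measurability sits under the existential so that the limit can be chosen as a total function of
    [E]. *)
Let lim_ex E : exists l : R, measurable E -> I E @ F --> l.
Proof.
have [mE|nE] := pselect (measurable E); last by exists 0.
have [l Il] := @ultra_cvg_ex R F UF (I E) 1 (fun L => Rintegral01_le1 P mE (mg L) (g01 L)).
by exists l.
Qed.

Let lim_int E : R := if pselect (measurable E) then sval (cid (lim_ex E)) else 0.

Let lim_intP E : measurable E -> I E @ F --> lim_int E.
Proof. by rewrite /lim_int; case: pselect => // mE _; case: cid => l /= /(_ mE). Qed.

Let lim_int_bound E : measurable E -> 0 <= lim_int E <= fine (P E).
Proof.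
move=> mE; apply/andP; split.
  apply: (cvgr_to_ge (lim_intP mE)); apply: nearW => L.
  by case/andP: (Rintegral01 P mE (mg L) (g01 L)).
apply: (cvgr_to_le (lim_intP mE)); apply: nearW => L.
by case/andP: (Rintegral01 P mE (mg L) (g01 L)).
Qed.

Let lim_intU A B : measurable A -> measurable B -> A `&` B = set0 ->
  lim_int (A `|` B) = lim_int A + lim_int B.
Proof.
move=> mA mB AB.
apply: (cvgR_unique (lim_intP (measurableU _ _ mA mB))).
rewrite (_ : I _ = fun L => I A L + I B L); first by apply: cvgD; exact: lim_intP.
apply/funext => L; rewrite /I Rintegral_setU//; last exact/disj_set2P.
by apply: integrable01 => //; exact: measurableU.
Qed.

Let nu E := (lim_int E)%:E.

Let lim_int0 : lim_int set0 = 0.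
Proof.
have := lim_int_bound measurable0; rewrite measure0/= => /le_anti.
by move/esym.
Qed.

Let nu0 : nu set0 = 0%E. Proof. by rewrite /nu lim_int0. Qed.

Let nu_ge0 E : (0 <= nu E)%E.
Proof.
rewrite lee_fin; have [mE|nE] := pselect (measurable E).
  by case/andP: (lim_int_bound mE).
by rewrite /lim_int; case: pselect.
Qed.

Let lim_int_sum (E : (set X)^nat) n : (forall i, measurable (E i)) -> trivIset setT E ->
  lim_int (\big[setU/set0]_(i < n) E i) = \sum_(i < n) lim_int (E i).
Proof.
move=> mE tE; elim: n => [|n IH]; first by rewrite !big_ord0 lim_int0.
rewrite !big_ord_recr/= lim_intU ?IH//; first exact: bigsetU_measurable.
by apply: (@trivIset_bigsetUI _ predT) => //; rewrite /predT /= trueE.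
Qed.

(** Finite additivity passes to the limit. Countable additivity comes from the bound of [lim_int E]
    by the mass of [E] under [P], which forces the tails to vanish. *)
Let nu_sigma_additive : semi_sigma_additive nu.
Proof.
move=> E mE tE mU; rewrite /nu.
under eq_fun do rewrite big_mkord sumEFin.
apply: cvg_EFin; first by apply: nearW.
apply/cvgrPdist_le => e e0.
have PE : (fun n => \sum_(i < n) fine (P (E i))) @ \oo --> fine (P (\bigcup_i E i)).
  have := @measure_semi_sigma_additive _ _ _ P E mE tE mU.
  rewrite -[X in _ --> X](@fineK _ (P _)) ?fin_num_measure//.
  under eq_fun do rewrite big_mkord.
  move=> /fine_cvg; apply: cvg_trans; apply: near_eq_cvg; apply: nearW => n /=.
  by rewrite sum_fine// => i _; exact: fin_num_measure.
move/cvgrPdist_le : PE => /(_ e e0); apply: filterS => n; apply: le_trans.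
set V := \big[setU/set0]_(i < n) E i.
have mV : measurable V by exact: bigsetU_measurable.
have VU : V `<=` \bigcup_i E i by move=> x; rewrite /V -bigcup_mkord => -[k _ ?]; exists k.
have mD : measurable ((\bigcup_i E i) `\` V) by exact: measurableD.
have UE : \bigcup_i E i = V `|` ((\bigcup_i E i) `\` V).
  by rewrite setDUK.
have disj : V `&` ((\bigcup_i E i) `\` V) = set0 by rewrite setDE setICA setICr setI0.
have PV : \sum_(i < n) fine (P (E i)) = fine (P V).
  rewrite /V (@measure_bigsetU _ _ _ P)//= sum_fine// => i _.
  exact: fin_num_measure.
rewrite /= -lim_int_sum// -/V PV UE lim_intU// measureU//.
rewrite fineD ?fin_num_measure//.
have aK (a b : R) : a + b - a = b by ring.
rewrite !aK.
have /andP[l0 lP] := lim_int_bound mD.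
by rewrite !ger0_norm// ?fine_ge0// (le_trans l0).
Qed.

HB.instance Definition _ := isMeasure.Build _ _ _ nu nu0 nu_ge0 nu_sigma_additive.

Let nu_fin : fin_num_fun nu. Proof. by move=> E _. Qed.

HB.instance Definition _ := @Measure_isFinite.Build _ _ _ nu nu_fin.

(* The limit of the indefinite integrals is a measure dominated by [P]; its
   density is the weak-star limit. *)
Lemma weak_star_limit : exists G : X -> R,
  [/\ measurable_fun setT G, forall x, 0 <= G x, P.-integrable setT (EFin \o G) &
   forall E, measurable E ->
   (fun L => \int[P]_(x in E) g L x) @ F --> \int[P]_(x in E) G x].
Proof.
have nuP : nu `<< P.
  apply/null_content_dominatesP => A mA PA; rewrite /nu; congr (_%:E).
  have := lim_int_bound mA; rewrite PA /= => /le_anti.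
  by move/esym.
have [f [f0 ffin fint fE]] := @radon_nikodym_sigma_finite _ _ _ P nu nuP.
have fineE : EFin \o (fine \o f) = f by apply/funext => x; rewrite /= fineK.
exists (fine \o f); rewrite fineE; split => //.
- by apply/measurable_EFinP; rewrite fineE; case/integrableP: fint.
- by move=> x; exact: fine_ge0.
move=> E mE; have := lim_intP mE; congr (_ --> _).
rewrite /Rintegral; under eq_integral do rewrite fineK//.
by rewrite -fE.
Qed.

End weak_star_limit.

(** * Convergence from a generating family to a dominated measure *)

Section dominated_extension.
Context d (X : measurableType d) (R : realType) (P Q : probability X R).
Variables (F : set_system nat) (UF : UltraFilter F).
Variables (g : nat -> X -> R) (G : X -> R).
Hypothesis mg : forall L, measurable_fun setT (g L).
Hypothesis g01 : forall L x, 0 <= g L x <= 1.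
Hypothesis mG : measurable_fun setT G.
Hypothesis G01 : forall x, 0 <= G x <= 1.
Variable H : set (set X).
Hypothesis HI : setI_closed H.
Hypothesis HT : H setT.
Hypothesis Hgen : @measurable _ X = <<s H >>.
Hypothesis cvgH : forall E, H E ->
  (fun L => \int[P]_(x in E) g L x) @ F --> \int[P]_(x in E) G x.

Let int_fin (p : probability X R) E (u : X -> R) : measurable E ->
  measurable_fun setT u -> (forall x, 0 <= u x <= 1) ->
  (\int[p]_(x in E) (u x)%:E)%E \is a fin_num.
Proof. by move=> mE mu u01; apply: integrable_fin_num => //; exact: integrable01. Qed.

(** Some weak-star limit [K] exists in any case. The measures of densities [K] and [G] agree on a
    generating family closed under intersection, hence everywhere. *)
Lemma cvg_integral_generated E : measurable E ->
  (fun L => \int[P]_(x in E) g L x) @ F --> \int[P]_(x in E) G x.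
Proof.
move=> mE; have [K [mK K0 iK Kc]] := weak_star_limit P UF mg g01.
have -> // : \int[P]_(x in E) G x = \int[P]_(x in E) K x.
pose dm C (mC : measurable C) := @measurable_fun_dirac _ X R setT C mC.
pose m1 : {measure set X -> \bar R} := mixm P dm (fun x => proj1 (andP (G01 x))) mG.
pose m2 : {measure set X -> \bar R} := mixm P dm K0 mK.
have mI (u : X -> R) C : measurable C ->
   (\int[P]_x ((u x)%:E * \d_x C) = \int[P]_(x in C) (u x)%:E)%E.
  move=> mC; rewrite [RHS]integral_mkcond; apply: eq_integral => x _.
  rewrite patchE diracE; case: ifPn; by rewrite ?mule1 ?mule0.
have m12 : m1 E = m2 E.
  apply: (measure_unique H (fun=> setT)) => //; last 2 first.
  - move=> A HA; have mA : measurable A by rewrite Hgen; exact: sub_sigma_algebra.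
    rewrite /m1 /m2 /= /mixm !mI//.
    have := cvgR_unique (cvgH HA) (Kc _ mA); rewrite /Rintegral => GK.
    rewrite -[LHS]fineK ?int_fin// GK fineK//.
    by apply: integrable_fin_num => //; exact: (integrableS measurableT).
  - by move=> _; rewrite /= /mixm mI// ltey_eq int_fin.
  - by rewrite bigcup_const.
by move: m12; rewrite /m1 /m2 /= /mixm !mI// /Rintegral => ->.
exact: Kc.
Qed.

(** An error bound uniform in the weight [a]. It rests on [a v + u <= v + a u], a form that avoids
    subtracting infinite values. *)
Let le_weighted (u v w : X -> \bar R) (a : X -> R) :
  (forall x, 0 <= a x <= 1) -> measurable_fun setT a ->
  (forall x, (0 <= u x)%E) -> (forall x, (u x <= v x)%E) ->
  measurable_fun setT u -> measurable_fun setT v ->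
  (\int[P]_x v x < +oo)%E ->
  `|fine (\int[P]_x ((a x)%:E * v x))%E - fine (\int[P]_x ((a x)%:E * u x))%E|
     <= fine (\int[P]_x v x)%E - fine (\int[P]_x u x)%E.
Proof.
move=> a01 ma u0 uv mu mv voo.
have v0 x : (0 <= v x)%E by exact: le_trans (u0 x) (uv x).
have a0 x : (0 <= (a x)%:E)%E by rewrite lee_fin; case/andP: (a01 x).
have a1 x : ((a x)%:E <= 1)%E by rewrite lee_fin; case/andP: (a01 x).
have mau (k : X -> \bar R) : measurable_fun setT k -> measurable_fun setT (fun x => (a x)%:E * k x)%E.
  by move=> mk; apply: emeasurable_funM => //; exact/measurable_EFinP.
have au0 x : (0 <= (a x)%:E * u x)%E by exact: mule_ge0.
have av0 x : (0 <= (a x)%:E * v x)%E by exact: mule_ge0.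
have auv x : ((a x)%:E * u x <= (a x)%:E * v x)%E by exact: lee_wpmul2l.
have avv x : ((a x)%:E * v x <= v x)%E by exact: gee_pMl.
have fin (k : X -> \bar R) : (forall x, (0 <= k x)%E) -> (forall x, (k x <= v x)%E) ->
    measurable_fun setT k -> (\int[P]_x k x)%E \is a fin_num.
  move=> k0 kv mk; rewrite ge0_fin_numE ?integral_ge0//.
  by apply: le_lt_trans voo; apply: ge0_le_integral.
have fav := fin _ av0 avv (mau _ mv).
have fau := fin _ au0 (fun x => le_trans (auv x) (avv x)) (mau _ mu).
have fv := fin _ v0 (fun x => lexx _) mv.
have fu := fin _ u0 uv mu.
rewrite ger0_norm; last first.
  by rewrite subr_ge0 fine_le//; apply: ge0_le_integral => //; exact: mau.
have key : (\int[P]_x ((a x)%:E * v x) + \int[P]_x u x <=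
    \int[P]_x v x + \int[P]_x ((a x)%:E * u x))%E.
  rewrite -!ge0_integralD//; [|exact: mau..].
  apply: ge0_le_integral => //.
  - by move=> x _; exact: adde_ge0.
  - by apply: emeasurable_funD => //; exact: mau.
  - by apply: emeasurable_funD => //; exact: mau.
  move=> x _; have aux := au0 x; have := uv x; have := u0 x.
  have /andP[ax0 ax1] := a01 x.
  case vE : (v x) => [s||]; last by rewrite leeNy_eq => + /eqP => /[swap] ->.
    case uE : (u x) => [r||]//; rewrite !lee_fin => r0 rs.
    by rewrite -?EFinM -?EFinD ?lee_fin; nra.
  by rewrite addye ?leey// gt_eqF// (lt_le_trans _ aux)// ltNy0.
move: key; rewrite -(fineK fav) -(fineK fau) -(fineK fv) -(fineK fu) -!EFinD lee_fin /=.
lra.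
Qed.

(** Test functions grow from indicators to integrable functions. For an increasing limit the error
    is bounded by [le_weighted] independently of [L], which allows the exchange of limits. *)
Lemma cvg_integral_weighted (f : X -> \bar R) :
  (forall x, 0 <= f x)%E -> measurable_fun setT f -> (\int[P]_x f x < +oo)%E ->
  (fun L => fine (\int[P]_x ((g L x)%:E * f x))%E) @ F -->
    fine (\int[P]_x ((G x)%:E * f x))%E.
Proof.
move: f; apply: ge0_fun_induction => [k A k0 mA _|u v u0 v0 mu mv IHu IHv foo|
    u f u0 mu ndu uf IHu foo].
- have kE (a : X -> R) : (forall x, 0 <= a x <= 1) -> measurable_fun setT a ->
     fine (\int[P]_x ((a x)%:E * (k * \1_A x)%:E))%E = k * \int[P]_(x in A) a x.
    move=> a01 ma; rewrite -RintegralZl//; last exact: integrable01.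
    rewrite /Rintegral [in RHS]integral_mkcond; congr fine; apply: eq_integral => x _.
    by rewrite patchE indicE; case: ifPn => _; rewrite ?mulr1 ?mulr0 ?mule0// -EFinM mulrC.
  under eq_fun do rewrite kE//.
  rewrite kE//; apply: cvgMl_tmp. exact: cvg_integral_generated.
- have ug0 (a w : X -> \bar R) x : (0 <= a x -> 0 <= w x -> 0 <= a x * w x)%E by exact: mule_ge0.
  have [uoo voo] : (\int[P]_x u x < +oo)%E /\ (\int[P]_x v x < +oo)%E.
    split; apply: le_lt_trans foo; apply: ge0_le_integral => //.
    + exact: emeasurable_funD.
    + by move=> x _; rewrite leeDl.
    + exact: emeasurable_funD.
    + by move=> x _; rewrite leeDr.
  have aD (a : X -> R) : (forall x, 0 <= a x <= 1) -> measurable_fun setT a ->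
     fine (\int[P]_x ((a x)%:E * (u x + v x)))%E =
     fine (\int[P]_x ((a x)%:E * u x))%E + fine (\int[P]_x ((a x)%:E * v x))%E.
    move=> a01 ma.
    have a0 x : (0 <= (a x)%:E)%E by rewrite lee_fin; case/andP: (a01 x).
    have a1 x : ((a x)%:E <= 1)%E by rewrite lee_fin; case/andP: (a01 x).
    have mau (w : X -> \bar R) : measurable_fun setT w ->
        measurable_fun setT (fun x => (a x)%:E * w x)%E.
      by move=> mw; apply: emeasurable_funM => //; exact/measurable_EFinP.
    have fin (w : X -> \bar R) : (forall x, (0 <= w x)%E) -> measurable_fun setT w ->
        (\int[P]_x w x < +oo)%E -> (\int[P]_x ((a x)%:E * w x))%E \is a fin_num.
      move=> w0 mw woo; rewrite ge0_fin_numE; last by apply: integral_ge0 => x _; exact: mule_ge0.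
      apply: le_lt_trans woo; apply: ge0_le_integral => //.
      + by move=> x _; exact: mule_ge0.
      + exact: mau.
      + by move=> x _; exact: gee_pMl.
    rewrite -fineD ?fin// -ge0_integralD//; [|by move=> x _; exact: mule_ge0|exact: mau|by move=> x _; exact: mule_ge0|exact: mau].
    by congr fine; apply: eq_integral => x _; rewrite ge0_muleDr.
  under eq_fun do rewrite aD//.
  by rewrite aD//; apply: cvgD; [exact: IHu|exact: IHv].
- have f0 x : (0 <= f x)%E.
    rewrite -(cvg_lim _ (uf x))//; apply: lime_ge; last by apply: nearW.
    by apply/cvg_ex; exists (f x); exact: uf.
  have mf : measurable_fun setT f.
    by apply: (emeasurable_fun_cvg u) => // x _; exact: uf.
  have ule m x : (u m x <= f x)%E.
    rewrite -(cvg_lim _ (uf x))//.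
    rewrite (cvg_lim _ (ereal_nondecreasing_cvgn (ndu x)))//.
    by apply: ereal_sup_ubound; exists m.
  have fu m : (\int[P]_x u m x)%E \is a fin_num.
    rewrite ge0_fin_numE ?integral_ge0//; apply: le_lt_trans foo.
    exact: ge0_le_integral.
  have ff : (\int[P]_x f x)%E \is a fin_num by rewrite ge0_fin_numE ?integral_ge0.
  have ucvg : (fun m => fine (\int[P]_x u m x)%E) @ \oo --> fine (\int[P]_x f x)%E.
    apply: fine_cvg; rewrite fineK//.
    rewrite (eq_integral (fun x => limn (u^~ x))); last by move=> x _; exact/esym/cvg_lim.
    by apply: cvg_monotone_convergence.
  apply: cvg_approx => e e0.
  have /cvgrPdist_le /(_ e e0) [N _ /(_ N (leqnn N))/=] := ucvg.
  rewrite ger0_norm; last first.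
    by rewrite subr_ge0 fine_le//; exact: ge0_le_integral.
  move=> Ne; exists (fun L => fine (\int[P]_x ((g L x)%:E * u N x))%E),
    (fine (\int[P]_x ((G x)%:E * u N x))%E); split.
  + by apply: IHu; rewrite -ge0_fin_numE ?integral_ge0.
  + by move=> L; apply: le_trans Ne; exact: le_weighted.
  + by apply: le_trans Ne; exact: le_weighted.
Qed.

(** Integrating over [E] under [Q] is integrating under [P] against the density of [Q] cut off to
    [E]. *)
Lemma cvg_integral_dominated (E : set X) : Q `<< P -> measurable E ->
  (fun L => \int[Q]_(x in E) g L x) @ F --> \int[Q]_(x in E) G x.
Proof.
move=> QP mE; have [f [f0 ffin fint fE]] := @radon_nikodym_sigma_finite _ _ _ P Q QP.
have mf : measurable_fun setT f by case/integrableP: fint.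
have fK x : (fine (f x))%:E = f x by rewrite fineK.
have QE (a : X -> R) : (forall x, 0 <= a x <= 1) -> measurable_fun setT a ->
    \int[Q]_(x in E) a x = fine (\int[P]_x ((a x)%:E * (f \_ E) x))%E.
  move=> a01 ma; rewrite /Rintegral integral_mkcond; congr fine.
  have mr : measurable_fun setT ((EFin \o a) \_ E).
    by apply/(measurable_restrictT _ mE)/measurable_funTS/measurable_EFinP.
  have r0 x : (0 <= ((EFin \o a) \_ E) x)%E.
    by rewrite patchE; case: ifPn => // _; rewrite lee_fin; case/andP: (a01 x).
  transitivity (\int[Q]_x ((cst 1 x)%:E * ((EFin \o a) \_ E) x))%E.
    by apply: eq_integral => x _; rewrite mul1e.
  rewrite (weighted_transfer (M2 := P) (e2 := id) (h2 := fine \o f))//.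
  - apply: eq_integral => x _ /=; rewrite fK !patchE; case: ifPn => _; rewrite ?mule0//.
    by rewrite muleC.
  - by move=> x; exact: fine_ge0.
  - by apply/measurable_EFinP; rewrite (_ : EFin \o _ = f)//; apply/funext => x /=; rewrite fK.
  - move=> C mC; under eq_integral do rewrite mul1e.
    rewrite integral_indic// setIT; etransitivity; first exact: (fE C mC).
    rewrite [LHS]integral_mkcond; apply: eq_integral => x _ /=.
    by rewrite fK patchE indicE; case: ifPn; rewrite ?mule1 ?mule0.
under eq_fun do rewrite QE//.
rewrite QE//; apply: cvg_integral_weighted.
- by move=> x; rewrite patchE; case: ifPn.
- by apply/(measurable_restrictT _ mE); exact: measurable_funTS.
- rewrite -integral_mkcond; have <- := fE E mE.
  by rewrite ltey_eq fin_num_measure.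
Qed.

End dominated_extension.

(** * Binary expansions *)

Section binary_digits.
Variable R : realType.
Implicit Type d : nat -> bool.

Definition dpart d (m : nat) : R := \sum_(i < m) (d i)%:R / 2 ^+ i.+1.

Definition dval d : R := limn (dpart d).

Lemma dpartS d m : dpart d m.+1 = dpart d m + (d m)%:R / 2 ^+ m.+1.
Proof. by rewrite /dpart big_ord_recr. Qed.

Lemma dpart0 d : dpart d 0 = 0.
Proof. by rewrite /dpart big_ord0. Qed.

Lemma dpart_nd d : nondecreasing_seq (dpart d).
Proof.
apply/nondecreasing_seqP => m; rewrite dpartS lerDl divr_ge0// ?ler0n// exprn_ge0//.
Qed.

Lemma dpart_le d m n : (m <= n)%N -> dpart d n <= dpart d m + (2 ^- m - 2 ^- n).
Proof.
move=> /subnK <-; elim: (n - m)%N => [|k IH]; first by rewrite add0n subrr addr0.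
rewrite addSn dpartS.
have e : 2 ^- (k + m) = 2 * 2 ^- (k + m).+1 :> R.
  by rewrite exprSr invfM mulrCA mulfV ?mulr1.
have : 0 < 2 ^- (k + m).+1 :> R by rewrite invr_gt0 exprn_gt0.
case: (d _); rewrite ?mul1r ?mul0r; lra.
Qed.

Lemma dpart_cvg d : dpart d @ \oo --> dval d.
Proof.
apply: nondecreasing_is_cvgn; first exact: dpart_nd.
exists 1 => _ [m _ <-]; have := dpart_le d (leq0n m).
rewrite dpart0 expr0 invr1.
have : 0 < 2 ^- m :> R by rewrite invr_gt0 exprn_gt0.
lra.
Qed.

Lemma dval_bounds d m : dpart d m <= dval d <= dpart d m + 2 ^- m.
Proof.
apply/andP; split.
  apply: (cvgr_to_ge (dpart_cvg (d := d))).
  by exists m => // n /= mn; exact: dpart_nd.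
apply: (cvgr_to_le (dpart_cvg (d := d))).
exists m => // n /= mn; apply: le_trans (dpart_le d mn) _.
by rewrite lerD2l gerBl invr_ge0 exprn_ge0.
Qed.

Lemma dval01 d : 0 <= dval d <= 1.
Proof. by have := dval_bounds d 0; rewrite dpart0 expr0 invr1 add0r. Qed.

Lemma dval_close d d' m : (forall i, (i < m)%N -> d i = d' i) ->
  `|dval d - dval d'| <= 2 ^- m.
Proof.
move=> dd'; have := dval_bounds d m; have := dval_bounds d' m.
have -> : dpart d m = dpart d' m by apply: eq_bigr => i _; rewrite dd'.
by move=> /andP[? ?] /andP[? ?]; rewrite ler_norml; apply/andP; split; lra.
Qed.

Fixpoint grem (x : R) (m : nat) : R :=
  if m is m'.+1 then 2 * grem x m' - ((2^-1 : R) <= grem x m')%R%:R else x.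

(* Greedy binary digits; [grem] is the rescaled remainder, kept inside [[0, 1]]. *)
Definition gdig x m : bool := (2^-1 : R) <= grem x m.

(** The right end is included: the remainder 1 reproduces itself, so [x = 1] receives only digits
    1. *)
Lemma grem01 x m : 0 <= x <= 1 -> 0 <= grem x m <= 1.
Proof.
move=> x01; elim: m => //= m /andP[r0 r1].
by case: (lerP 2^-1 (grem x m)) => h /=; apply/andP; split; lra.
Qed.

Lemma gdig_part x m : x = dpart (gdig x) m + grem x m * 2 ^- m.
Proof.
elim: m => [|m IH]; first by rewrite dpart0 add0r expr0 invr1 mulr1.
rewrite dpartS {1}IH /= -/(gdig x m).
have -> : 2 ^- m = 2 * 2 ^- m.+1 :> R.
  by rewrite exprSr invfM mulrCA mulfV ?mulr1.
ring.
Qed.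

Lemma dval_gdig x : 0 <= x <= 1 -> dval (gdig x) = x.
Proof.
move=> x01; apply: (cvgR_unique (F := \oo) (dpart_cvg (d := gdig x))).
apply/cvgrPdist_le => e e0; near=> m.
rewrite {1}(gdig_part x m) addrC addKr.
have /andP[r0 r1] := grem01 m x01.
have p0 : 0 < 2 ^- m :> R by rewrite invr_gt0 exprn_gt0.
rewrite ger0_norm ?mulr_ge0 ?(ltW p0)//.
apply: (@le_trans _ _ (2 ^- m)); first by rewrite ger_pMl.
near: m.
have /cvgrPdist_le /(_ e e0) : (fun m => 2^-1 ^+ m : R) @ \oo --> (0 : R).
  by apply: cvg_expr; rewrite ger0_norm; lra.
apply: filterS => m /=; rewrite sub0r normrN ger0_norm ?exprVn//.
Unshelve. all: by end_near. Qed.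

End binary_digits.

(** Polynomials in the entries of a table, as syntax so that continuity follows by induction. They
    include the products over the players and the squares of linear relations. *)
Inductive cpoly (R J : Type) : Type :=
| PConst of R | PVar of J | PAdd of cpoly R J & cpoly R J | PMul of cpoly R J & cpoly R J.
Arguments PConst {R J}.
Arguments PVar {R J}.
Arguments PAdd {R J}.
Arguments PMul {R J}.

Fixpoint peval (R : realType) (J : Type) (v : J -> R) (p : cpoly R J) : R :=
  match p with
  | PConst r => r
  | PVar j => v j
  | PAdd p q => peval v p + peval v q
  | PMul p q => peval v p * peval v q
  end.

(** * Limits of empirical averages *)

Section empirical_limit.
Variables (R : realType) (F : set_system nat) (UF : UltraFilter F).
Variables (T : nat -> nat) (T0 : forall L, (0 < T L)%N).

Definition emp (A : Type) (x : nat -> nat -> A) (phi : A -> R) (L : nat) : R :=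
  (T L)%:R^-1 * \sum_(i < T L) phi (x L i).

Section emp_theory.
Variables (A : Type) (x : nat -> nat -> A).
Implicit Types phi psi : A -> R.

Lemma emp_cst c L : emp x (fun=> c) L = c.
Proof.
rewrite /emp sumr_const card_ord -[X in _ * X]mulr_natl mulrA mulVf ?mul1r//.
by rewrite pnatr_eq0 -lt0n.
Qed.

Lemma empD phi psi L : emp x (fun a => phi a + psi a) L = emp x phi L + emp x psi L.
Proof. by rewrite /emp big_split mulrDr. Qed.

Lemma empM c phi L : emp x (fun a => c * phi a) L = c * emp x phi L.
Proof. by rewrite /emp -mulr_sumr mulrCA. Qed.

Lemma emp_le phi psi L : (forall a, phi a <= psi a) -> emp x phi L <= emp x psi L.
Proof.
by move=> le; rewrite /emp ler_wpM2l ?invr_ge0 ?ler0n//; apply: ler_sum => i _.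
Qed.

Lemma emp_norm phi e L : (forall a, `|phi a| <= e) -> `|emp x phi L| <= e.
Proof.
move=> le; rewrite ler_norml -{1}(emp_cst (- e) L) -{2}(emp_cst e L).
by apply/andP; split; apply: emp_le => a; have := le a; rewrite ler_norml => /andP[].
Qed.

End emp_theory.

(** Continuity on the Cantor space in its uniform form, which compactness makes equivalent to the
    pointwise one. *)
Definition ucont (phi : (nat -> bool) -> R) := forall e, 0 < e ->
  exists N, forall b b', (forall i, (i < N)%N -> b i = b' i) -> `|phi b - phi b'| <= e.

Section empirical_bits.
Variable z : nat -> nat -> nat -> bool.

Let freq_ex s : exists l : R, emp z (fun b => (mt b s)%:R) @ F --> l.
Proof.
apply: (@ultra_cvg_ex _ _ _ _ 1) => L; apply: emp_norm => b.
by case: mt; rewrite ?normr1 ?normr0.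
Qed.

Let w s : R := sval (cid (freq_ex s)).

Let wP s : emp z (fun b => (mt b s)%:R) @ F --> w s.
Proof. by rewrite /w; case: cid. Qed.

Let w_tree : is_tree w.
Proof.
split.
- apply: (cvgR_unique (@wP [::])); rewrite (_ : emp _ _ = fun=> 1).
    exact: cvg_cst.
  by apply/funext => L; rewrite emp_cst.
- move=> s; apply: (cvgr_to_ge (@wP s)); apply: nearW => L.
  by rewrite -(emp_cst z 0 L); apply: emp_le => b.
- move=> s; apply: (cvgR_unique (@wP s)).
  rewrite (_ : emp _ _ = fun L => emp z (fun b => (mt b (false :: s))%:R) L +
     emp z (fun b => (mt b (true :: s))%:R) L); first by apply: cvgD; exact: wP.
  apply/funext => L; rewrite -empD; congr (emp _ _ _); apply/funext => b /=.
  by case: (b _); case: mt; rewrite ?addr0 ?add0r.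
Qed.

Let S t := samp w t.

Let mS s : measurable [set t | mt (S t) s].
Proof.
by apply: (@measurable_samp R _ R (fun=> w) _ _ _ id id) => // s'; exact: measurable_cst.
Qed.

Let simple N (c : seq bool -> R) (b : nat -> bool) : R :=
  \sum_(s <- [seq val s | s : N.-tuple bool]) c s * (mt b s)%:R.

Let simpleE N c b : simple N c b = c (rpre b N).
Proof.
have sN : size (rpre b N) == N by rewrite size_rpre.
rewrite /simple big_image/= (bigD1 (Tuple sN))//= mt_rpre_same mulr1 big1 ?addr0//.
move=> s; rewrite -val_eqE/= => /negPf sn.
by rewrite mt_rpre size_tuple eq_sym sn mulr0.
Qed.

(** Some sequence starting with [s]; when [phi] varies by at most [e] on cells of that length, the
    choice costs at most [e]. *)
Let word s : nat -> bool := xget (fun=> false) [set b | mt b s].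

Let simple_close phi e N : (forall b b', (forall i, (i < N)%N -> b i = b' i) -> `|phi b - phi b'| <= e) ->
  forall b, `|phi b - simple N (phi \o word) b| <= e.
Proof.
move=> H b; rewrite simpleE; apply: H => i iN.
have : mt (word (rpre b N)) (rpre b N).
  by rewrite /word; case: xgetP => // /(_ b); rewrite /= mt_rpre_same.
by move=> /mt_eq_bits /(_ (mt_rpre_same b N) i); rewrite size_rpre => /(_ iN) ->.
Qed.

Let m_simple N c : measurable_fun setT (fun t => simple N c (S t)).
Proof.
apply: measurable_sum => s; apply: measurable_funM => //.
rewrite (_ : (fun _ => _) = \1_[set t | mt (S t) s]); first by apply: measurable_indic; exact: mS.
by apply/funext => t; rewrite indicE /=; case: (boolP (mt _ s)) => h;
  [rewrite mem_set|rewrite memNset//; apply/negP].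
Qed.

Let simple_bound N c b : `|simple N c b| <= \sum_(s : N.-tuple bool) `|c s|.
Proof.
rewrite simpleE.
have sN : size (rpre b N) == N by rewrite size_rpre.
by rewrite (bigD1 (Tuple sN))//= lerDl sumr_ge0.
Qed.

Let ucont_bounded phi : ucont phi -> exists M, forall b, `|phi b| <= M.
Proof.
move=> /(_ 1 ltr01)[N /simple_close H].
exists (1 + \sum_(s : N.-tuple bool) `|(phi \o word) s|) => b.
by rewrite -(subrK (simple N (phi \o word) b) (phi b)) (le_trans (ler_normD _ _))// lerD.
Qed.

Let m_ucont phi : ucont phi -> measurable_fun setT (phi \o S).
Proof.
move=> u; have /choice[N HN] : forall k : nat, exists N, forall b b',
   (forall i, (i < N)%N -> b i = b' i) -> `|phi b - phi b'| <= k.+1%:R^-1.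
  by move=> k; apply: u; rewrite invr_gt0 ltr0n.
apply: (@measurable_fun_cvg _ _ _ _ (fun k t => simple (N k) (phi \o word) (S t))).
  by move=> k; exact: m_simple.
move=> t _; apply/cvgrPdist_le => e e0.
near=> k; apply: le_trans (simple_close (HN k) (S t)) _.
by apply: ltW; near: k; exact: (near_infty_natSinv_lt (PosNum e0)).
Unshelve. all: by end_near. Qed.

Let int_mt s : unif01.-integrable setT (EFin \o (fun t => (mt (S t) s)%:R)).
Proof.
apply: (@bounded_integrable _ _ _ _ 1) => //; last by move=> t; case: mt; rewrite ?normr1 ?normr0.
rewrite (_ : (fun _ => _) = \1_[set t | mt (S t) s]); first by apply: measurable_indic; exact: mS.
by apply/funext => t; rewrite indicE /=; case: (boolP (mt _ s)) => h;
  [rewrite mem_set|rewrite memNset//; apply/negP].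
Qed.

Let int_mtE s : \int[unif01]_t (mt (S t) s)%:R = w s.
Proof.
rewrite /Rintegral (eq_integral (fun t => (\1_[set t | mt (S t) s] t)%:E)); last first.
  move=> t _; rewrite indicE /=; case: (boolP (mt _ s)) => h;
  by [rewrite mem_set|rewrite memNset//; apply/negP].
rewrite integral_indic; [|exact: measurableT|exact: mS].
by rewrite setIT -[RHS]/(fine (w s)%:E); congr fine; exact: unif01_samp.
Qed.

Let cvg_simple c (l : seq (seq bool)) :
  unif01.-integrable setT (EFin \o (fun t => \sum_(s <- l) c s * (mt (S t) s)%:R)) /\
  emp z (fun b => \sum_(s <- l) c s * (mt b s)%:R) @ F -->
    \int[unif01]_t (\sum_(s <- l) c s * (mt (S t) s)%:R).
Proof.
elim: l => [|s l [il IH]].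
  under eq_fun do rewrite big_nil.
  split; first exact: integrable0.
  rewrite (_ : emp _ _ = fun=> 0).
    rewrite (_ : Rintegral _ _ _ = 0); first exact: cvg_cst.
    by rewrite /Rintegral integral0_eq// => t _; rewrite big_nil.
  by apply/funext => L; rewrite -[RHS](emp_cst z 0 L); congr (emp _ _ _); apply/funext => b; rewrite big_nil.
have isw : unif01.-integrable setT (EFin \o (fun t => c s * (mt (S t) s)%:R)).
  exact: (integrableZl measurableT (c s) (int_mt s)).
split.
  under eq_fun do rewrite big_cons.
  exact: (integrableD measurableT isw il).
rewrite (_ : Rintegral _ _ _ = c s * w s + \int[unif01]_t (\sum_(s <- l) c s * (mt (S t) s)%:R)).
  rewrite (_ : emp _ _ = fun L => c s * emp z (fun b => (mt b s)%:R) L +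
      emp z (fun b => \sum_(s <- l) c s * (mt b s)%:R) L).
    by apply: cvgD => //; apply: cvgMl_tmp; exact: wP.
  apply/funext => L; rewrite -empM -empD; congr (emp _ _ _).
  by apply/funext => b; rewrite big_cons.
rewrite -int_mtE -RintegralZl// -RintegralD//.
by apply: eq_Rintegral => t _; rewrite big_cons.
Qed.

(** Compactness of laws on the Cantor space, with the limit law represented by a uniform variable.
    The limiting frequencies of words form a tree, which settles locally constant functions; these
    approximate [phi] uniformly. *)
Lemma empirical_bits_limit : exists S : R -> nat -> bool,
  forall phi, ucont phi ->
  [/\ exists M, forall b, `|phi b| <= M,
    measurable_fun setT (phi \o S) &
    emp z phi @ F --> \int[unif01]_t phi (S t)].
Proof.
exists S => phi u; have [M phiM] := ucont_bounded u.
split; [by exists M|exact: m_ucont|].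
have iphi : unif01.-integrable setT (EFin \o (phi \o S)).
  by apply: (@bounded_integrable _ _ _ _ M) => //; [exact: m_ucont|move=> t; exact: phiM].
apply: cvg_approx => e e0; have [N /simple_close H] := u e e0.
set c := phi \o word in H.
have [isimple cvgs] := cvg_simple c [seq val s | s : N.-tuple bool].
exists (emp z (simple N c)), (\int[unif01]_t simple N c (S t)); split => //.
- move=> L; rewrite -[X in `|_ - X|]mul1r -mulNr -empM -empD.
  by apply: emp_norm => b; rewrite mulN1r.
- rewrite -RintegralB//; apply: (@le_trans _ _ (\int[unif01]_t e)); last first.
    by rewrite Rintegral_cst//= /fine probability_setT mulr1.
  apply: (le_trans (le_normr_Rintegral measurableT (integrableB measurableT iphi isimple))).
  apply: le_Rintegral => //.
  + apply: integrable_norm => //; exact: (integrableB measurableT iphi isimple).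
  + exact: finite_measure_integrable_cst.
  + by move=> t _; exact: H.
Qed.

End empirical_bits.

Lemma ucont_cst c : ucont (fun=> c).
Proof. by move=> e e0; exists 0%N => b b' _; rewrite subrr normr0 ltW. Qed.

Lemma ucontD phi psi : ucont phi -> ucont psi -> ucont (fun b => phi b + psi b).
Proof.
move=> u v e e0; have e2 : 0 < e / 2 by rewrite divr_gt0.
have [[N HN] [N' HN']] := (u _ e2, v _ e2).
exists (maxn N N') => b b' bb'.
rewrite opprD addrACA (splitr e) (le_trans (ler_normD _ _))// lerD//.
  by apply: HN => i iN; apply: bb'; rewrite leq_max iN.
by apply: HN' => i iN; apply: bb'; rewrite leq_max iN orbT.
Qed.

Lemma ucontM phi psi : ucont phi -> ucont psi -> ucont (fun b => phi b * psi b).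
Proof.
move=> u v e e0.
(* An arbitrary sample, taken only for the bounds on [phi] and [psi]. *)
have [S HS] := empirical_bits_limit (fun _ _ _ => false).
have [[M phiM] _ _] := HS _ u; have [[K psiK] _ _] := HS _ v.
have M0 : 0 <= M by apply: le_trans (phiM (fun=> false)).
have K0 : 0 <= K by apply: le_trans (psiK (fun=> false)).
have MK : 0 < M + K + 1 by rewrite ltr_wpDl// addr_ge0.
have e2 : 0 < e / (M + K + 1) by rewrite divr_gt0.
have [[N HN] [N' HN']] := (u _ e2, v _ e2).
exists (maxn N N') => b b' bb'.
have -> : phi b * psi b - phi b' * psi b' =
  phi b * (psi b - psi b') + (phi b - phi b') * psi b' by ring.
have h1 : `|psi b - psi b'| <= e / (M + K + 1).
  by apply: HN' => i iN; apply: bb'; rewrite leq_max iN orbT.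
have h2 : `|phi b - phi b'| <= e / (M + K + 1).
  by apply: HN => i iN; apply: bb'; rewrite leq_max iN.
rewrite (le_trans (ler_normD _ _))// !normrM.
apply: (@le_trans _ _ (M * (e / (M + K + 1)) + e / (M + K + 1) * K)).
  by apply: lerD; apply: ler_pM.
rewrite mulrC -mulrDr mulrAC ler_pdivrMr// ler_pM2l//; lra.
Qed.

Section empirical_tables.
Variable J : countType.

(** The digits of all the entries of a countable table are interleaved in one bit sequence. *)
Let dec (b : nat -> bool) (j : J) : R := dval R (fun m => b (choice.pickle (j, m))).

Let ucont_dec j : ucont (dec ^~ j).
Proof.
move=> e e0; have [N HN] : exists N, 2 ^- N <= e.
  have [N _ /(_ N (leqnn N)) HN] := near_infty_natSinv_lt (PosNum e0).
  exists N; apply: le_trans (ltW HN); rewrite lef_pV2 ?posrE ?exprn_gt0 ?ltr0n//.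
  by rewrite -natrX ler_nat ltn_expl.
(* A length that covers the positions of the first [N] digits of entry [j]. *)
pose M := (\max_(m < N) choice.pickle (j, nat_of_ord m)).+1.
exists M => b b' bb'; apply: le_trans HN; apply: dval_close => m mN.
apply: bb'; rewrite ltnS; exact: (leq_bigmax (F := fun m : 'I_N => choice.pickle (j, nat_of_ord m)) (Ordinal mN)).
Qed.

(* Limits of all polynomial averages along [F] are realised by one random table:
   its entries are read off a limit law on bit sequences. *)
Lemma empirical_tables_limit (x : nat -> nat -> J -> R) :
  (forall L i j, 0 <= x L i j <= 1) ->
  exists X : R -> J -> R, [/\ forall j, measurable_fun setT (X ^~ j),
    forall t j, 0 <= X t j <= 1 &
    forall p : cpoly R J,
    [/\ measurable_fun setT (fun t => peval (X t) p),
      exists M, forall t, `|peval (X t) p| <= M &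
      emp x (fun v => peval v p) @ F --> \int[unif01]_t peval (X t) p]].
Proof.
move=> x01.
(* Positions that code no pair get the bit false; [dec] reads only the others. *)
pose z L i k := if choice.unpickle k is Some (j, m) then gdig (x L i j) m else false.
have decz L i : dec (z L i) = x L i.
  apply/funext => j; rewrite /dec -[RHS](dval_gdig (x01 L i j)); congr (dval _ _).
  by apply/funext => m; rewrite /z choice.pickleK.
have [S HS] := empirical_bits_limit z.
have up (p : cpoly R J) : ucont (fun b => peval (dec b) p).
  elim: p => [r|j|p IHp q IHq|p IHp q IHq] /=.
  - exact: ucont_cst.
  - exact: ucont_dec.
  - exact: ucontD.
  - exact: ucontM.
exists (fun t => dec (S t)); split.
- by move=> j; have [_ + _] := HS _ (up (PVar j)).
- by move=> t j; exact: dval01.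
move=> p; have [[M pM] mp cp] := HS _ (up p); split => //.
- by exists M => t; exact: pM.
rewrite (_ : emp x _ = emp z (fun b => peval (dec b) p))//; apply/funext => L.
by rewrite /emp; congr (_ * _); apply: eq_bigr => i _; rewrite decz.
Qed.

End empirical_tables.
End empirical_limit.

(** * Cylinder sets and coding of standard Borel spaces *)

Lemma mt_agree b b' s : (forall i, (i < size s)%N -> b i = b' i) -> mt b s = mt b' s.
Proof. by move=> bb'; rewrite !mt_rpre (rpre_eq bb'). Qed.

(** If some sequence matches both words, the shorter one is an initial part of the longer, which
    then decides alone. *)
Lemma mt_cap s s' : (exists s'', forall b, mt b s && mt b s' = mt b s'') \/
  (forall b, mt b s && mt b s' = false).
Proof.
wlog ss' : s s' / (size s <= size s')%N.
  move=> H; have [/H//|/ltnW/H] := leqP (size s) (size s').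
  by case=> [[s'' h]|h]; [left; exists s''|right] => b; rewrite andbC h.
have [[b0 /andP[b0s b0s']]|no] := pselect (exists b, mt b s && mt b s').
  left; exists s' => b; apply: andb_idl => bs'.
  rewrite (@mt_agree _ b0)// => i il.
  by apply: (mt_eq_bits bs' b0s'); exact: leq_trans ss'.
by right => b; apply/negP => h; apply: no; exists b.
Qed.

(** The empty set is included for closure under intersection. *)
Definition cells : set (set (nat -> bool)) :=
  [set C | C = set0 \/ exists s, C = [set b | mt b s]].

Definition cantor_bits := g_sigma_algebraType cells.

Lemma cells_setI : setI_closed cells.
Proof.
move=> A B [->|[s ->]]; first by left; rewrite set0I.
move=> [->|[s' ->]]; first by left; rewrite setI0.
have [[s'' h]|h] := mt_cap s s'; [right; exists s''|left].
  by apply/seteqP; split => b /=; rewrite -h => /andP.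
by apply/seteqP; split => b //= [bs bs']; have := h b; rewrite bs bs'.
Qed.

Lemma cells_setT : cells setT.
Proof. by right; exists [::]; apply/seteqP; split. Qed.

Lemma measurable_cell s : measurable ([set b | mt b s] : set cantor_bits).
Proof. by apply: sub_sigma_algebra; right; exists s. Qed.

Lemma measurable_bit n : measurable ([set b : nat -> bool | b n] : set cantor_bits).
Proof.
rewrite (_ : [set b : nat -> bool | b n] =
    \bigcup_(s : n.-tuple bool) [set b : nat -> bool | mt b (true :: s)]).
  by apply: countable_bigcupT_measurable => // s; exact: measurable_cell.
apply/seteqP; split => [b /= bn|b [s _ /=]].
  have sn : size (rpre b n) == n by rewrite size_rpre.
  by exists (Tuple sn); rewrite //= size_rpre bn mt_rpre_same.
by rewrite size_tuple => /andP[/eqP].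
Qed.

Section measurable_to_bits.
Context d (P : measurableType d) (e : P -> cantor_bits).

Lemma measurable_fun_cells :
  (forall s, measurable [set p | mt (e p) s]) -> measurable_fun setT e.
Proof.
move=> me; apply: (@measurability _ _ P cantor_bits setT e cells) => // _ [C] [->|[s ->]] <-.
  by rewrite preimage_set0 setI0.
by rewrite setTI; exact: me.
Qed.

Lemma measurable_cell_bits s :
  (forall n, measurable [set p | e p n]) -> measurable [set p | mt (e p) s].
Proof.
move=> me; elim: s => [|c s IH].
  by rewrite (_ : [set _ | _] = setT) //; apply/seteqP; split.
rewrite (_ : [set _ | _] = [set p | e p (size s) == c] `&` [set p | mt (e p) s]).
  apply: measurableI => //; case: c.
    rewrite (_ : [set _ | _] = [set p | e p (size s)])//.
    by apply/seteqP; split => p /= /eqP.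
  rewrite (_ : [set _ | _] = ~` [set p | e p (size s)]); first exact: measurableC.
  by apply/seteqP; split => p /=; [move=> /eqP ->|move=> /negP/negPf ->].
by apply/seteqP; split => p /= => /andP.
Qed.

End measurable_to_bits.

Section coding.
Variable R : realType.

Let q (n : nat) : R := ratr (odflt 0 (choice.unpickle n)).

(* A point is coded by its rational Dedekind cut in the line and decoded by an
   infimum. *)
Lemma standard_borel_coding d (T : measurableType d) (t0 : T) :
  standard_borel R T -> exists (beta : T -> cantor_bits) (D : cantor_bits -> T),
  [/\ measurable_fun setT beta, measurable_fun setT D & forall y, D (beta y) = y].
Proof.
move=> [f [finj mf mrf mfA]].
pose beta y : cantor_bits := fun n => f y < q n.
(* The infimum of the rationals in the cut; on the code of [y] it is [f y] by density. *)
pose r (b : cantor_bits) : \bar R := einfs (fun n => if b n then (q n)%:E else +oo%E) 0%N.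
pose D (b : cantor_bits) : T :=
  if pselect (exists y, (f y)%:E = r b) is left h then sval (cid h) else t0.
have rbeta y : r (beta y) = (f y)%:E.
  rewrite /r /einfs/=; apply/eqP; rewrite eq_le; apply/andP; split.
    apply/lee_addgt0Pr => e e0.
    have : f y < f y + e by rewrite ltrDl.
    move=> /rat_in_itvoo[z]; rewrite in_itv/= => /andP[fz ze].
    have qz : q (choice.pickle z) = ratr z by rewrite /q choice.pickleK.
    apply: (@le_trans _ _ (ratr z)%:E); last by rewrite -EFinD lee_fin ltW.
    by apply: ereal_inf_lbound; exists (choice.pickle z) => //=; rewrite /beta qz fz.
  by apply: le_ereal_inf_tmp => _ [n _ <-] /=; case: ifPn => [/ltW|_]; rewrite ?leey ?lee_fin.
exists beta, D; split.
- apply: measurable_fun_cells => s; apply: measurable_cell_bits => n.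
  have mlt : measurable_fun setT (fun y => f y < q n).
    exact: (measurable_fun_ltr mf (measurable_cst (q n))).
  have := mlt measurableT [set true] I.
  by rewrite setTI; congr measurable; apply/seteqP; split.
- have mr : measurable_fun setT r.
    apply: (@measurable_fun_einfs _ _ _ setT
      (fun n (b : cantor_bits) => if b n then (q n)%:E else +oo%E)) => n.
    apply: measurable_fun_ifT; [|exact: measurable_cst|exact: measurable_cst].
    apply: (measurable_fun_bool true); rewrite setTI.
    by rewrite (_ : _ @^-1` _ = [set b : nat -> bool | b n]); [exact: measurable_bit|apply/seteqP; split].
  have mpre A : measurable A -> measurable (r @^-1` (EFin @` (f @` A))).
    by move=> mA; rewrite -[_ @^-1` _]setTI; apply: mr => //; apply: measurable_image_EFin; exact: mfA.
  move=> _ B mB; rewrite setTI.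
  (* A sequence decodes into [B] either because its infimum lies in the image of [B], or because it
     codes no point and the default [t0] lies in [B]. Images under [f] are measurable, so both sets
     are. *)
  have -> : D @^-1` B = (r @^-1` (EFin @` (f @` B))) `|`
      (if pselect (B t0) then ~` (r @^-1` (EFin @` (f @` setT))) else set0).
    apply/seteqP; split => b /=; rewrite /D; case: (pselect (exists y, (f y)%:E = r b)) => [h|nh].
    - case: cid => y /= yr By; left; exists (f y) => //; by exists y.
    - move=> Bt0; right; case: pselect => //= _ [_ [y _ <-] yr].
      by apply: nh; exists y.
    - case=> [[_ [y By <-] yr]|]; first by case: cid => y' /=; rewrite -yr => -[/finj ->].
      case: pselect => //= _ H; case: h => y yr; exfalso; apply: H; exists (f y) => //.
      by exists y.
    - case=> [[_ [y By <-] yr]|]; first by exfalso; apply: nh; exists y.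
      by case: pselect.
  apply: measurableU; first exact: mpre.
  by case: pselect => ? /=; [apply: measurableC; exact: mpre|exact: measurable0].
move=> y; rewrite /D; case: pselect => [h|]; last by case; exists y; rewrite rbeta.
by case: cid => y' /=; rewrite rbeta => -[]; exact: finj.
Qed.

End coding.

(** * Fubini for functions with values in the unit interval, and almost sure identities *)

Section Rfubini.
Context d1 d2 (T1 : measurableType d1) (T2 : measurableType d2) (R : realType).
Variables (P1 : probability T1 R) (P2 : probability T2 R).
Variable f : T1 * T2 -> R.
Hypotheses (mf : measurable_fun setT f) (f01 : forall p, 0 <= f p <= 1).

Let mfE : measurable_fun setT (EFin \o f). Proof. exact/measurable_EFinP. Qed.

Let fE0 p : (0 <= (EFin \o f) p)%E. Proof. by rewrite lee_fin; case/andP: (f01 p). Qed.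

Let mf1 x : measurable_fun setT (fun y => f (x, y)).
Proof. exact: measurableT_comp mf (pair1_measurable x). Qed.

Let mf2 y : measurable_fun setT (fun x => f (x, y)).
Proof. exact: measurableT_comp mf (pair2_measurable y). Qed.

Lemma Rint1E x : (\int[P2]_y f (x, y))%:E = (\int[P2]_y (f (x, y))%:E)%E.
Proof. by rewrite /Rintegral fineK//; apply: integrable_fin_num => //; exact: integrable01. Qed.

Lemma Rint2E y : (\int[P1]_x f (x, y))%:E = (\int[P1]_x (f (x, y))%:E)%E.
Proof. by rewrite /Rintegral fineK//; apply: integrable_fin_num => //; exact: integrable01. Qed.

Lemma measurable_Rint1 : measurable_fun setT (fun x => \int[P2]_y f (x, y)).
Proof.
apply/measurable_EFinP.
rewrite (_ : EFin \o _ = fun x => \int[P2]_y (f (x, y))%:E)%E; last by apply/funext => x /=; rewrite Rint1E.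
exact: (measurable_fun_fubini_tonelli_F (EFin \o f)).
Qed.

Lemma measurable_Rint2 : measurable_fun setT (fun y => \int[P1]_x f (x, y)).
Proof.
apply/measurable_EFinP.
rewrite (_ : EFin \o _ = fun y => \int[P1]_x (f (x, y))%:E)%E; last by apply/funext => y /=; rewrite Rint2E.
exact: (measurable_fun_fubini_tonelli_G (EFin \o f)).
Qed.

Lemma Rfubini1 : \int[(P1 \x P2)%E]_p f p = \int[P1]_x \int[P2]_y f (x, y).
Proof.
rewrite /Rintegral (fubini_tonelli1 (EFin \o f))//; congr fine.
by apply: eq_integral => x _; exact/esym/Rint1E.
Qed.

Lemma Rfubini2 : \int[(P1 \x P2)%E]_p f p = \int[P2]_y \int[P1]_x f (x, y).
Proof.
rewrite /Rintegral (fubini_tonelli2 (EFin \o f))//; congr fine.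
by apply: eq_integral => y _; exact/esym/Rint2E.
Qed.

End Rfubini.

Section Rfubini_rect.
Context d1 d2 (T1 : measurableType d1) (T2 : measurableType d2) (R : realType).
Variables (P1 : probability T1 R) (P2 : probability T2 R).
Variable f : T1 * T2 -> R.
Hypotheses (mf : measurable_fun setT f) (f01 : forall p, 0 <= f p <= 1).
Variables (A : set T1) (B : set T2).
Hypotheses (mA : measurable A) (mB : measurable B).

Let patch01 d (T : measurableType d) (u : T -> R) C : (forall x, 0 <= u x <= 1) ->
  forall x, 0 <= (u \_ C) x <= 1.
Proof. by move=> u01 x; rewrite patchE; case: ifPn => // _; rewrite lexx ler01. Qed.

Let mpatch d (T : measurableType d) (u : T -> R) C : measurable C ->
  measurable_fun setT u -> measurable_fun setT (u \_ C).
Proof. by move=> mC mu; apply/(measurable_restrictT _ mC); exact: measurable_funTS. Qed.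

Lemma measurable_Rint2_in : measurable_fun setT (fun y => \int[P1]_(x in A) f (x, y)).
Proof.
under eq_fun do rewrite Rintegral_mkcond.
pose g : T1 * T2 -> R := f \_ (A `*` setT).
have mg : measurable_fun setT g by apply: mpatch => //; exact: measurableX.
rewrite (_ : (fun _ => _) = fun y => \int[P1]_x g (x, y)).
  exact: (@measurable_Rint2 _ _ _ _ _ P1 g mg (patch01 _ f01)).
apply/funext => y; apply: eq_Rintegral => x _; rewrite /g !patchE.
by rewrite in_setX /= in_setT andbT.
Qed.

Lemma Rfubini2_in : \int[(P1 \x P2)%E]_(p in A `*` B) f p =
  \int[P2]_(y in B) \int[P1]_(x in A) f (x, y).
Proof.
have mg : measurable_fun setT (f \_ (A `*` B)) by apply: mpatch => //; exact: measurableX.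
rewrite Rintegral_mkcond (Rfubini2 _ _ mg (patch01 _ f01)) [RHS]Rintegral_mkcond.
apply: eq_Rintegral => y _; rewrite patchE; case: ifPn => yB.
  rewrite [RHS]Rintegral_mkcond; apply: eq_Rintegral => x _; rewrite !patchE.
  by rewrite in_setX /= yB andbT.
rewrite /Rintegral integral0_eq// => x _; rewrite patchE in_setX /= (negPf yB).
by rewrite andbF.
Qed.

End Rfubini_rect.

Lemma ae_eq01 d (T : measurableType d) (R : realType) (P : probability T R) (f g : T -> R) :
  measurable_fun setT f -> measurable_fun setT g ->
  P.-integrable setT (EFin \o f) -> P.-integrable setT (EFin \o g) ->
  (forall E, measurable E -> \int[P]_(x in E) f x = \int[P]_(x in E) g x) ->
  {ae P, forall x, f x = g x}.
Proof.
move=> mf mg i_f ig fg.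
have : ae_eq P setT (EFin \o f) (EFin \o g).
  apply: integral_ae_eq => //; first exact/measurable_EFinP.
  move=> E _ mE.
  have fin (u : T -> R) : P.-integrable setT (EFin \o u) -> (\int[P]_(x in E) (EFin \o u) x)%E \is a fin_num.
    by move=> iu; apply: integrable_fin_num => //; exact: (integrableS measurableT).
  by rewrite -(fineK (fin _ i_f)) -(fineK (fin _ ig)); congr EFin; exact: fg.
by apply: filterS => x /(_ I) /= -[].
Qed.

Lemma ae_forall_countable d (T : measurableType d) (R : realType)
    (P : {measure set T -> \bar R}) (I : countType) (A : I -> T -> Prop) :
  (forall i, {ae P, forall x, A i x}) -> {ae P, forall x, forall i, A i x}.
Proof.
move=> H.
have : forall n, {ae P, forall x, if choice.unpickle n is Some i then A i x else True}.
  by move=> n; case: (choice.unpickle n) => [i|]; [exact: H|apply: aeW].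
move=> /ae_foralln; apply: filterS => x Hx i.
by have := Hx (choice.pickle i); rewrite choice.pickleK.
Qed.

Lemma measurable_forall_countable d (T : measurableType d) (I : countType)
    (A : I -> set T) :
  (forall i, measurable (A i)) -> measurable [set x | forall i, A i x].
Proof.
move=> mA; rewrite (_ : [set _ | _] = ~` (\bigcup_i (~` A i))).
  apply: measurableC; apply: countable_bigcupT_measurable => // i.
  exact: measurableC.
apply/seteqP; split => x /=; first by move=> Ax [i _]; apply; exact: Ax.
by move=> nA i; apply: contrapT => nAi; apply: nA; exists i.
Qed.

(** * Conditional laws recovered from cell masses *)

Section conditional_trees.
Context d (Y : measurableType d) (R : realType) (Q : probability Y R).
Variable beta : Y -> cantor_bits.
Hypothesis mbeta : measurable_fun setT beta.

Definition cell_in s : set Y := [set y | mt (beta y) s].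

Lemma measurable_cell_in s : measurable (cell_in s).
Proof. by have := mbeta measurableT (measurable_cell s); rewrite setTI. Qed.

Definition qcell s : R := fine (Q (cell_in s)).

(** A joint law of signal and output, known on pairs of cells: [x s a] is the mass of signals in [s]
    with output in [a], and the signal marginal is [Q]. *)
Definition consistent (x : seq bool -> seq bool -> R) := forall s a,
  [/\ 0 <= x s a, x s [::] = qcell s, x s a = x (false :: s) a + x (true :: s) a &
      x s a = x s (false :: a) + x s (true :: a)].

Lemma consistent_le x s a : consistent x -> x s a <= qcell s.
Proof.
move=> cx; have [_ <- _ _] := cx s [::]; elim: a => // c a; apply: le_trans.
have [_ _ _ ->] := cx s a; have [+ _ _ _] := cx s (false :: a).
by have [+ _ _ _] := cx s (true :: a); case: c; lra.
Qed.

Variable X : R -> seq bool -> seq bool -> R.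
Hypothesis mX : forall s a, measurable_fun setT (fun t => X t s a).
Hypothesis cX : forall t, consistent (X t).

(** Conditional mass of the output cell [a] given the first [j] bits of the signal; over a null
    signal cell the quotient is 0. *)
Let g a (j : nat) (p : Y * R) : R :=
  X p.2 (rpre (beta p.1) j) a / qcell (rpre (beta p.1) j).

Let q_ge0 s : 0 <= qcell s. Proof. by rewrite fine_ge0. Qed.

Let g01 a j p : 0 <= g a j p <= 1.
Proof.
have [X0 _ _ _] := cX p.2 (rpre (beta p.1) j) a.
rewrite /g divr_ge0//=; have := q_ge0 (rpre (beta p.1) j).
rewrite le_eqVlt => /orP[/eqP <-|q0]; first by rewrite invr0 mulr0.
by rewrite ler_pdivrMr// mul1r consistent_le.
Qed.

Let gE a j p : g a j p =
  \sum_(s : j.-tuple bool) \1_(cell_in s) p.1 * (X p.2 s a / qcell s).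
Proof.
have sj : size (rpre (beta p.1) j) == j by rewrite size_rpre.
rewrite (bigD1 (Tuple sj))//= indicE mem_set ?mul1r; last exact: mt_rpre_same.
rewrite big1 ?addr0// => s; rewrite -val_eqE/= => sn.
rewrite indicE memNset ?mul0r// => /=; rewrite /cell_in/= mt_rpre size_tuple => /eqP e.
by rewrite e eqxx in sn.
Qed.

Let mg a j : measurable_fun setT (g a j).
Proof.
rewrite (_ : g a j = fun p => \sum_(s : j.-tuple bool) \1_(cell_in s) p.1 * (X p.2 s a / qcell s)).
  apply: measurable_sum => s; apply: measurable_funM.
    apply: (measurableT_comp _ measurable_fst); apply: measurable_indic.
    exact: measurable_cell_in.
  by apply: measurable_funM => //; exact: (measurableT_comp (mX s a) measurable_snd).
by apply/funext => p; rewrite gE.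
Qed.

(** Martingale property of cell averages: split the cell of [s] until its words have exactly [j]
    bits, where [g] is constant. *)
Let int_g a j t s : (size s <= j)%N -> \int[Q]_(y in cell_in s) g a j (y, t) = X t s a.
Proof.
have mgt : measurable_fun setT (fun y => g a j (y, t)).
  exact: measurableT_comp (mg a j) (pair2_measurable t).
move=> /subnK; move: (j - size s)%N => k; elim: k s => [|k IH] s kj.
  have -> : \int[Q]_(y in cell_in s) g a j (y, t) = \int[Q]_(y in cell_in s) (X t s a / qcell s).
    apply: eq_Rintegral => y /set_mem; rewrite /cell_in/= mt_rpre => /eqP ys.
    by rewrite /g/= -kj add0n ys.
  rewrite (Rintegral_cst _ (measurable_cell_in s)) -/(qcell s).
  (* On a null cell [X t s a] also vanishes, being squeezed between 0 and the mass of the cell. *)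
  have [q0|q0] := eqVneq (qcell s) 0; last by rewrite mulfVK.
  rewrite q0 mulr0; apply/esym/le_anti; rewrite -{1}q0 consistent_le//=.
  by have [] := cX t s a.
have cU : cell_in s = cell_in (false :: s) `|` cell_in (true :: s).
  apply/seteqP; split => y; rewrite /cell_in/=.
    by move=> ->; rewrite !andbT; case: (beta y _); [right|left].
  by case=> /andP[].
rewrite cU Rintegral_setU.
- have [_ _ -> _] := cX t s a; rewrite !IH//= addnS -addSn; exact: kj.
- exact: measurable_cell_in.
- exact: measurable_cell_in.
- by apply: integrable01 => //; apply: measurableU; exact: measurable_cell_in.
- apply/disj_set2P/seteqP; split => y //=; rewrite /cell_in/= => -[/andP[/eqP -> _]].
  by case/andP.
Qed.

Variables (F : set_system nat) (UF : UltraFilter F) (Foo : \oo `<=` F).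

(** Taking the limit under the product law, rather than for each [t], makes the conditional masses
    jointly measurable in the signal and [t]. *)
Let lam := (Q \x @unif01 R)%E.

Let dens a : exists p : Y * R -> R,
  [/\ measurable_fun setT p, forall x, 0 <= p x, lam.-integrable setT (EFin \o p) &
   forall E, measurable E ->
   (fun j => \int[lam]_(x in E) g a j x) @ F --> \int[lam]_(x in E) p x].
Proof. exact: weak_star_limit. Qed.

(** The weak-star limit of [g a j] as the signal cells shrink is a conditional mass of [a]. The tree
    relations hold almost everywhere for the countably many words together and are then repaired on
    a null set. *)
Lemma conditional_tree : exists w : Y * R -> seq bool -> R,
  [/\ forall a, measurable_fun setT (w ^~ a), forall p, is_tree (w p) &
   forall s a, {ae unif01, forall t, \int[Q]_(y in cell_in s) w (y, t) a = X t s a}].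
Proof.
have /choice[p Hp] := dens.
have mp a := let: And4 h _ _ _ := Hp a in h.
have p0 a := let: And4 _ h _ _ := Hp a in h.
have ip a := let: And4 _ _ h _ := Hp a in h.
have pc a := let: And4 _ _ _ h := Hp a in h.
have pD a : {ae lam, forall x, p a x = p (false :: a) x + p (true :: a) x}.
  apply: ae_eq01 => //.
  - exact: measurable_funD.
  - exact: (integrableD measurableT (ip _) (ip _)).
  move=> E mE; rewrite RintegralD//; [|exact: (integrableS measurableT)..].
  apply: (cvgR_unique (pc a E mE)).
  rewrite (_ : (fun _ => _) = fun j => \int[lam]_(x in E) g (false :: a) j x +
     \int[lam]_(x in E) g (true :: a) j x); first by apply: cvgD; exact: pc.
  apply/funext => j; rewrite -RintegralD//; [|exact: integrable01..].
  apply: eq_Rintegral => x _; rewrite /g -mulrDl; congr (_ / _).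
  by have [] := cX x.2 (rpre (beta x.1) j) a.
have intg a j s B : measurable B -> (size s <= j)%N ->
    \int[lam]_(x in cell_in s `*` B) g a j x = \int[unif01]_(t in B) X t s a.
  move=> mB sj; rewrite Rfubini2_in//; last exact: measurable_cell_in.
  by apply: eq_Rintegral => t _; exact: int_g.
(* For the empty word [g] is at most 1 and has integral 1, so its integral over any [E] is already
   the mass of [E]. *)
have p1 : {ae lam, forall x, p [::] x = 1}.
  have i1 : lam.-integrable setT (EFin \o (cst 1 : Y * R -> R)).
    by apply: integrable01 => //= _; rewrite ler01 lexx.
  apply: (@ae_eq01 _ _ _ _ _ (cst 1)) => // E mE.
  apply: (cvgR_unique (pc [::] E mE)).
  rewrite (_ : (fun _ => _) = fun=> \int[lam]_(x in E) 1); first exact: cvg_cst.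
  apply/funext => j; rewrite Rintegral_cst// mul1r.
  have mEC : measurable (~` E) by exact: measurableC.
  have /andP[_ gE1] := Rintegral01 lam mE (mg [::] j) (@g01 [::] j).
  have /andP[_ gE2] := Rintegral01 lam mEC (mg [::] j) (@g01 [::] j).
  have cT : cell_in [::] `*` setT = setT :> set (Y * R).
    by apply/seteqP; split => x.
  have : \int[lam]_(x in setT) g [::] j x = 1.
    rewrite -cT intg//.
    rewrite (_ : Rintegral _ _ _ = \int[unif01]_(t in setT) (1 : R)).
      by rewrite Rintegral_cst//= /fine probability_setT mulr1.
    apply: eq_Rintegral => t _; have [_ -> _ _] := cX t [::] [::].
    rewrite /qcell (_ : cell_in [::] = setT) ?probability_setT//.
    by apply/seteqP; split.
  rewrite -(setUv E) Rintegral_setU//; last 2 first.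
  - by rewrite setUv; exact: integrable01.
  - by apply/disj_set2P; rewrite setICr.
  have : fine (lam E) + fine (lam (~` E)) = 1.
    pose m : probability (Y * R)%type R := lam.
    have LU : (m E + m (~` E) = 1)%E.
      rewrite -(@measureU _ _ _ m E (~` E) mE mEC (setICr E)) setUv.
      exact: (probability_setT m).
    by rewrite -fineD ?(fin_num_measure m)//; move/(congr1 fine): LU.
  by move: gE1 gE2; lra.
pose Gd := [set x | p [::] x = 1] `&`
  [set x | forall a, p a x = p (false :: a) x + p (true :: a) x].
have meq (u v : Y * R -> R) : measurable_fun setT u -> measurable_fun setT v ->
    measurable [set x | u x = v x].
  move=> mu mv; have m : measurable_fun setT (fun x => u x == v x).
    exact: measurable_fun_eqr.
  have := m measurableT [set true] I; rewrite setTI.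
  by congr measurable; apply/seteqP; split => x /= /eqP.
have mGd : measurable Gd.
  apply: measurableI; first by apply: meq.
  by apply: measurable_forall_countable => a; apply: meq => //; exact: measurable_funD.
have aeGd : {ae lam, forall x, x \in Gd}.
  apply: filterS2 p1 (ae_forall_countable pD) => x x1 xD.
  by rewrite mem_set.
(* Outside the good set, the law of the constant sequence false. *)
pose w x a : R := if x \in Gd then p a x else (~~ has id a)%:R.
have mw a : measurable_fun setT (w ^~ a).
  apply: measurable_fun_ifT => //.
  apply: (measurable_fun_bool true); rewrite setTI.
  rewrite (_ : _ @^-1` _ = Gd)//.
  by apply/seteqP; split => x /=; [move=> /set_mem|move=> /mem_set].
have tw x : is_tree (w x).
  have [xG|xG] := boolP (x \in Gd).
    rewrite (_ : w x = p^~ x); last by apply/funext => a; rewrite /w xG.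
    by have [x1 xD] := set_mem xG; split => // s; exact: p0.
  rewrite (_ : w x = fun a => (~~ has id a)%:R); last first.
    by apply/funext => a; rewrite /w (negPf xG).
  by split => //= s; rewrite ?ler0n//; case: has; rewrite ?addr0.
have w01 a x : 0 <= w x a <= 1.
  by apply/andP; split; [have [_ + _] := tw x; apply|exact: (tree_le1 a (tw x))].
exists w; split => // s a.
apply: ae_eq01 => //.
- exact: (measurable_Rint2_in Q (mw a) (w01 a) (measurable_cell_in s)).
- apply: integrable01 => //; first exact: (measurable_Rint2_in Q (mw a) (w01 a) (measurable_cell_in s)).
  move=> t; have mwt : measurable_fun setT (fun y => w (y, t) a).
    exact: measurableT_comp (mw a) (pair2_measurable t).
  have /andP[-> h] := Rintegral01 Q (measurable_cell_in s) mwt (fun y => w01 a (y, t)).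
  rewrite (le_trans h)// -lee_fin fineK ?fin_num_measure ?probability_le1//; exact: measurable_cell_in.
- apply: integrable01 => // t; have [-> _ _ _] := cX t s a.
  rewrite (le_trans (consistent_le s a (cX t)))// /qcell -lee_fin.
  rewrite fineK ?fin_num_measure ?probability_le1//; exact: measurable_cell_in.
move=> B mB; have mE : measurable (cell_in s `*` B).
  by apply: measurableX => //; exact: measurable_cell_in.
rewrite -(Rfubini2_in Q unif01 (mw a) (w01 a) (measurable_cell_in s) mB).
have -> : \int[lam]_(x in cell_in s `*` B) w x a = \int[lam]_(x in cell_in s `*` B) p a x.
  rewrite /Rintegral; congr fine; apply: ge0_ae_eq_integral => //.
  - by apply/measurable_EFinP; exact: measurable_funTS.
  - by apply/measurable_EFinP; exact: measurable_funTS.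
  - by move=> x _; rewrite lee_fin; case/andP: (w01 a x).
  - by move=> x _; rewrite lee_fin.
  by apply: filterS aeGd => x xG _; rewrite /w xG.
apply: (cvgR_unique (pc a _ mE)); apply: (@cvg_trans _ (\int[unif01]_(t in B) X t s a @[_ --> F])).
  (* Once [j] reaches the length of [s] the integrals no longer change. *)
  apply: near_eq_cvg; apply: Foo; exists (size s) => // j /= sj.
  by rewrite intg.
exact: cvg_cst.
Qed.

End conditional_trees.

Lemma EFin_Rintegral01 d (X : measurableType d) (R : realType) (P : probability X R)
    E (u : X -> R) : measurable E -> measurable_fun setT u -> (forall x, 0 <= u x <= 1) ->
  (\int[P]_(x in E) u x)%:E = (\int[P]_(x in E) (u x)%:E)%E.
Proof.
move=> mE mu u01; rewrite /Rintegral fineK//.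
by apply: integrable_fin_num => //; exact: integrable01.
Qed.

Lemma Rintegral_indicM d (X : measurableType d) (R : realType) (P : probability X R)
    E (u : X -> R) : \int[P]_(x in E) u x = \int[P]_x (\1_E x * u x).
Proof.
rewrite Rintegral_mkcond; apply: eq_Rintegral => x _.
by rewrite patchE indicE; case: ifPn; rewrite ?mul1r ?mul0r.
Qed.

Lemma Rintegral_indic d (X : measurableType d) (R : realType) (P : probability X R)
    E : measurable E -> \int[P]_x \1_E x = fine (P E).
Proof. by move=> mE; rewrite /Rintegral integral_indic// setIT. Qed.

Lemma indic01 (T : Type) (R : realType) (A : set T) x : 0 <= (\1_A x : R) <= 1.
Proof. by rewrite indicE; case: (_ \in _); rewrite /= ?lexx ?ler01. Qed.

Lemma prod01 (R : realType) (I : Type) (s : seq I) (p : pred I) (u : I -> R) :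
  (forall i, 0 <= u i <= 1) -> 0 <= \prod_(i <- s | p i) u i <= 1.
Proof.
move=> u01; apply/andP; split.
  by apply: prodr_ge0 => i _; case/andP: (u01 i).
by apply: prodr_ile1 => i _; exact: u01.
Qed.

Lemma mul01 (R : realType) (a b : R) : 0 <= a <= 1 -> 0 <= b <= 1 -> 0 <= a * b <= 1.
Proof. by move=> /andP[? ?] /andP[? ?]; rewrite mulr_ge0//= mulr_ile1. Qed.

(** * Integrals under a product law over the players *)

Section product_probability.
Variables (R : realType) (n : nat) (dY : 'I_n -> measure_display).
Variable Y : forall k, measurableType (dY k).

Lemma measurable_proj k : measurable_fun setT (fun y : prodY Y => y k).
Proof.
move=> _ A mA; rewrite setTI; apply: sub_sigma_algebra.
by exists k, A.
Qed.

Lemma measurable_prod_proj d (X : measurableType d) (e : X -> prodY Y) :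
  measurable_fun setT e -> forall (u : forall k, Y k -> R) (p : pred 'I_n),
  (forall k, measurable_fun setT (u k)) ->
  measurable_fun setT (fun x => \prod_(k | p k) u k (e x k)).
Proof.
move=> me u p mu; under eq_fun do rewrite big_mkcond.
apply: measurable_prod => k _; case: (p k); last exact: measurable_cst.
exact: (measurableT_comp (mu k) (measurableT_comp (@measurable_proj k) me)).
Qed.

Lemma measurable_rect (B : forall k, set (Y k)) : (forall k, measurable (B k)) ->
  measurable ([set y | forall k, B k (y k)] : set (prodY Y)).
Proof.
move=> mB; apply: measurable_forall_countable => k.
by have := @measurable_proj k measurableT _ (mB k); rewrite setTI.
Qed.

Variables (Q : forall k, probability (Y k) R) (P : probability (prodY Y) R).
Hypothesis PQ : is_product_prob Q P.

Lemma product_prob_integral (phi : forall k, Y k -> R) :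
  (forall k, measurable_fun setT (phi k)) -> (forall k y, 0 <= phi k y <= 1) ->
  \int[P]_y \prod_k phi k (y k) = \prod_k \int[Q k]_y phi k y.
Proof.
(* Induction on the number [j] of coordinates that may carry general functions, the others carrying
   indicators. For [j = 0] this is the defining property of [P] on rectangles. *)
suff : forall j, (j <= n)%N -> forall phi : (forall k, Y k -> R),
  (forall k, measurable_fun setT (phi k)) -> (forall k y, 0 <= phi k y <= 1) ->
  (forall k : 'I_n, (j <= k)%N -> exists2 B, measurable B & phi k = \1_B) ->
  \int[P]_y \prod_k phi k (y k) = \prod_k \int[Q k]_y phi k y.
  by move=> /(_ n (leqnn n)) H mphi phi01; apply: H => // k; rewrite leqNgt ltn_ord.
clear phi; elim=> [_|j IH jn] phi mphi phi01 phiB.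
  have /all_sig2[B mB BE] : forall k, {B : set (Y k) | measurable B & phi k = \1_B}.
    by move=> k; apply: cid2; exact: phiB.
  transitivity (\int[P]_y (\1_[set y : prodY Y | forall k, B k (y k)] y : R)); last first.
    rewrite Rintegral_indic; last exact: measurable_rect.
    rewrite PQ// (_ : (\prod_(k < n) Q k (B k))%E = (\prod_k fine (Q k (B k)))%:E).
      by apply: eq_bigr => k _; rewrite BE Rintegral_indic.
    by rewrite -prodEFin; apply: eq_bigr => k _; rewrite fineK// fin_num_measure.
  apply: eq_Rintegral => y _; rewrite indicE; have [By|nBy] := pselect (forall k, B k (y k)).
    by rewrite mem_set//= big1// => k _; rewrite BE indicE mem_set.
  rewrite memNset//=; have /existsNP[k nBk] := nBy.
  by rewrite (bigD1 k)//= BE indicE memNset// mul0r.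
pose k0 := Ordinal jn.
have step (psi : Y k0 -> R) : measurable_fun setT psi -> (forall y, 0 <= psi y <= 1) ->
   [/\ forall k, measurable_fun setT (eqtype.dfwith phi psi k),
    forall k y, 0 <= eqtype.dfwith phi psi k y <= 1,
    forall y : prodY Y, \prod_k eqtype.dfwith phi psi k (y k) = \prod_(k | k != k0) phi k (y k) * psi (y k0) &
    \prod_k \int[Q k]_y eqtype.dfwith phi psi k y =
       (\prod_(k | k != k0) \int[Q k]_y phi k y) * \int[Q k0]_y psi y].
  move=> mpsi psi01; split.
  - by move=> k; have [<-|kk0] := eqVneq k0 k; [rewrite dfwith_in|rewrite dfwith_out].
  - by move=> k y; move: y; have [<-|kk0] := eqVneq k0 k; [rewrite dfwith_in|rewrite dfwith_out].
  - move=> y; rewrite (bigD1 k0)//= dfwith_in mulrC; congr (_ * _).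
    by apply: eq_bigr => k kk0; rewrite dfwith_out// eq_sym.
  - rewrite (bigD1 k0)//= dfwith_in mulrC; congr (_ * _).
    by apply: eq_bigr => k kk0; rewrite dfwith_out// eq_sym.
pose h (y : prodY Y) := \prod_(k | k != k0) phi k (y k).
pose c := \prod_(k | k != k0) \int[Q k]_y phi k y.
have mh : measurable_fun setT h.
  exact: (measurable_prod_proj (@measurable_id _ _ setT) (predC1 k0) mphi).
have h01 y : 0 <= h y <= 1 by apply: prod01 => k; exact: phi01.
have c0 : 0 <= c.
  by apply: prodr_ge0 => k _; apply: Rintegral_ge0 => y _; case/andP: (phi01 k y).
have mproj := @measurable_proj k0.
(* The image under coordinate [k0] of [P] weighted by [h] is [c] times [Q k0]; [weighted_transfer]
   then admits [phi k0] in place of the indicator. *)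
have key C : measurable C -> \int[P]_y (h y * \1_C (y k0)) = c * \int[Q k0]_y \1_C y.
  move=> mC; have [md d01 dE dQ] := step _ (@measurable_indic _ _ R setT C mC) (indic01 R C).
  rewrite /c -dQ -IH ?(ltnW jn)//; first by apply: eq_Rintegral => z _; rewrite dE.
  move=> k1; have [<-|kk0 jk] := eqVneq k0 k1.
    by exists C => //; rewrite dfwith_in.
  rewrite dfwith_out//; apply: phiB; rewrite ltn_neqAle jk andbT.
  by move: kk0; apply: contraNneq => jk0; apply/eqP/val_inj.
have [md d01 dE prodQ] := step _ (mphi k0) (phi01 k0).
have -> : \prod_k \int[Q k]_y phi k y = c * \int[Q k0]_y phi k0 y.
  by rewrite (bigD1 k0)//= mulrC.
have -> : \int[P]_y \prod_k phi k (y k) = \int[P]_y (h y * phi k0 (y k0)).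
  by apply: eq_Rintegral => y _; rewrite (bigD1 k0)//= mulrC.
have i01 (psi : Y k0 -> R) : measurable_fun setT psi -> (forall y, 0 <= psi y <= 1) ->
  ((\int[P]_y (h y * psi (y k0)))%:E = \int[P]_y ((h y)%:E * (psi (y k0))%:E))%E /\
  ((c * \int[Q k0]_y psi y)%:E = \int[Q k0]_y ((cst c y)%:E * (psi y)%:E))%E.
  move=> mpsi psi01; split.
    rewrite EFin_Rintegral01//.
    - by apply: measurable_funM => //; exact: measurableT_comp mpsi mproj.
    - by move=> y; apply: mul01.
  rewrite EFinM EFin_Rintegral01// ge0_integralZl_EFin//.
  - by move=> y _; rewrite lee_fin; case/andP: (psi01 y).
  - exact/measurable_EFinP.
apply: EFin_inj; have [-> ->] := i01 _ (mphi k0) (phi01 k0).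
apply: (@weighted_transfer _ _ _ _ _ _ _ P (Q k0) (fun y => y k0) id h (cst c)
  mproj _ _ _ mh _ _ (EFin \o phi k0)) => //.
- by move=> y; case/andP: (h01 y).
- by move=> C mC; have [<- <-] := i01 _ (@measurable_indic _ _ R setT C mC) (indic01 R C); rewrite key.
- by move=> y; rewrite lee_fin; case/andP: (phi01 k0 y).
- exact/measurable_EFinP.
Qed.

Section product_with_state.
Context d0 (Om : measurableType d0) (mu0 : probability Om R).

Lemma product_state_integral (u : Om -> R) (phi : forall k, Y k -> R) :
  measurable_fun setT u -> (forall x, 0 <= u x <= 1) ->
  (forall k, measurable_fun setT (phi k)) -> (forall k y, 0 <= phi k y <= 1) ->
  \int[(mu0 \x P)%E]_x (u x.1 * \prod_k phi k (x.2 k)) =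
  \int[mu0]_x u x * \prod_k \int[Q k]_y phi k y.
Proof.
move=> mu u01 mphi phi01.
have mf : measurable_fun setT (fun x : Om * prodY Y => u x.1 * \prod_k phi k (x.2 k)).
  apply: measurable_funM; first exact: measurableT_comp mu measurable_fst.
  exact: (measurable_prod_proj measurable_snd predT mphi).
have p01 y : 0 <= \prod_k phi k (y k) <= 1 by apply: prod01 => k; exact: phi01.
rewrite Rfubini1//; last by move=> x; exact: mul01.
rewrite -product_prob_integral// -RintegralZr//; last exact: integrable01.
apply: eq_Rintegral => x _ /=; rewrite RintegralZl//; apply: integrable01 => //.
exact: (measurable_prod_proj (@measurable_id _ _ setT) predT mphi).
Qed.

End product_with_state.
End product_probability.

(** * Rectangles in coded coordinates *)

Section coded_rectangles.
Variables (n : nat) (d0 : measure_display) (Om : measurableType d0).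
Variables (dY : 'I_n -> measure_display) (Y : forall k, measurableType (dY k)).
Variables (bO : Om -> cantor_bits) (DO : cantor_bits -> Om).
Variables (bY : forall k, Y k -> cantor_bits) (DY : forall k, cantor_bits -> Y k).
Hypotheses (mbO : measurable_fun setT bO) (mDO : measurable_fun setT DO).
Hypotheses (mbY : forall k, measurable_fun setT (@bY k)).
Hypotheses (mDY : forall k, measurable_fun setT (DY k)).
Hypotheses (bOK : cancel bO DO) (bYK : forall k, cancel (@bY k) (DY k)).

Definition crect s0 (s : 'I_n -> seq bool) : set (Om * prodY Y) :=
  [set x | mt (bO x.1) s0 /\ forall k, mt (bY (x.2 k)) (s k)].

Definition crects : set (set (Om * prodY Y)) :=
  [set E | E = set0 \/ exists s0 s, E = crect s0 s].

Lemma crects_setT : crects setT.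
Proof. by right; exists [::], (fun=> [::]); apply/seteqP; split. Qed.

Lemma crects_setI : setI_closed crects.
Proof.
move=> A B [->|[s0 [s ->]]]; first by left; rewrite set0I.
move=> [->|[s0' [s' ->]]]; first by left; rewrite setI0.
have [[t0 h0]|h0] := mt_cap s0 s0'; last first.
  left; apply/seteqP; split => x //= [[x0 _] [x0' _]].
  by have := h0 (bO x.1); rewrite x0 x0'.
have [/choice[t ht]|] := pselect (forall k, exists t, forall b, mt b (s k) && mt b (s' k) = mt b t).
  right; exists t0, t; apply/seteqP; split => x /=.
    move=> [[x0 xs] [x0' xs']]; split; first by rewrite -h0 x0 x0'.
    by move=> k; rewrite -ht xs xs'.
  move=> [x0 xs]; rewrite -h0 in x0; have /andP[x1 x2] := x0.
  by split; split => // k; have := xs k; rewrite -ht => /andP[].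
move=> /existsNP[k nk]; left; apply/seteqP; split => x //= [[_ xs] [_ xs']].
have [//|h] := mt_cap (s k) (s' k).
by have := h (bY (x.2 k)); rewrite xs xs'.
Qed.

Lemma measurable_crect s0 s : measurable (crect s0 s).
Proof.
rewrite (_ : crect s0 s = cell_in bO s0 `*` [set y : prodY Y | forall k, cell_in (@bY k) (s k) (y k)]).
  apply: measurableX; first exact: (measurable_cell_in mbO).
  by apply: (measurable_rect (B := fun k => cell_in (@bY k) (s k))) => k; exact: (measurable_cell_in (@mbY k)).
by apply/seteqP; split => x.
Qed.

(** Coded rectangles make every bit measurable, and the decoders rebuild each coordinate measurably
    from its bits. *)
Lemma crects_gen : @measurable _ (Om * prodY Y)%type = <<s crects >>.
Proof.
apply/seteqP; split; last first.
  apply: smallest_sub; first exact: sigma_algebra_measurable.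
  by move=> _ [->|[s0 [s ->]]]; [exact: measurable0|exact: measurable_crect].
pose P := g_sigma_algebraType crects.
have m1 : measurable_fun setT (fun p : P => p.1).
  rewrite (_ : (fun _ => _) = fun p : P => DO (bO p.1)); last by apply/funext => p; rewrite bOK.
  apply: (measurableT_comp mDO); apply: measurable_fun_cells => s.
  apply: sub_sigma_algebra; right; exists s, (fun=> [::]).
  by apply/seteqP; split => x //= -[].
have m2 k : measurable_fun setT (fun p : P => p.2 k).
  rewrite (_ : (fun _ => _) = fun p : P => DY k (bY (p.2 k))); last by apply/funext => p; rewrite bYK.
  apply: (measurableT_comp (@mDY k)); apply: measurable_fun_cells => s.
  apply: sub_sigma_algebra; right; exists [::], (fun j => if j == k then s else [::]).
  apply/seteqP; split => x /=.
    by move=> xs; split => // j; case: eqP => // ->.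
  by move=> [_ /(_ k)]; rewrite eqxx.
have m2' : measurable_fun setT (fun p : P => p.2 : prodY Y).
  apply: (@measurability _ _ P (prodY Y) setT _ (cyl_gen (fun k => @measurable _ (Y k)))) => //.
  move=> _ [_ [k [A mA ->]] <-].
  exact: (m2 k measurableT).
move=> A mA.
have mid : measurable_fun setT (fun p : P => p : Om * prodY Y).
  by rewrite (_ : (fun _ => _) = fun p : P => (p.1, p.2 : prodY Y));
    [exact: measurable_fun_pair|apply/funext => -[]].
by have := mid measurableT A mA; rewrite setTI.
Qed.

End coded_rectangles.

Section poly_product.
Variables (R : realType) (J : Type).

Definition pprod (s : seq J) : cpoly R J :=
  foldr (fun j p => PMul (PVar j) p) (PConst 1) s.

Lemma peval_pprod v s : peval v (pprod s) = \prod_(j <- s) v j.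
Proof. by elim: s => [|j s IH] /=; rewrite ?big_nil ?big_cons ?IH. Qed.

End poly_product.

(** * Relations between the entries of a limit table *)

Section table_identities.
Variables (R : realType) (F : set_system nat) (UF : UltraFilter F).
Variables (T : nat -> nat) (T0 : forall L, (0 < T L)%N) (J : countType).
Variables (x : nat -> nat -> J -> R) (X : R -> J -> R).
Hypothesis XP : forall p : cpoly R J,
    [/\ measurable_fun setT (fun t => peval (X t) p),
      exists M, forall t, `|peval (X t) p| <= M &
      emp T x (fun v => peval v p) @ F --> \int[unif01]_t peval (X t) p].

(** The square of [p] is again a polynomial; its averages vanish, so its limit integral does, and a
    nonnegative function of integral 0 vanishes almost everywhere. *)
Lemma table_identity (p : cpoly R J) : (forall L i, peval (x L i) p = 0) ->
  {ae unif01, forall t, peval (X t) p = 0}.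
Proof.
move=> xp; pose q := PMul p p.
have [mq [M qM] cq] := XP q; have [mp _ _] := XP p.
have iq : unif01.-integrable setT (EFin \o (fun t => peval (X t) q)).
  exact: (@bounded_integrable _ _ _ _ M).
have q0 : \int[unif01]_t peval (X t) q = 0.
  apply: (cvgR_unique cq); rewrite (_ : emp _ _ _ = fun=> 0); first exact: cvg_cst.
  by apply/funext => L; rewrite /emp big1 ?mulr0// => i _ /=; rewrite xp mul0r.
have : {ae unif01, forall t, peval (X t) q = 0}.
  apply: (@ae_eq01 _ _ _ _ _ (cst 0)) => //; first exact: integrable0.
  move=> E mE; rewrite Rintegral_cst// mul0r; apply/le_anti/andP; split.
    rewrite -q0 -[X in _ <= X](_ : \int[unif01]_(t in E `|` ~` E) peval (X t) q = _); last by rewrite setUv.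
    have mEC : measurable (~` E) by exact: measurableC.
    rewrite Rintegral_setU ?setUv//; last by apply/disj_set2P; rewrite setICr.
    by rewrite lerDl Rintegral_ge0// => t _ /=; rewrite -expr2 sqr_ge0.
  by rewrite Rintegral_ge0// => t _ /=; rewrite -expr2 sqr_ge0.
by apply: filterS => t /= /eqP; rewrite mulf_eq0 orbb => /eqP.
Qed.

End table_identities.

Lemma Rintegral_ae_eq d (T : measurableType d) (R : realType) (P : probability T R)
    (u v : T -> R) : measurable_fun setT u -> measurable_fun setT v ->
  (forall x, 0 <= u x) -> (forall x, 0 <= v x) ->
  {ae P, forall x, u x = v x} -> \int[P]_x u x = \int[P]_x v x.
Proof.
move=> mu mv u0 v0 uv; rewrite /Rintegral; congr fine; apply: ge0_ae_eq_integral => //.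
- exact/measurable_EFinP.
- exact/measurable_EFinP.
- by move=> x _; rewrite lee_fin.
- by move=> x _; rewrite lee_fin.
- by apply: filterS uv => x -> _.
Qed.

Lemma probability_cell_split d (Y : measurableType d) (R : realType) (Q : probability Y R)
    (b : Y -> cantor_bits) (A : set Y) s : measurable_fun setT b -> measurable A ->
  fine (Q (A `&` cell_in b s)) =
  fine (Q (A `&` cell_in b (false :: s))) + fine (Q (A `&` cell_in b (true :: s))).
Proof.
move=> mb mA; have mc c : measurable (A `&` cell_in b (c :: s)).
  by apply: measurableI => //; exact: (measurable_cell_in mb).
rewrite -fineD ?fin_num_measure// -measureU//; last first.
  apply/seteqP; split => y //=; rewrite /cell_in/= => -[[_ /andP[/eqP -> _]] [_]].
  by case/andP.
congr (fine (Q _)); rewrite -setIUr; congr (_ `&` _).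
apply/seteqP; split => y; rewrite /cell_in/=.
  by move=> ->; rewrite !andbT; case: (b y _); [right|left].
by case=> /andP[].
Qed.

(** * Limits of mixtures of policies *)

Section mixture_limit.
Variables (R : realType) (F : set_system nat) (UF : UltraFilter F) (Foo : \oo `<=` F).
Variables (T : nat -> nat) (T0 : forall L, (0 < T L)%N).
Variables (n : nat) (dY : 'I_n -> measure_display) (Y : forall k, measurableType (dY k)).
Variables (Q : forall k, probability (Y k) R).
Variable bY : forall k, Y k -> cantor_bits.
Hypothesis mbY : forall k, measurable_fun setT (@bY k).
Variable gam : nat -> nat -> forall k, Y k -> cantor_bits.
Hypothesis mgam : forall L i k, measurable_fun setT (@gam L i k).

Let J : countType := ('I_n * (seq bool * seq bool))%type.

(** Joint masses, under the reference law of a player, of the signal cell and of the cell announced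
    by policy [i] of stage [L]. All the players are stored in one table since they share the index
    [i]. *)
Definition cell_table (L i : nat) (j : J) : R :=
  fine (Q j.1 (cell_in (@bY j.1) j.2.1 `&` cell_in (@gam L i j.1) j.2.2)).

Let table01 L i j : 0 <= cell_table L i j <= 1.
Proof.
have mA : measurable (cell_in (@bY j.1) j.2.1 `&` cell_in (@gam L i j.1) j.2.2).
  by apply: measurableI; apply: measurable_cell_in; [exact: mbY|exact: mgam].
rewrite /cell_table fine_ge0//= -lee_fin fineK ?fin_num_measure//.
exact: probability_le1.
Qed.

(** The masses of a player who ignores the signal and always announces false; used on an exceptional
    null set. *)
Let dflt k (s a : seq bool) : R := qcell (Q k) (@bY k) s * (~~ has id a)%:R.

Let dflt_consistent k : consistent (Q k) (@bY k) (dflt k).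
Proof.
move=> s a; split.
- by rewrite /dflt mulr_ge0// fine_ge0.
- by rewrite /dflt mulr1.
- rewrite /dflt -mulrDl; congr (_ * _); rewrite /qcell.
  rewrite -[cell_in _ s]setTI (probability_cell_split (Q k) _ (@mbY k))//.
  by rewrite !setTI.
- by rewrite /dflt /=; case: has; rewrite ?mulr0 ?addr0.
Qed.

(** Consistency consists of countably many linear relations valid in each table of a policy, so by
    [table_identity] the limit table satisfies them all for almost every [t]; elsewhere it is
    replaced by [dflt]. *)
Lemma consistent_limit_tables : exists Z : 'I_n -> R -> seq bool -> seq bool -> R,
  [/\ forall k s a, measurable_fun setT (fun t => Z k t s a),
    forall k t, consistent (Q k) (@bY k) (Z k t) &
    forall s a : 'I_n -> seq bool,
    emp T cell_table (fun v => \prod_k v (k, (s k, a k))) @ F -->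
      \int[unif01]_t \prod_k Z k t (s k) (a k)].
Proof.
have [X [mX X01 XP]] := empirical_tables_limit UF T0 table01.
pose p1 k s : cpoly R J := PAdd (PVar (k, (s, [::]))) (PConst (- qcell (Q k) (@bY k) s)).
pose p2 k s a : cpoly R J := PAdd (PVar (k, (s, a)))
  (PMul (PConst (-1)) (PAdd (PVar (k, (false :: s, a))) (PVar (k, (true :: s, a))))).
pose p3 k s a : cpoly R J := PAdd (PVar (k, (s, a)))
  (PMul (PConst (-1)) (PAdd (PVar (k, (s, false :: a))) (PVar (k, (s, true :: a))))).
have id1 k s L i : peval (cell_table L i) (p1 k s) = 0.
  rewrite /= /cell_table /qcell /= (_ : cell_in _ [::] = setT) ?setIT ?subrr//.
  by apply/seteqP; split.
have id2 k s a L i : peval (cell_table L i) (p2 k s a) = 0.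
  rewrite /= /cell_table /= setIC (probability_cell_split (Q k) s (@mbY k)).
    by rewrite ![_ `&` cell_in (@bY k) _]setIC; lra.
  exact: (measurable_cell_in (@mgam L i k)).
have id3 k s a L i : peval (cell_table L i) (p3 k s a) = 0.
  rewrite /= /cell_table /= (probability_cell_split (Q k) a (@mgam L i k)).
    lra.
  exact: (measurable_cell_in (@mbY k)).
pose G := [set t | forall j : J, [/\ peval (X t) (p1 j.1 j.2.1) = 0,
   peval (X t) (p2 j.1 j.2.1 j.2.2) = 0 & peval (X t) (p3 j.1 j.2.1 j.2.2) = 0]].
have mp p : measurable_fun setT (fun t => peval (X t) p) by have [] := XP p.
have mp0 p : measurable [set t | peval (X t) p = 0].
  have m : measurable_fun setT (fun t => peval (X t) p == 0).
    by apply: measurable_fun_eqr.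
  have := m measurableT [set true] I; rewrite setTI.
  by congr measurable; apply/seteqP; split => x /= /eqP.
have mG : measurable G.
  apply: measurable_forall_countable => j.
  rewrite [X in measurable X](_ : _ = [set t | peval (X t) (p1 j.1 j.2.1) = 0] `&`
    ([set t | peval (X t) (p2 j.1 j.2.1 j.2.2) = 0] `&`
     [set t | peval (X t) (p3 j.1 j.2.1 j.2.2) = 0])).
    by apply: measurableI => //; exact: measurableI.
  by apply/seteqP; split => t /=; [case=> ? ? ?; split => //; split|case=> ? [? ?]; split].
have aeG : {ae unif01, forall t, t \in G}.
  have : {ae unif01, forall t, forall j : J, [/\ peval (X t) (p1 j.1 j.2.1) = 0,
   peval (X t) (p2 j.1 j.2.1 j.2.2) = 0 & peval (X t) (p3 j.1 j.2.1 j.2.2) = 0]}.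
    apply: ae_forall_countable => j.
    have H1 := table_identity UF XP (id1 j.1 j.2.1).
    have H2 := table_identity UF XP (id2 j.1 j.2.1 j.2.2).
    have H3 := table_identity UF XP (id3 j.1 j.2.1 j.2.2).
    by apply: filterS3 H1 H2 H3 => t ? ? ?; split.
  by apply: filterS => t Gt; rewrite mem_set.
pose Z k t s a := if t \in G then X t (k, (s, a)) else dflt k s a.
have mZ k s a : measurable_fun setT (fun t => Z k t s a).
  apply: measurable_fun_ifT => //.
  apply: (measurable_fun_bool true); rewrite setTI.
  rewrite (_ : _ @^-1` _ = G)//.
  by apply/seteqP; split => t /=; [move=> /set_mem|move=> /mem_set].
have Z0 k t s a : 0 <= Z k t s a.
  rewrite /Z; case: ifPn => _; first by case/andP: (X01 t (k, (s, a))).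
  by have [] := dflt_consistent k s a.
exists Z; split => //.
  move=> k t s a; rewrite /Z; case: ifPn => [/set_mem|_]; last exact: dflt_consistent.
  move=> /(_ (k, (s, a))) [/= e1 e2 e3]; split; last 3 first.
  - by apply/eqP; rewrite -subr_eq0; apply/eqP.
  - by lra.
  - by lra.
  by case/andP: (X01 t (k, (s, a))).
move=> s a; pose js : seq J := [seq (k, (s k, a k)) | k <- index_enum 'I_n].
have ev v : peval v (pprod R js) = \prod_k v (k, (s k, a k)).
  by rewrite peval_pprod /js big_map.
have [mjs _] := XP (pprod R js).
rewrite (_ : (fun v => peval v (pprod R js)) = fun v => \prod_k v (k, (s k, a k))); last exact/funext.
rewrite (_ : \int[unif01]_t peval (X t) (pprod R js) = \int[unif01]_t \prod_k Z k t (s k) (a k))//.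
apply: Rintegral_ae_eq => //.
- by apply: measurable_prod => k _; exact: mZ.
- by move=> t; rewrite ev; apply: prodr_ge0 => k _; case/andP: (X01 t (k, (s k, a k))).
- by move=> t; apply: prodr_ge0 => k _.
by apply: filterS aeG => t tG; rewrite ev; apply: eq_bigr => k _; rewrite /Z tG.
Qed.

(** The same [t] drives the conditional laws of all the players: given [t] they act independently,
    and integrating over [t] restores their correlation. *)
Lemma limit_trees : exists w : forall k, Y k * R -> seq bool -> R,
  [/\ forall k a, measurable_fun setT (fun p => w k p a),
    forall k p, is_tree (w k p) &
    forall s a : 'I_n -> seq bool,
    emp T cell_table (fun v => \prod_k v (k, (s k, a k))) @ F -->
      \int[unif01]_t \prod_k \int[Q k]_(y in cell_in (@bY k) (s k)) w k (y, t) (a k)].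
Proof.
have [Z [mZ cZ ZP]] := consistent_limit_tables.
have /(_ _)/cid wex k := conditional_tree (@mbY k) (mZ k) (cZ k) UF Foo.
pose w k := sval (wex k).
have mw k a : measurable_fun setT (fun p => w k p a) by rewrite /w; case: (wex k) => ? [].
have tw k p : is_tree (w k p) by rewrite /w; case: (wex k) => ? [].
have wZ k s a : {ae unif01, forall t, \int[Q k]_(y in cell_in (@bY k) s) w k (y, t) a = Z k t s a}.
  by rewrite /w; case: (wex k) => ? [].
have w01 k a p : 0 <= w k p a <= 1.
  by apply/andP; split; [have [_ + _] := tw k p; apply|exact: (tree_le1 a (tw k p))].
exists w; split => // s a.
rewrite (_ : Rintegral _ _ _ = \int[unif01]_t \prod_k Z k t (s k) (a k))//.
apply: Rintegral_ae_eq => //.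
- apply: measurable_prod => k _.
  exact: (measurable_Rint2_in (Q k) (mw k (a k)) (w01 k (a k)) (measurable_cell_in (@mbY k) (s k))).
- by apply: measurable_prod => k _; exact: mZ.
- by move=> t; apply: prodr_ge0 => k _; apply: Rintegral_ge0 => y _; case/andP: (w01 k (a k) (y, t)).
- by move=> t; apply: prodr_ge0 => k _; have [] := cZ k t (s k) (a k).
have := ae_forall_countable (fun k : 'I_n => wZ k (s k) (a k)).
by apply: filterS => t H; apply: eq_bigr => k _; rewrite H.
Qed.

End mixture_limit.

Lemma Rintegral_sum01 d (X : measurableType d) (R : realType) (P : probability X R)
    (I : Type) (s : seq I) (u : I -> X -> R) :
  (forall i, measurable_fun setT (u i)) -> (forall i x, 0 <= u i x <= 1) ->
  P.-integrable setT (EFin \o (fun x => \sum_(i <- s) u i x)) /\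
  \int[P]_x \sum_(i <- s) u i x = \sum_(i <- s) \int[P]_x u i x.
Proof.
move=> mu u01; elim: s => [|i s [is_ IH]].
  split; last first.
    by rewrite big_nil /Rintegral integral0_eq// => x _; rewrite big_nil.
  by under eq_fun do rewrite big_nil; exact: integrable0.
have iu : P.-integrable setT (EFin \o u i) by exact: integrable01.
split.
  under eq_fun do rewrite big_cons.
  exact: (integrableD measurableT iu is_).
rewrite big_cons -IH -RintegralD//.
by apply: eq_Rintegral => x _; rewrite big_cons.
Qed.

Lemma crect_indic (R : realType) n d0 (Om : measurableType d0)
    (dY : 'I_n -> measure_display) (Y : forall k, measurableType (dY k))
    (bO : Om -> cantor_bits) (b : forall k, Y k -> cantor_bits) s0 s (x : Om * prodY Y) :
  \1_(crect bO b s0 s) x = \1_(cell_in bO s0) x.1 *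
    \prod_k \1_(cell_in (@b k) (s k)) (x.2 k) :> R.
Proof.
rewrite indicE; have [xs|nxs] := pselect (crect bO b s0 s x).
  have [x0 xk] := xs; rewrite mem_set// indicE mem_set// big1 ?mulr1// => k _.
  by rewrite indicE mem_set//; exact: xk.
rewrite memNset//; have [x0|nx0] := pselect (cell_in bO s0 x.1); last first.
  by rewrite indicE memNset// mul0r.
have [/(conj x0)//|/existsNP[k nk]] := pselect (forall k, mt (b k (x.2 k)) (s k)).
by rewrite (bigD1 k)//= !indicE (@memNset _ (cell_in (@b k) (s k)))// mul0r mulr0.
Qed.

(** * The law of the announced bits in the limit *)

Section mixture_law.
Variables (R : realType) (F : set_system nat) (UF : UltraFilter F) (Foo : \oo `<=` F).
Variables (T : nat -> nat) (T0 : forall L, (0 < T L)%N).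
Variables (n : nat) (d0 : measure_display) (Om : measurableType d0).
Variables (dY : 'I_n -> measure_display) (Y : forall k, measurableType (dY k)).
Variables (mu0 : probability Om R) (Q : forall k, probability (Y k) R).
Variables (P : probability (prodY Y) R) (PQ : is_product_prob Q P).
Variables (bO : Om -> cantor_bits) (DO : cantor_bits -> Om).
Variables (bY : forall k, Y k -> cantor_bits) (DY : forall k, cantor_bits -> Y k).
Hypotheses (mbO : measurable_fun setT bO) (mDO : measurable_fun setT DO).
Hypotheses (mbY : forall k, measurable_fun setT (@bY k)).
Hypotheses (mDY : forall k, measurable_fun setT (DY k)).
Hypotheses (bOK : cancel bO DO) (bYK : forall k, cancel (@bY k) (DY k)).
Variables mu nu : probability (Om * prodY Y)%type R.
Hypothesis mu_dom : mu `<< product_measure1 mu0 P.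
Variable gam : nat -> nat -> forall k, Y k -> cantor_bits.
Hypothesis mgam : forall L i k, measurable_fun setT (@gam L i k).
Hypothesis gam_cvg : forall s0 a,
  (fun L => (T L)%:R^-1 * \sum_(i < T L) fine (mu (crect bO (gam L i) s0 a))) @ F -->
     fine (nu (crect bO bY s0 a)).

Let lam : probability (Om * prodY Y)%type R := (mu0 \x P)%E.

(** The announcement probabilities [g L] converge to [G] on coded rectangles under the reference
    product, where integrals factor. They then converge under [mu] by domination, and comparison
    with the hypothesis on [gam] identifies the limit. *)
Lemma mixture_law : exists w : forall k, Y k * R -> seq bool -> R,
  [/\ forall k a, measurable_fun setT (fun p => w k p a),
    forall k p, is_tree (w k p) &
    forall s0 (a : 'I_n -> seq bool), fine (nu (crect bO bY s0 a)) =
    \int[unif01]_t \int[mu]_x (\1_(cell_in bO s0) x.1 * \prod_k w k (x.2 k, t) (a k))].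
Proof.
have [w [mw tw wP]] := limit_trees UF Foo T0 Q mbY mgam.
exists w; split => // s0 a.
have w01 k c p : 0 <= w k p c <= 1.
  by apply/andP; split; [have [_ + _] := tw k p; apply|exact: (tree_le1 c (tw k p))].
have mcO s : measurable (cell_in bO s) by exact: (measurable_cell_in mbO).
have mcY k s : measurable (cell_in (@bY k) s) by exact: (measurable_cell_in (@mbY k)).
have mcG L i k s : measurable (cell_in (@gam L i k) s) by exact: (measurable_cell_in (@mgam L i k)).
pose gi L i (x : Om * prodY Y) : R := \prod_k \1_(cell_in (@gam L i k) (a k)) (x.2 k).
have gi01 L i x : 0 <= gi L i x <= 1 by apply: prod01 => k; exact: indic01.
have mgi L i : measurable_fun setT (gi L i).
  apply: (measurable_prod_proj measurable_snd (u := fun k => \1_(cell_in (@gam L i k) (a k))) predT) => k.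
  exact: measurable_indic.
(* Chance, over a uniform index [i], that the policies of stage [L] announce [a] at [x]; [G] below
   is the expected limit. *)
pose g L x := (T L)%:R^-1 * \sum_(i < T L) gi L i x.
have g01 L x : 0 <= g L x <= 1.
  rewrite /g mulr_ge0 ?invr_ge0 ?ler0n//=; last by apply: sumr_ge0 => i _; case/andP: (gi01 L i x).
  rewrite mulrC ler_pdivrMr ?ltr0n// mul1r.
  rewrite -[X in _ <= X%:R](card_ord (T L)) -sumr_const.
  by apply: ler_sum => i _; case/andP: (gi01 L i x).
have mg L : measurable_fun setT (g L).
  by apply: measurable_funM => //; apply: measurable_sum => i.
pose f (p : (Om * prodY Y) * R) : R := \prod_k w k (p.1.2 k, p.2) (a k).
have mf : measurable_fun setT f.
  apply: measurable_prod => k _.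
  have m12 := measurableT_comp (@measurable_snd _ _ Om (prodY Y))
    (@measurable_fst _ _ (Om * prodY Y)%type R).
  have m3 := measurable_fun_pair (measurableT_comp (@measurable_proj _ _ Y k) m12)
    (@measurable_snd _ _ (Om * prodY Y)%type R).
  exact: (measurableT_comp (mw k (a k)) m3).
have f01 p : 0 <= f p <= 1 by apply: prod01 => k; exact: w01.
pose G x := \int[unif01]_t f (x, t).
have mG : measurable_fun setT G by exact: measurable_Rint1.
have mfx x : measurable_fun setT (fun t => f (x, t)).
  exact: measurableT_comp mf (pair1_measurable x).
have G01 x : 0 <= G x <= 1.
  have /andP[-> h] := Rintegral01 unif01 measurableT (mfx x) (fun t => f01 (x, t)).
  by rewrite (le_trans h)// probability_setT.
have intG (p : probability (Om * prodY Y)%type R) E : measurable E ->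
   \int[p]_(x in E) G x = \int[unif01]_t \int[p]_x (\1_E x * f (x, t)).
  move=> mE; rewrite Rintegral_indicM.
  have mEf : measurable_fun setT (fun q : (Om * prodY Y) * R => \1_E q.1 * f q).
    apply: measurable_funM => //.
    exact: (measurableT_comp (@measurable_indic _ _ R setT E mE) measurable_fst).
  have Ef01 (q : (Om * prodY Y) * R) : 0 <= \1_E q.1 * f q <= 1.
    by apply: mul01 => //; exact: indic01.
  rewrite -(Rfubini2 p unif01 mEf Ef01) (Rfubini1 p unif01 mEf Ef01).
  apply: eq_Rintegral => x _ /=; rewrite RintegralZl//.
  by apply: integrable01 => //.
have intg (p : probability (Om * prodY Y)%type R) E L : measurable E ->
   \int[p]_(x in E) g L x = (T L)%:R^-1 * \sum_(i < T L) \int[p]_x (\1_E x * gi L i x).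
  move=> mE; rewrite Rintegral_indicM.
  have mu1 i : measurable_fun setT (fun x => \1_E x * gi L i x).
    by apply: measurable_funM => //; exact: measurable_indic.
  have u01 i x : 0 <= \1_E x * gi L i x <= 1 by apply: mul01 => //; exact: indic01.
  have [iS <-] := Rintegral_sum01 p (index_enum 'I_(T L)) (fun i : 'I_(T L) => mu1 i) (fun i : 'I_(T L) => u01 i).
  rewrite -RintegralZl//; apply: eq_Rintegral => x _.
  by rewrite /g mulrCA mulr_sumr.
(* Over a coded rectangle both integrals split into a state factor and products of table entries,
   whose averages converge by [wP]. *)
have cvgL E : crects bO bY E ->
   (fun L => \int[lam]_(x in E) g L x) @ F --> \int[lam]_(x in E) G x.
  case=> [->|[s0' [s ->]]].
    under eq_fun do rewrite Rintegral_set0.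
    by rewrite Rintegral_set0; exact: cvg_cst.
  have mE : measurable (crect bO bY s0' s) by exact: measurable_crect.
  pose q := \int[mu0]_x \1_(cell_in bO s0') x.
  pose tb := cell_table Q bY gam.
  have -> : \int[lam]_(x in crect bO bY s0' s) G x =
      q * \int[unif01]_t \prod_k \int[Q k]_(y in cell_in (@bY k) (s k)) w k (y, t) (a k).
    have mI k : measurable_fun setT (fun t => \int[Q k]_(y in cell_in (@bY k) (s k)) w k (y, t) (a k)).
      exact: (measurable_Rint2_in (Q k) (mw k (a k)) (w01 k (a k)) (mcY k (s k))).
    have mwt k t : measurable_fun setT (fun y => w k (y, t) (a k)).
      exact: measurableT_comp (mw k (a k)) (pair2_measurable t).
    rewrite intG// -RintegralZl//; last first.
      apply: integrable01 => //.
        by apply: measurable_prod => k _.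
      move=> t; apply: prod01 => k.
      have /andP[-> h] := Rintegral01 (Q k) (mcY k (s k)) (mwt k t) (fun y => w01 k (a k) (y, t)).
      rewrite (le_trans h)// -lee_fin fineK ?fin_num_measure//.
      exact: probability_le1.
    apply: eq_Rintegral => t _.
    rewrite (_ : \prod_k _ = \prod_k \int[Q k]_y (\1_(cell_in (@bY k) (s k)) y * w k (y, t) (a k))); last first.
      by apply: eq_bigr => k _; rewrite Rintegral_indicM.
    rewrite /q -(product_state_integral PQ)//.
    - apply: eq_Rintegral => x _; rewrite crect_indic -mulrA.
      by rewrite /f -big_split.
    - by move=> x; exact: indic01.
    - by move=> k; apply: measurable_funM => //; exact: measurable_indic.
    - by move=> k y; apply: mul01 => //; exact: indic01.
  rewrite (_ : (fun _ => _) = fun L => q * emp T tb (fun v => \prod_k v (k, (s k, a k))) L).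
    by apply: cvgMl_tmp; exact: wP.
  apply/funext => L; rewrite intg// /emp [RHS]mulrCA; congr (_ * _); rewrite mulr_sumr.
  apply: eq_bigr => i _; pose phi k : Y k -> R :=
    \1_(cell_in (@bY k) (s k) `&` cell_in (@gam L i k) (a k)).
  have mA k : measurable (cell_in (@bY k) (s k) `&` cell_in (@gam L i k) (a k)) by exact: measurableI.
  rewrite (_ : \prod_k _ = \prod_k \int[Q k]_y phi k y); last first.
    by apply: eq_bigr => k _; rewrite /phi Rintegral_indic.
  rewrite /q -(product_state_integral PQ)//.
  - apply: eq_Rintegral => x _; rewrite crect_indic -mulrA.
    rewrite /gi -big_split /=; congr (\1_(cell_in bO s0') x.1 * _).
    by apply: eq_bigr => k _; rewrite /phi indicI.
  - by move=> x; exact: indic01.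
  - by move=> k; exact: measurable_indic.
  - by move=> k y; exact: indic01.
have H0 := cvg_integral_dominated UF mg g01 mG G01 (@crects_setI _ _ _ _ _ bO bY)
  (crects_setT bO bY) (crects_gen mbO mDO mbY mDY bOK bYK) cvgL.
(* Empty words leave the original signals free: only the state is constrained, since [a] concerns
   the announcements. *)
have mE0 : measurable (crect bO bY s0 (fun=> [::])) by exact: measurable_crect.
have := H0 mu _ mu_dom mE0; rewrite intG// => H1.
have c0 x : \1_(crect bO bY s0 (fun=> [::])) x = \1_(cell_in bO s0) x.1 :> R.
  by rewrite crect_indic big1 ?mulr1// => k _; rewrite indicE mem_set.
rewrite (_ : Rintegral _ _ _ = \int[unif01]_t \int[mu]_x (\1_(cell_in bO s0) x.1 * f (x, t))) in H1.
  apply: (cvgR_unique (@gam_cvg s0 a)).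
  move: H1; apply: cvg_trans; apply: near_eq_cvg; apply: nearW => L.
  rewrite intg//; congr (_ * _); apply: eq_bigr => i _.
  rewrite -Rintegral_indic; last exact: measurable_crect.
  by apply: eq_Rintegral => x _; rewrite c0 crect_indic.
by apply: eq_Rintegral => t _; apply: eq_Rintegral => x _; rewrite c0.
Qed.

End mixture_law.

(** * Kernels driven by a private uniform seed *)

Section push_kernel.
Context d d' (X : measurableType d) (Z : measurableType d') (R : realType).
Variables (f : X * R -> Z) (mf : measurable_fun setT f).

(** The law of [f (x, u)] for a uniform [u]. The measurability of [f] is an argument so that the
    kernel structures can be attached. *)
Definition push_kernel of measurable_fun setT f := fun (x : X) (C : set Z) =>
  unif01 [set u | C (f (x, u))].

Local Notation k := (push_kernel mf).

Let msec C : measurable C -> measurable [set p | C (f p)].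
Proof. by move=> mC; have := mf measurableT mC; rewrite setTI. Qed.

Let msec1 x C : measurable C -> measurable [set u | C (f (x, u))].
Proof.
move=> mC; have := measurable_xsection x (msec mC).
by congr measurable; apply/seteqP; split => u; rewrite /xsection/= in_setE.
Qed.

Let k_set0 x : k x set0 = 0%E.
Proof.
by rewrite /push_kernel (_ : [set _ | _] = set0) ?measure0.
Qed.

Let k_ge0 x C : (0 <= k x C)%E. Proof. exact: measure_ge0. Qed.

Let k_sigma_additive x : semi_sigma_additive (k x).
Proof.
move=> E mE tE mU; rewrite /push_kernel.
rewrite (_ : [set u | _] = \bigcup_n [set u | E n (f (x, u))]); last first.
  by apply/seteqP; split => u.
apply: measure_semi_sigma_additive.
- by move=> n; exact: msec1.
- apply/trivIsetP => i j _ _ ij; move/trivIsetP : tE => /(_ i j I I ij) tE.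
  apply/seteqP; split => u //= Eu.
  by have : (E i `&` E j) (f (x, u)) by []; rewrite tE.
- rewrite (_ : \bigcup_n _ = [set u | (\bigcup_n E n) (f (x, u))]).
    exact: msec1.
  by apply/seteqP; split => u.
Qed.

HB.instance Definition _ x := isMeasure.Build _ _ _ (k x)
  (k_set0 x) (k_ge0 x) (@k_sigma_additive x).

Definition push_measure x : {measure set Z -> \bar R} := k x.

Let measurable_k C : measurable C -> measurable_fun setT (push_measure ^~ C).
Proof.
move=> mC; have := measurable_fun_xsection (@unif01 R) (msec mC).
rewrite (_ : _ \o _ = push_measure ^~ C)//; apply/funext => x /=.
rewrite /push_measure/= /push_kernel; congr unif01.
by apply/seteqP; split => u; rewrite /xsection/= in_setE.
Qed.

HB.instance Definition _ := isKernel.Build _ _ _ _ _ push_measure measurable_k.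

Let k_prob x : push_measure x setT = 1%E.
Proof.
rewrite /push_measure/= /push_kernel (_ : [set _ | _] = setT); last by apply/seteqP; split.
exact: probability_setT.
Qed.

HB.instance Definition _ := Kernel_isProbability.Build _ _ _ _ _ push_measure k_prob.

Definition push_pker : R.-pker X ~> Z := push_measure.

Lemma push_pkerE x C : push_pker x C = unif01 [set u | C (f (x, u))].
Proof. by []. Qed.

End push_kernel.

Section probability_kernel_values.
Context d d' (X : measurableType d) (Z : measurableType d') (R : realType).
Variable kap : R.-pker X ~> Z.

Lemma pker_fin x C : measurable C -> kap x C \is a fin_num.
Proof.
move=> mC; rewrite ge0_fin_numE//; apply: (@le_lt_trans _ _ 1%E); last exact: ltry.
by rewrite -(prob_kernel (s := kap) x) le_measure ?in_setE.
Qed.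

Lemma pker01 C x : measurable C -> 0 <= fine (kap x C) <= 1.
Proof.
move=> mC; rewrite fine_ge0//= -lee_fin fineK ?pker_fin//.
by rewrite -(prob_kernel (s := kap) x) le_measure ?in_setE.
Qed.

Lemma measurable_pker C : measurable C -> measurable_fun setT (fun x => fine (kap x C)).
Proof. by move=> mC; apply: (measurableT_comp _ (measurable_kernel kap C mC)). Qed.

End probability_kernel_values.

Section coordinate_extension.
Context d d' (X : measurableType d) (X' : measurableType d') (R : realType).
Variables (M : probability X R) (N : probability X' R).
Variables (kap : R.-pker X ~> cantor_bits) (h : X -> R).
Hypotheses (mh : measurable_fun setT h) (h01 : forall x, 0 <= h x <= 1).
Variables (E : set X') (e : X' -> cantor_bits).
Hypotheses (mE : measurable E) (me : measurable_fun setT e).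

(** Both sides are finite measures in [C] that agree on the cells, a family closed under
    intersection. This frees one coordinate at a time from being a cell. *)
Lemma coordinate_extension :
  (forall s, fine (N (E `&` cell_in e s)) = \int[M]_x (h x * fine (kap x [set b | mt b s]))) ->
  forall C, measurable C ->
  fine (N (E `&` e @^-1` C)) = \int[M]_x (h x * fine (kap x C)).
Proof.
move=> H C mC.
have h0 x : 0 <= h x by case/andP: (h01 x).
have mk B : measurable B -> measurable_fun setT (kap ^~ B) by exact: measurable_kernel.
have md B (mB : measurable B) : measurable_fun setT (fun x => \d_(e x) B : \bar R).
  exact: (measurableT_comp (@measurable_fun_dirac _ cantor_bits R setT B mB) me).
have mIE : measurable_fun setT (\1_E : X' -> R) by exact: measurable_indic.
have IE0 x : 0 <= (\1_E : X' -> R) x by case/andP: (@indic01 _ R E x).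
pose m1 : {measure set cantor_bits -> \bar R} := mixm M mk h0 mh.
pose m2 : {measure set cantor_bits -> \bar R} := mixm N md IE0 mIE.
have m1E B : measurable B -> m1 B = (\int[M]_x (h x * fine (kap x B)))%:E.
  move=> mB; rewrite EFin_Rintegral01//.
  - by rewrite /m1/= /mixm; apply: eq_integral => x _; rewrite EFinM fineK ?pker_fin.
  - by apply: measurable_funM => //; exact: measurable_pker.
  - by move=> x; apply: mul01 => //; exact: pker01.
have m2E B : measurable B -> m2 B = N (E `&` e @^-1` B).
  move=> mB; have meB : measurable (e @^-1` B) by have := me measurableT mB; rewrite setTI.
  rewrite -[RHS](_ : (\int[N]_x (\1_(E `&` e @^-1` B) x)%:E)%E = _); last first.
    by rewrite integral_indic ?setIT//; exact: measurableI.
  rewrite /m2/= /mixm; apply: eq_integral => x _.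
  by rewrite indicI EFinM; congr (_ * _)%E.
suff m12 : m2 C = m1 C by rewrite -m2E// m12 m1E.
apply: (@measure_unique _ R cantor_bits cells (fun=> setT)) => //.
- exact: cells_setI.
- by move=> _; exact: cells_setT.
- by rewrite bigcup_const.
- move=> _ [->|[s ->]]; first by rewrite !measure0.
  have ms := measurable_cell s.
  by rewrite m1E// -H m2E// fineK// fin_num_measure//; apply: measurableI => //; exact: measurable_cell_in.
- move=> _; rewrite m2E// preimage_setT setIT.
  by rewrite (le_lt_trans (probability_le1 N mE))// ltry.
Qed.

End coordinate_extension.

(** * From conditional trees to a correlated garbling *)

Section kernels_from_trees.
Variables (R : realType) (n : nat) (d0 : measure_display) (Om : measurableType d0).
Variables (dY : 'I_n -> measure_display) (Y : forall k, measurableType (dY k)).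
Variables (bO : Om -> cantor_bits) (DO : cantor_bits -> Om).
Variables (bY : forall k, Y k -> cantor_bits) (DY : forall k, cantor_bits -> Y k).
Hypotheses (mbO : measurable_fun setT bO) (mDO : measurable_fun setT DO).
Hypotheses (mbY : forall k, measurable_fun setT (@bY k)).
Hypotheses (mDY : forall k, measurable_fun setT (DY k)).
Hypotheses (bOK : cancel bO DO) (bYK : forall k, cancel (@bY k) (DY k)).
Variables mu nu : probability (Om * prodY Y)%type R.
Variable w : forall k, Y k * R -> seq bool -> R.
Hypothesis mw : forall k a, measurable_fun setT (fun p => @w k p a).
Hypothesis tw : forall k p, is_tree (@w k p).
Hypothesis law : forall s0 (a : 'I_n -> seq bool), fine (nu (crect bO bY s0 a)) =
    \int[unif01]_t \int[mu]_x (\1_(cell_in bO s0) x.1 * \prod_k w (x.2 k, t) (a k)).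

Let X := ((Om * prodY Y) * R)%type.
Let M : probability X R := (mu \x unif01)%E.

Let mcoord k : measurable_fun setT (fun p : X => (p.1.2 k, p.2) : Y k * R).
Proof.
have m12 := measurableT_comp (@measurable_snd _ _ Om (prodY Y))
    (@measurable_fst _ _ (Om * prodY Y)%type R).
exact: (measurable_fun_pair (measurableT_comp (@measurable_proj _ _ Y k) m12)
    (@measurable_snd _ _ (Om * prodY Y)%type R)).
Qed.

(** Two seeds: [q.1.2] is common to all the players, [q.2] is private and is integrated out by the
    kernel. *)
Let sampX k (q : X * R) : cantor_bits := samp (w (q.1.1.2 k, q.1.2)) q.2.

Let msampX k : measurable_fun setT (sampX k).
Proof.
apply: measurable_fun_cells => s.
apply: (@measurable_samp R _ _ (@w k) (@mw k) _ _ (fun q : X * R => (q.1.1.2 k, q.1.2)) snd).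
  exact: (measurableT_comp (@mcoord k) measurable_fst).
exact: measurable_snd.
Qed.

Let codeX (q : X * R) : cantor_bits := bO q.1.1.1.

Let mcodeX : measurable_fun setT codeX.
Proof.
have m1 := measurableT_comp (@measurable_fst _ _ X R) (@measurable_id _ (X * R)%type setT).
have m2 := measurableT_comp (@measurable_fst _ _ (Om * prodY Y)%type R) m1.
exact: (measurableT_comp mbO (measurableT_comp (@measurable_fst _ _ Om (prodY Y)) m2)).
Qed.

Let kapY k := push_pker (@msampX k).
Let kapO := push_pker mcodeX.

Let kapYE k p s : fine (kapY k p [set b | mt b s]) = w (p.1.2 k, p.2) s.
Proof.
rewrite /kapY push_pkerE.
exact: (congr1 fine (unif01_samp s (@tw k (p.1.2 k, p.2)))).
Qed.

Let kapOE p C : fine (kapO p C) = \1_C (bO p.1.1).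
Proof.
rewrite /kapO push_pkerE /codeX indicE; have [Cp|nCp] := pselect (C (bO p.1.1)).
  rewrite mem_set// (_ : [set _ | _] = setT) ?probability_setT//.
  by apply/seteqP; split.
rewrite memNset// (_ : [set _ | _] = set0) ?measure0//.
by apply/seteqP; split.
Qed.

Let box (C0 : set cantor_bits) (C : 'I_n -> set cantor_bits) : set (Om * prodY Y) :=
  [set x | C0 (bO x.1) /\ forall k, C k (bY (x.2 k))].

Let measurable_box C0 C : measurable C0 -> (forall k, measurable (C k)) -> measurable (box C0 C).
Proof.
move=> m0 mC.
rewrite (_ : box C0 C = (bO @^-1` C0) `*` [set y : prodY Y | forall k, (@bY k @^-1` C k) (y k)]).
  apply: measurableX; first by have := mbO measurableT m0; rewrite setTI.
  apply: (measurable_rect (B := fun k => @bY k @^-1` C k)) => k.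
  by have := @mbY k measurableT _ (mC k); rewrite setTI.
by apply/seteqP; split => x.
Qed.

Let m1 C0 : measurable C0 -> measurable_fun setT (fun p : X => \1_C0 (bO p.1.1) : R).
Proof.
move=> mC0; rewrite (_ : (fun _ => _) = fun p => fine (kapO p C0)).
  exact: measurable_pker.
by apply/funext => p; rewrite kapOE.
Qed.

Let cell (s : seq bool) : set cantor_bits := [set b | mt b s].

(** The state coordinate is freed first, through the Dirac kernel [kapO], while the signals are
    still confined to cells. *)
Let base C0 (a : 'I_n -> seq bool) : measurable C0 ->
  fine (nu (box C0 (fun k => cell (a k)))) =
  \int[M]_p (\1_C0 (bO p.1.1) * \prod_k fine (kapY k p (cell (a k)))).
Proof.
move=> mC0.
pose h (p : X) := \prod_k fine (kapY k p (cell (a k))).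
have mh : measurable_fun setT h.
  by apply: measurable_prod => k _; apply: measurable_pker; exact: measurable_cell.
have h01 p : 0 <= h p <= 1 by apply: prod01 => k; apply: pker01; exact: measurable_cell.
pose E := box setT (fun k => cell (a k)).
have mE : measurable E by apply: measurable_box => // k; exact: measurable_cell.
have me : measurable_fun setT (fun x : Om * prodY Y => bO x.1).
  exact: (measurableT_comp mbO (@measurable_fst _ _ Om (prodY Y))).
have H s : fine (nu (E `&` cell_in (fun x : Om * prodY Y => bO x.1) s)) = \int[M]_x (h x * fine (kapO x [set b | mt b s])).
  rewrite (_ : E `&` _ = crect bO bY s a); last first.
    by apply/seteqP; split => x; rewrite /E /box /crect /cell_in /=; [case=> [[_ ?] ?]|case=> ? ?].
  rewrite law.
  have mg : measurable_fun setT (fun p : X => h p * fine (kapO p [set b | mt b s])).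
    apply: measurable_funM => //; apply: measurable_pker; exact: measurable_cell.
  have g01 p : 0 <= h p * fine (kapO p [set b | mt b s]) <= 1.
    by apply: mul01 => //; apply: pker01; exact: measurable_cell.
  rewrite (Rfubini2 mu unif01 mg g01); apply: eq_Rintegral => t _; apply: eq_Rintegral => x _.
  rewrite kapOE mulrC /h; congr (_ * _).
  by apply: eq_bigr => k _; rewrite kapYE.
have := coordinate_extension mh h01 mE me H mC0.
rewrite (_ : E `&` _ = box C0 (fun k => cell (a k))) => [->|].
  by apply: eq_Rintegral => p _; rewrite kapOE mulrC.
by apply/seteqP; split => x; rewrite /E /box /=; [case=> [[_ ?] ?]|case=> ? ?].
Qed.

Let bits_law C0 C : measurable C0 -> (forall k, measurable (C k)) ->
  fine (nu (box C0 C)) =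
  \int[M]_p (\1_C0 (bO p.1.1) * \prod_k fine (kapY k p (C k))).
Proof.
(* Players of index below [j] may have arbitrary measurable sets, the others only cells; each step
   frees one more player. *)
move=> mC0; suff : forall j, (j <= n)%N -> forall C : 'I_n -> set cantor_bits,
  (forall k, measurable (C k)) ->
  (forall k : 'I_n, (j <= k)%N -> exists s, C k = cell s) ->
  fine (nu (box C0 C)) =
  \int[M]_p (\1_C0 (bO p.1.1) * \prod_k fine (kapY k p (C k))).
  by move=> /(_ n (leqnn n)) H mC; apply: H => // k; rewrite leqNgt ltn_ord.
clear C; elim=> [_|j IH jn] C mC Cc.
  have /choice[a aE] : forall k, exists s, C k = cell s by move=> k; exact: Cc.
  by rewrite (_ : C = fun k => cell (a k)); [exact: base|exact/funext].
pose k0 := Ordinal jn.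
pose up (B : set cantor_bits) (k : 'I_n) := if k == k0 then B else C k.
have mup B : measurable B -> forall k, measurable (up B k).
  by move=> mB k; rewrite /up; case: eqP.
pose h (p : X) := \1_C0 (bO p.1.1) * \prod_(k | k != k0) fine (kapY k p (C k)) : R.
have hE B p : h p * fine (kapY k0 p B) = \1_C0 (bO p.1.1) * \prod_k fine (kapY k p (up B k)).
  rewrite /h -mulrA; congr (_ * _); rewrite [in RHS](bigD1 k0)//= /up eqxx mulrC; congr (_ * _).
  by apply: eq_bigr => k /negPf ->.
have mh : measurable_fun setT h.
  apply: measurable_funM; first exact: m1.
  rewrite (_ : (fun _ => _) = fun p => \prod_k (if k != k0 then fine (kapY k p (C k)) else 1)).
    apply: measurable_prod => k _; case: (k != k0); last exact: measurable_cst.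
    exact: measurable_pker.
  by apply/funext => p; rewrite big_mkcond.
have h01 p : 0 <= h p <= 1.
  by apply: mul01; [exact: indic01|apply: prod01 => k; exact: pker01].
have me : measurable_fun setT (fun x : Om * prodY Y => bY (x.2 k0)).
  exact: (measurableT_comp (@mbY k0) (measurableT_comp (@measurable_proj _ _ Y k0) (@measurable_snd _ _ Om (prodY Y)))).
have boxE B : box C0 (up setT) `&` ((fun x : Om * prodY Y => bY (x.2 k0)) @^-1` B) = box C0 (up B).
  apply/seteqP; split => x; rewrite /box /up /=.
    by move=> [[x0 xk] xB]; split => // k; have := xk k; case: eqP => // ->.
  move=> [x0 xk]; split; last by have := xk k0; rewrite eqxx.
  by split => // k; have := xk k; case: eqP.
have H s : fine (nu (box C0 (up setT) `&` cell_in (fun x : Om * prodY Y => bY (x.2 k0)) s)) =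
    \int[M]_x (h x * fine (kapY k0 x [set b | mt b s])).
  rewrite [_ `&` _](boxE [set b | mt b s]) IH ?(ltnW jn)//.
  - by apply: eq_Rintegral => p _; rewrite hE.
  - by apply: mup; exact: measurable_cell.
  move=> k jk; rewrite /up; case: eqP => [_|kk0]; first by exists s.
  apply: Cc; rewrite ltn_neqAle jk andbT; apply/negP => /eqP jk0.
  by apply: kk0; exact: val_inj.
have mE : measurable (box C0 (up setT)) by apply: measurable_box => //; exact: mup.
have := coordinate_extension mh h01 mE me H (mC k0).
have upC : up (C k0) = C by apply/funext => k; rewrite /up; case: eqP => // ->.
rewrite boxE upC => ->; apply: eq_Rintegral => p _.
by rewrite hE upC.
Qed.

Variable k0 : 'I_n.

(** The common randomness is a single real, placed on the diagonal of the cube; the kernels read it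
    back from coordinate [k0]. *)
Let diag (t : R) : prodRn R n := fun=> t.

Let mdiag : measurable_fun setT (fun q : unit * R => diag q.2).
Proof.
apply: (@measurability _ _ _ (prodRn R n) setT _ (cyl_gen (fun=> @measurable _ R))) => //.
move=> _ [_ [k [A mA ->]] <-].
exact: (@measurable_snd _ _ unit R measurableT A mA).
Qed.

Definition diag_law : set (prodRn R n) -> \bar R := push_measure mdiag tt.

HB.instance Definition _ := Measure.on diag_law.

Let diag_law_setT : diag_law setT = 1%E.
Proof. exact: (prob_kernel (s := push_pker mdiag)). Qed.

HB.instance Definition _ := Measure_isProbability.Build _ _ _ diag_law diag_law_setT.

Let sampZ k (q : (Y k * prodRn R n) * R) : Y k := DY k (samp (w (q.1.1, q.1.2 k0)) q.2).

Let msampZ k : measurable_fun setT (@sampZ k).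
Proof.
apply: (measurableT_comp (@mDY k)); apply: measurable_fun_cells => s.
apply: (@measurable_samp R _ _ (@w k) (@mw k) _ _
  (fun q : (Y k * prodRn R n) * R => (q.1.1, q.1.2 k0)) snd); last exact: measurable_snd.
have m0 : measurable_fun setT (fun z : prodRn R n => z k0).
  move=> _ A mA; rewrite setTI; apply: sub_sigma_algebra.
  by exists k0, A.
have m1' := measurableT_comp (@measurable_fst _ _ (Y k) (prodRn R n))
  (@measurable_fst _ _ (Y k * prodRn R n)%type R).
have m2' := measurableT_comp (@measurable_snd _ _ (Y k) (prodRn R n))
  (@measurable_fst _ _ (Y k * prodRn R n)%type R).
exact: (measurable_fun_pair m1' (measurableT_comp m0 m2')).
Qed.

Lemma garbling_of_trees : correlated_garbling mu nu.
Proof.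
pose Pi k := push_pker (@msampZ k).
exists diag_law, Pi; split.
  transitivity (unif01 [set t : R | 0 <= t <= 1]).
    congr (unif01 _); apply/seteqP; split => t /=; first by move/(_ k0).
    by move=> t01 k.
  rewrite unif01_itvE (_ : _ `&` _ = `[0, 1[%classic).
    by rewrite unif01_itv// subr0.
  apply/seteqP; split => t /=; first by case.
  by rewrite in_itv/= => /andP[t0 t1]; rewrite t0 t1 ltW.
move=> A B mA mB.
have mAO : measurable (DO @^-1` A) by have := mDO measurableT mA; rewrite setTI.
have mBY k : measurable (DY k @^-1` B k) by have := @mDY k measurableT _ (mB k); rewrite setTI.
(* Sets are pulled back to bit sequences by the decoders, where [bits_law] applies. *)
rewrite (_ : A `*` _ = box (DO @^-1` A) (fun k => DY k @^-1` B k)); last first.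
  apply/seteqP; split => x; rewrite /box /= bOK.
    by move=> [xA xB]; split => // k; rewrite bYK.
  by move=> [xA xB]; split => // k; have := xB k; rewrite bYK.
have mb : measurable (box (DO @^-1` A) (fun k => DY k @^-1` B k)) by exact: measurable_box.
rewrite -[LHS]fineK ?fin_num_measure// bits_law//.
pose f (q : (Om * prodY Y) * prodRn R n) : R :=
  \1_A q.1.1 * \prod_k fine (Pi k (q.1.2 k, q.2) (B k)).
have f01 q : 0 <= f q <= 1.
  by apply: mul01; [exact: indic01|apply: prod01 => k; exact: pker01].
have mf : measurable_fun setT f.
  apply: measurable_funM.
    exact: (measurableT_comp (@measurable_indic _ _ R setT A mA)
      (measurableT_comp (@measurable_fst _ _ Om (prodY Y)) (@measurable_fst _ _ (Om * prodY Y)%type (prodRn R n)))).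
  apply: measurable_prod => k _.
  have mc := measurable_fun_pair (measurableT_comp (@measurable_proj _ _ Y k)
     (measurableT_comp (@measurable_snd _ _ Om (prodY Y)) (@measurable_fst _ _ (Om * prodY Y)%type (prodRn R n))))
     (@measurable_snd _ _ (Om * prodY Y)%type (prodRn R n)).
  exact: (measurableT_comp (measurable_pker (Pi k) (mB k)) mc).
have mG : measurable_fun setT (fun z => \int[mu]_x f (x, z)) by exact: measurable_Rint2.
have fz z : measurable_fun setT (fun x => f (x, z)) by exact: measurableT_comp mf (pair2_measurable z).
have G01 z : 0 <= \int[mu]_x f (x, z) <= 1.
  have /andP[-> h] := Rintegral01 mu measurableT (fz z) (fun x => f01 (x, z)).
  by rewrite (le_trans h)// probability_setT.
transitivity (\int[diag_law]_z ((cst 1%R z)%:E * (\int[mu]_x f (x, z))%:E))%E; last first.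
  apply: eq_integral => z _; rewrite mul1e EFin_Rintegral01//.
  apply: eq_integral => x _; rewrite /f EFinM; congr (_ * _)%E.
  rewrite -prodEFin; apply: eq_bigr => k _; rewrite fineK//.
  rewrite ge0_fin_numE//; apply: (@le_lt_trans _ _ 1%E); last exact: ltry.
  by rewrite -(prob_kernel (s := Pi k) (x.2 k, z)) le_measure ?in_setE.
have mdg : measurable_fun setT diag.
  exact: (measurableT_comp mdiag (pair1_measurable tt)).
(* With both weights equal to 1 this is the change of variables from the diagonal law to [t]. *)
rewrite (@weighted_transfer _ _ _ _ _ _ _ diag_law (@unif01 R) id diag (cst 1) (cst 1)
  _ _ _ _ _ _ _ (fun z => (\int[mu]_x f (x, z))%:E))//; last 3 first.
- move=> C mC; under eq_integral do rewrite mul1e.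
  rewrite integral_indic// setIT; under eq_integral do rewrite mul1e.
  transitivity (\int[unif01]_t (\1_(diag @^-1` C) t)%:E)%E; last by apply: eq_integral.
  by rewrite integral_indic ?setIT//; have := mdg measurableT C mC; rewrite setTI.
- by move=> z; rewrite lee_fin; case/andP: (G01 z).
- exact/measurable_EFinP.
have ml : measurable_fun setT (fun p : X => \1_(DO @^-1` A) (bO p.1.1) * \prod_k fine (kapY k p (DY k @^-1` B k)) : R).
  apply: measurable_funM; first exact: m1.
  by apply: measurable_prod => k _; exact: measurable_pker.
rewrite (Rfubini2 mu unif01 ml); last first.
  by move=> p; apply: mul01; [exact: indic01|apply: prod01 => k; exact: pker01].
have mdG : measurable_fun setT (fun t => \int[mu]_x f (x, diag t)).
  exact: (measurableT_comp mG mdg).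
under [RHS]eq_integral do rewrite mul1e.
rewrite -[RHS](EFin_Rintegral01 unif01 measurableT mdG (fun t => G01 (diag t))).
apply: (congr1 EFin).
apply: eq_Rintegral => t _; apply: eq_Rintegral => x _.
have e1 : \1_(DO @^-1` A) (bO x.1) = \1_A x.1 :> R by rewrite !indicE /= -{2}(bOK x.1).
have e2 k : fine (kapY k (x, t) (DY k @^-1` B k)) = fine (Pi k (x.2 k, diag t) (B k)).
  by rewrite /kapY /Pi !push_pkerE.
transitivity (\1_A x.1 * \prod_k fine (kapY k (x, t) (DY k @^-1` B k)) : R).
  by rewrite -e1.
by under eq_bigr do rewrite e2.
Qed.

End kernels_from_trees.

(** * Finite-valued variables and words as actions *)

Section finite_law.
Context d (X : measurableType d) (R : realType) (P : probability X R).

Lemma Rintegral_lincomb (I : Type) (s : seq I) (c : I -> R) (A : I -> set X) :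
  (forall i, measurable (A i)) ->
  P.-integrable setT (EFin \o (fun x => \sum_(i <- s) c i * \1_(A i) x)) /\
  \int[P]_x \sum_(i <- s) c i * \1_(A i) x = \sum_(i <- s) c i * fine (P (A i)).
Proof.
move=> mA; elim: s => [|i s [is_ IH]].
  split; last first.
    by rewrite big_nil /Rintegral integral0_eq// => x _; rewrite big_nil.
  by under eq_fun do rewrite big_nil; exact: integrable0.
have i1 : P.-integrable setT (EFin \o (\1_(A i) : X -> R)).
  by apply: integrable01 => // x; exact: indic01.
have iu : P.-integrable setT (EFin \o (fun x => c i * \1_(A i) x)).
  exact: (integrableZl measurableT (c i) i1).
split.
  under eq_fun do rewrite big_cons.
  exact: (integrableD measurableT iu is_).
rewrite big_cons -IH -Rintegral_indic// -RintegralZl// -RintegralD//.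
by apply: eq_Rintegral => x _; rewrite big_cons.
Qed.

Variables (C : finType) (phi : X -> C).
Hypothesis mphi : forall c, measurable (phi @^-1` [set c]).

Lemma finite_valuedE (h : C -> R) x :
  h (phi x) = \sum_c h c * \1_(phi @^-1` [set c]) x.
Proof.
rewrite (bigD1 (phi x))//= indicE mem_set// mulr1 big1 ?addr0// => c cx.
rewrite indicE memNset ?mulr0//= => e.
by rewrite e eqxx in cx.
Qed.

Lemma finite_valued_measurable (h : C -> R) : measurable_fun setT (h \o phi).
Proof.
rewrite (_ : h \o phi = fun x => \sum_c h c * \1_(phi @^-1` [set c]) x).
  apply: measurable_sum => c; apply: measurable_funM => //.
by apply/funext => x; rewrite -finite_valuedE.
Qed.

Lemma finite_valued_integral (h : C -> R) :
  P.-integrable setT (EFin \o (h \o phi)) /\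
  \int[P]_x h (phi x) = \sum_c h c * fine (P (phi @^-1` [set c])).
Proof.
have [ih <-] := Rintegral_lincomb (index_enum C) h mphi.
split.
  rewrite (_ : EFin \o _ = EFin \o (fun x => \sum_c h c * \1_(phi @^-1` [set c]) x))//.
  by apply/funext => x /=; rewrite -finite_valuedE.
by apply: eq_Rintegral => x _; rewrite -finite_valuedE.
Qed.

End finite_law.

Definition word_pt (L : nat) : L.-tuple bool := [tuple of nseq L false].

(** A copy of the tuples to carry the discrete pseudometric, so that words can serve as a compact
    action space. *)
Definition word (L : nat) : Type := L.-tuple bool.
HB.instance Definition _ (L : nat) := Choice.copy (word L) (L.-tuple bool).
HB.instance Definition _ (L : nat) := isPointed.Build (word L) (word_pt L).
HB.instance Definition _ (L : nat) := hasNbhs.Build (word L) principal_filter.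
HB.instance Definition _ (L : nat) := Discrete_ofNbhs.Build (word L) erefl.
HB.instance Definition _ (L : nat) := DiscreteUniform_ofNbhs.Build (word L).
HB.instance Definition _ (R : numDomainType) (L : nat) :=
  @DiscretePseudoMetric_ofUniform.Build R (word L).

Definition word_of (L : nat) (b : nat -> bool) : L.-tuple bool :=
  Tuple (introT eqP (size_rpre b L)).

(** Words list the newest bit first, whence the reversed index; past the end, truncated subtraction
    repeats the newest bit. *)
Definition bits_of (s : seq bool) (m : nat) : bool := nth false s (size s - m.+1).

Lemma rpre_bits_of s : rpre (bits_of s) (size s) = s.
Proof.
elim: s => //= c s IH; rewrite /bits_of /= subSS subnn /=; congr (_ :: _).
rewrite -[RHS]IH; apply: rpre_eq => i il.
by rewrite /bits_of /= subSS -subnSK.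
Qed.

Lemma mt_word_of L b s : (size s <= L)%N -> mt (bits_of (word_of L b)) s = mt b s.
Proof.
move=> sL; apply: mt_agree => i il.
have m1 : mt (bits_of (word_of L b)) (word_of L b).
  by rewrite mt_rpre rpre_bits_of.
apply: (mt_eq_bits m1 (mt_rpre_same b L)).
by rewrite size_tuple (leq_trans il).
Qed.

(** * Games in which bits are announced *)

Section finite_games.
Variables (R : realType) (n : nat) (d0 : measure_display) (Om : measurableType d0).
Variables (dY : 'I_n -> measure_display) (Y : forall k, measurableType (dY k)).
Variable bO : Om -> cantor_bits.
Hypothesis mbO : measurable_fun setT bO.
Variable L : nat.

Let W : pseudoPMetricType R := word L.
Let U (k : 'I_n) : pseudoPMetricType R := W.

Let C : finType := (L.-tuple bool * {ffun 'I_n -> L.-tuple bool})%type.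

Definition play (g : forall k, Y k -> U k) (x : Om * prodY Y) : C :=
  (word_of L (bO x.1), [ffun k => g k (x.2 k) : L.-tuple bool]).

Lemma measurable_word_of d (X : measurableType d) (b : X -> cantor_bits) (s : L.-tuple bool) :
  measurable_fun setT b -> measurable [set x | word_of L (b x) = s].
Proof.
move=> mb; rewrite (_ : [set _ | _] = cell_in b s); first exact: measurable_cell_in.
apply/seteqP; split => x; rewrite /cell_in /= mt_rpre size_tuple.
  by move=> <-.
by move=> /eqP e; apply: val_inj.
Qed.

Lemma measurable_play (g : forall k, Y k -> U k) c : team_policy (R := R) g ->
  measurable (play g @^-1` [set c]).
Proof.
move=> tg; rewrite (_ : _ @^-1` _ = [set w | word_of L (bO w) = c.1] `*`
    [set y : prodY Y | forall k, (g k @^-1` [set c.2 k]) (y k)]).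
  apply: measurableX; first exact: measurable_word_of.
  apply: (measurable_rect (B := fun k => g k @^-1` [set c.2 k])) => k.
  by apply: tg; exact: discrete_open.
apply/seteqP; split => x; rewrite /play /=; case: c => c1 c2 /=.
  by case=> <- <-; split => // k; rewrite ffunE.
by case=> -> xk; congr (_, _); apply/ffunP => k; rewrite ffunE xk.
Qed.

Variable S : C -> R.

(** As [S] varies, the expected costs are all the linear functionals of the joint law of truncated
    state and announced words, as separation requires. *)
Definition word_cost (w : Om) (u : forall k, U k) : R :=
  S (word_of L (bO w), [ffun k => u k : L.-tuple bool]).

Lemma word_cost_team : team_problem_in_E word_cost.
Proof.
split.
- move=> k; split; last exact: discrete_hausdorff.
  apply: finite_compact.
  exact: (@finite_finset (L.-tuple bool) setT).
- pose phi (p : (Om * prodU U)%type) : C := (word_of L (bO p.1), [ffun k => p.2 k : L.-tuple bool]).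
  apply: (finite_valued_measurable (phi := phi)) => c.
  rewrite (_ : _ @^-1` _ = [set w | word_of L (bO w) = c.1] `*`
      [set u : prodU U | forall k, u k = c.2 k]).
    apply: measurableX; first exact: measurable_word_of.
    apply: measurable_forall_countable => k; apply: sub_sigma_algebra.
    by exists k, [set c.2 k : W] => //; exact: discrete_open.
  apply/seteqP; split => x; rewrite /phi /=; case: c => c1 c2 /=.
    by case=> <- <-; split => // k; rewrite ffunE.
  by case=> -> xk; congr (_, _); apply/ffunP => k; rewrite ffunE xk.
- exists (\sum_c `|S c|) => w u; rewrite /word_cost.
  set c := (_, _); by rewrite (bigD1 c)//= lerDl sumr_ge0.
- move=> w u A Aw.
  have Au : A (word_cost w u) by exact: nbhs_singleton.
  have FF : Filter (nbhs (u : prod_topology U)) by exact: nbhs_filter.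
  (* With finitely many discrete factors a single profile is a neighbourhood of itself, so every
     cost is continuous. *)
  have uu : nbhs (u : prod_topology U) [set v | forall k, v k = u k].
    apply: (@filter_forall _ 'I_n (fun k => [set v : prod_topology U | v k = u k]) _ FF) => k.
    exact: (@proj_continuous 'I_n U k u [set u k] (discrete_set1 (u k : word L))).
  have sub : [set v : prod_topology U | forall k, v k = u k] `<=` [set v | A (word_cost w v)].
    move=> v /= vu; have e : word_cost w v = word_cost w u.
      rewrite /word_cost; congr (S (_, _)); apply/ffunP => k.
      by rewrite !ffunE vu.
    by rewrite e.
  exact: (@filterS _ _ FF _ _ sub uu).
Qed.

End finite_games.

(** * Mixtures of policies from the comparison of optimal costs *)

Section more_informative.
Variables (R : realType) (n : nat) (d0 : measure_display) (Om : measurableType d0).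
Variables (dY : 'I_n -> measure_display) (Y : forall k, measurableType (dY k)).
Variables (bO : Om -> cantor_bits) (bY : forall k, Y k -> cantor_bits).
Hypotheses (mbO : measurable_fun setT bO) (mbY : forall k, measurable_fun setT (@bY k)).
Variables mu nu : probability (Om * prodY Y)%type R.
Hypothesis info : forall (U : 'I_n -> pseudoPMetricType R) (c : Om -> (forall k, U k) -> R),
  team_problem_in_E c -> (Jstar c mu <= Jstar c nu)%E.

Let U (L : nat) (k : 'I_n) : pseudoPMetricType R := word L.
Let C (L : nat) : finType := (L.-tuple bool * {ffun 'I_n -> L.-tuple bool})%type.

Let play_law (p : probability (Om * prodY Y)%type R) L (g : forall k, Y k -> U L k) (c : C L) : R :=
  fine (p (play bO g @^-1` [set c])).

Let cost_integral (p : probability (Om * prodY Y)%type R) L (S : C L -> R) (g : forall k, Y k -> U L k) :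
  team_policy (R := R) g ->
  (\int[p]_x (word_cost bO S x.1 (fun k => g k (x.2 k)))%:E)%E =
  (\sum_c S c * play_law p g c)%:E.
Proof.
move=> tg; have [ig <-] := finite_valued_integral p (fun c => measurable_play mbO c tg) S.
by rewrite /Rintegral fineK//; apply: integrable_fin_num.
Qed.

(** The policy that announces one's own signal; under [nu] its law is the target of the
    approximation. *)
Let truth L k (y : Y k) : U L k := word_of L (bY y).

Let team_truth L : team_policy (R := R) (@truth L).
Proof.
move=> k O _; rewrite (_ : _ @^-1` _ = \bigcup_(s : L.-tuple bool) ([set y | word_of L (bY y) = s] `&` [set y | O s])).
  apply: countable_bigcupT_measurable => // s; apply: measurableI.
    exact: measurable_word_of.
  have [Os|nOs] := pselect (O s).
    by rewrite (_ : [set _ | _] = setT)//; apply/seteqP; split.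
  by rewrite (_ : [set _ | _] = set0)//; apply/seteqP; split.
apply/seteqP; split => y; first by move=> Oy; exists (word_of L (bY y)).
by move=> [s _ [<-]].
Qed.

Let word_mixture L : exists (T : nat) (g : nat -> forall k, Y k -> U L k),
  [/\ (0 < T)%N, forall i, team_policy (R := R) (g i) &
   \sum_c `|T%:R^-1 * (\sum_(i < T) play_law mu (g i) c) - play_law nu (@truth L) c| <= L.+1%:R^-1].
Proof.
have law01 p (g : forall k, Y k -> U L k) : team_policy (R := R) g ->
    forall c, 0 <= play_law p g c <= 1.
  move=> tg c; have mp := measurable_play mbO c tg.
  rewrite /play_law fine_ge0//= -lee_fin fineK ?fin_num_measure//.
  exact: probability_le1.
pose K := [set v : C L -> R | exists2 g : forall k, Y k -> U L k, team_policy (R := R) g & v = play_law mu g].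
have K01 v : K v -> forall c, 0 <= v c <= 1 by case=> g tg -> c; exact: law01.
have sep (S : C L -> R) : exists2 v, K v & \sum_c S c * v c <=
    \sum_c S c * play_law nu (@truth L) c + 1.
  (* Truthful play bounds the optimal cost under [nu], hence under [mu]; a policy within 1 of that
     bound provides the separating member of [K]. *)
  have J1 : (Jstar (word_cost (R := R) bO S) mu <= (\sum_c S c * play_law nu (@truth L) c)%:E)%E.
    apply: le_trans (info (word_cost_team mbO S)) _.
    by apply: ereal_inf_lbound; exists (@truth L); [exact: team_truth|exact: (cost_integral nu S (@team_truth L))].
  have : (Jstar (word_cost (R := R) bO S) mu < (\sum_c S c * play_law nu (@truth L) c + 1)%:E)%E.
    by apply: le_lt_trans J1 _; rewrite lte_fin ltrDl.
  move=> /ereal_inf_lt[_ [g tg <-]]; have := cost_integral mu S tg => ->.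
  rewrite lte_fin => /ltW gle.
  by exists (play_law mu g) => //; exists g.
have e0 : 0 < L.+1%:R^-1 :> R by rewrite invr_gt0.
have [T [v [T0 Kv vle]]] := frank_wolfe K01 (law01 nu _ (@team_truth L)) sep e0.
have /choice[g Hg] : forall i, exists g, team_policy (R := R) g /\ v i = play_law mu g.
  by move=> i; have [g tg ->] := Kv i; exists g.
exists T, g; split => //; first by move=> i; case: (Hg i).
move: vle; under eq_bigr => c _ do under eq_bigr => i _ do rewrite (Hg i).2.
by [].
Qed.

(** Cells of words of length at most [L] are decided by the first [L] bits, so their masses are sums
    over the finite outcome set of the game. *)
Let crect_law (p : probability (Om * prodY Y)%type R) L (g : forall k, Y k -> U L k) (b : forall k, Y k -> cantor_bits)
    s0 (a : 'I_n -> seq bool) : team_policy (R := R) g -> (size s0 <= L)%N ->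
  (forall k y, mt (bits_of (g k y : L.-tuple bool)) (a k) = mt (b k y) (a k)) ->
  fine (p (crect bO b s0 a)) =
  \sum_(c : C L) (mt (bits_of c.1) s0 && [forall k, mt (bits_of (c.2 k)) (a k)])%:R * play_law p g c.
Proof.
move=> tg sL gb.
pose h (c : C L) : R := (mt (bits_of c.1) s0 && [forall k, mt (bits_of (c.2 k)) (a k)])%:R.
rewrite -[RHS]/(\sum_c h c * play_law p g c).
have [_ <-] := finite_valued_integral p (fun c => measurable_play mbO c tg) h.
rewrite (_ : crect bO b s0 a = (h \o play bO g) @^-1` [set 1]).
  rewrite -Rintegral_indic; last first.
    have mh := finite_valued_measurable (fun c => measurable_play mbO c tg) h.
    by have := mh measurableT [set 1] (measurable_set1 1); rewrite setTI.
  apply: eq_Rintegral => x _; rewrite indicE /h /=; case: (boolP (_ && _)) => hx.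
    by rewrite mem_set//= hx.
  by rewrite memNset//= (negPf hx) => /eqP; rewrite eq_sym oner_eq0.
have hE x : h (play bO g x) = (mt (bO x.1) s0 && [forall k, mt (b k (x.2 k)) (a k)])%:R.
  rewrite /h /play /= mt_word_of//; congr ((_ && _)%:R).
  by apply: eq_forallb => k; rewrite ffunE gb.
apply/seteqP; split => x /=; rewrite hE.
  by move=> [x0 xk]; rewrite (_ : _ && _)// x0; apply/forallP.
case: (boolP (_ && _)) => [/andP[x0 /forallP xk] _|_ /eqP]; first by split.
by rewrite eq_sym oner_eq0.
Qed.

Lemma informative_mixtures (F : set_system nat) : \oo `<=` F ->
  exists (T : nat -> nat) (gam : nat -> nat -> forall k, Y k -> cantor_bits),
  [/\ forall L, (0 < T L)%N, forall L i k, measurable_fun setT (@gam L i k) &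
  forall s0 a,
  (fun L => (T L)%:R^-1 * \sum_(i < T L) fine (mu (crect bO (gam L i) s0 a))) @ F -->
     fine (nu (crect bO bY s0 a))].
Proof.
move=> Foo.
have wm L := cid (word_mixture L).
pose T L := sval (wm L).
have gm L := cid (svalP (wm L)).
pose g L := sval (gm L).
have T0 L : (0 < T L)%N by have [] := svalP (gm L).
have tg L i : team_policy (R := R) (g L i) by have [_ H _] := svalP (gm L); exact: H.
have gle L : \sum_c `|(T L)%:R^-1 * (\sum_(i < T L) play_law mu (g L i) c) -
   play_law nu (@truth L) c| <= L.+1%:R^-1 by have [] := svalP (gm L).
pose gam : nat -> nat -> forall k, Y k -> cantor_bits :=
  fun L i k y => bits_of (g L i k y : L.-tuple bool).
exists T, gam; split; first exact: T0.
  move=> L i k; apply: measurable_fun_cells => s.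
  rewrite (_ : [set _ | _] = g L i k @^-1` [set x : word L | mt (bits_of x) s])//.
  by apply: tg; exact: discrete_open.
move=> s0 a.
(* The convergence is ordinary, with error at most [1 / (L + 1)] as soon as all the words fit in [L]
   bits; it passes to the finer filter [F]. *)
suff H : (fun L => (T L)%:R^-1 * \sum_(i < T L)
    fine (mu (crect bO (gam L i) s0 a))) @ \oo -->
     fine (nu (crect bO bY s0 a)) by move=> V /H /Foo.
apply/cvgrPdist_le => e e0.
near=> L.
have sL : (size s0 <= L)%N by near: L; exact: nbhs_infty_ge.
have aL k : (size (a k) <= L)%N.
  apply: (@leq_trans (\max_k size (a k))); first exact: (leq_bigmax (F := fun k => size (a k))).
  by near: L; exact: nbhs_infty_ge.
have eL : L.+1%:R^-1 <= e.
  by apply: ltW; near: L; exact: (near_infty_natSinv_lt (PosNum e0)).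
have nuE := @crect_law nu L (@truth L) bY s0 a (@team_truth L) sL
  (fun k y => mt_word_of (bY y) (aL k)).
have muE i := @crect_law mu L (g L i) (gam L i) s0 a (tg L i) sL
  (fun k y => erefl).
rewrite (eq_bigr _ (fun (i : 'I_(T L)) _ => muE i)) nuE.
rewrite exchange_big/= mulr_sumr -sumrB (le_trans (ler_norm_sum _ _ _))//.
apply: le_trans eL; apply: le_trans (gle L); apply: ler_sum => c _.
(* The coefficient of [c] is 0 or 1, so each term is at most the error of the mixture at [c]. *)
rewrite -mulr_sumr mulrCA -mulrBr normrM distrC.
by rewrite ger0_norm ?ler0n// ler_piMl//; case: (_ && _).
Unshelve. all: by end_near. Qed.

End more_informative.

(** * More informative implies garbling *)

Lemma probability_nonempty d (X : measurableType d) (R : realType) (P : probability X R) :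
  exists x : X, True.
Proof.
apply: contrapT => no; have e : [set: X] = set0.
  by apply/seteqP; split => x // _; apply: no; exists x.
have := probability_setT P; rewrite e measure0 => /eqP.
by rewrite eq_sym onee_eq0.
Qed.

Section garbling_of_more_informative.
Variables (R : realType) (n : nat) (d0 : measure_display) (Om : measurableType d0).
Variables (dY : 'I_n -> measure_display) (Y : forall k, measurableType (dY k)).
Variables (zeta : probability Om R) (mu nu : probability (Om * prodY Y)%type R).

(** Without players no coordinate of the cube can carry [t]. A rectangle then constrains only the
    state, whose law is [zeta] on both sides. *)
Lemma trivial_garbling : n = 0%N -> has_marginal mu zeta -> has_marginal nu zeta ->
  correlated_garbling mu nu.
Proof.
move=> n0 mum num; have noI (k : 'I_n) : False by case: k => m; rewrite n0.
exists (@diag_law R n), (fun k => False_rect _ (noI k)); split.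
  rewrite (_ : unit_cube (n := n) = setT) ?probability_setT//.
  by apply/seteqP; split => z // _ k; case: (noI k).
move=> A B mA mB.
rewrite (_ : [set y : prodY Y | _] = setT); last by apply/seteqP; split => y // _ k; case: (noI k).
rewrite num// -mum//.
transitivity (\int[@diag_law R n]_z mu (A `*` setT))%E.
  rewrite integral_cst//; apply/esym; rewrite -[RHS]mule1; congr (_ * _)%E.
  exact: (@probability_setT _ _ _ (@diag_law R n)).
apply: eq_integral => z _.
have mX : measurable (A `*` [set: prodY Y]) by exact: measurableX.
transitivity (\int[mu]_x (\1_(A `*` [set: prodY Y]) x)%:E)%E.
  by rewrite integral_indic// setIT.
apply: eq_integral => x _; rewrite big1 ?mule1; last by move=> k; case: (noI k).
by congr (_%:E); rewrite !indicE in_setX in_setT andbT.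
Qed.

Hypotheses (sbO : standard_borel R Om) (sbY : forall k, standard_borel R (Y k)).
Hypotheses (mum : has_marginal mu zeta) (num : has_marginal nu zeta).
Hypothesis dom : exists (mu0 : probability Om R) (Q : forall k, probability (Y k) R)
          (P : probability (prodY Y) R),
      is_product_prob Q P /\ mu `<< product_measure1 mu0 P.
Hypothesis info : forall (U : 'I_n -> pseudoPMetricType R) (c : Om -> (forall k, U k) -> R),
  team_problem_in_E c -> (Jstar c mu <= Jstar c nu)%E.

Lemma garbling_of_more_informative : correlated_garbling mu nu.
Proof.
have [n0|n_gt0] := posnP n; first exact: trivial_garbling.
pose k0 := Ordinal n_gt0.
(* Its components are the points that the decoders return on sequences coding nothing. *)
have [x0 _] := probability_nonempty mu.
have [bO [DO [mbO mDO bOK]]] := standard_borel_coding x0.1 sbO.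
have cY k := cid (standard_borel_coding (x0.2 k) (sbY k)).
pose bY k : Y k -> cantor_bits := sval (cY k).
have cD k := cid (svalP (cY k)).
pose DY k : cantor_bits -> Y k := sval (cD k).
have mbY k : measurable_fun setT (@bY k) by have [] := svalP (cD k).
have mDY k : measurable_fun setT (DY k) by have [] := svalP (cD k).
have bYK k : cancel (@bY k) (DY k) by have [_ _ H] := svalP (cD k).
have [mu0 [Q [P [PQ mu_dom]]]] := dom.
have [F [UF Foo]] := exists_ultra_eventually.
have [T [gam [T0 mgam gam_cvg]]] := informative_mixtures mbO mbY info Foo.
have [w [mw tw law]] := mixture_law UF Foo T0 PQ mbO mDO mbY mDY bOK bYK mu_dom mgam gam_cvg.
exact: (garbling_of_trees mbO mDO mbY mDY bOK bYK mw tw law k0).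
Qed.

End garbling_of_more_informative.

(** * Freezing a random seed and derandomizing the players *)

Lemma exists_le_mean d (X : measurableType d) (R : realType) (P : probability X R)
    (A : set X) (u : X -> R) : measurable A -> P A = 1%E ->
  measurable_fun setT u -> (forall x, 0 <= u x <= 1) ->
  exists2 x, A x & u x <= \int[P]_x u x.
Proof.
move=> mA PA mu u01; apply: contrapT => no.
(* Then [u] minus its mean would be positive on [A] with integral 0 there, making [A] a null set. *)
have gt x : A x -> \int[P]_x u x < u x.
  by move=> Ax; rewrite ltNge; apply/negP => le; apply: no; exists x.
have [c cE] : {c : R | c = \int[P]_x u x} by exists (\int[P]_x u x).
rewrite -cE in gt.
have iu (E : set X) : measurable E -> P.-integrable E (EFin \o u) by move=> mE; exact: integrable01.
have ic (E : set X) : measurable E -> P.-integrable E (EFin \o cst c).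
  by move=> mE; exact: finite_measure_integrable_cst.
have mAC : measurable (~` A) by exact: measurableC.
have PAC : P (~` A) = 0%E by rewrite probability_setC// PA subee.
have cA : \int[P]_(x in A) (u x - c) = 0.
  rewrite RintegralB//; [|exact: iu|exact: ic].
  rewrite [X in _ - X](_ : _ = c); last first.
    etransitivity; first exact: (Rintegral_cst P mA c).
    by rewrite -[RHS]mulr1; congr (_ * _); exact: (congr1 fine PA).
  have : \int[P]_(x in A `|` ~` A) u x = c by rewrite setUv cE.
  rewrite Rintegral_setU ?setUv//; last 2 first.
  - exact: iu.
  - by apply/disj_set2P; rewrite setICr.
  have /andP[u0 u1] := Rintegral01 P mAC mu u01.
  rewrite PAC /= in u1; have -> : \int[P]_(x in ~` A) u x = 0 by apply/le_anti; rewrite u0 u1.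
  by rewrite addr0 => ->; rewrite subrr.
have muc : measurable_fun setT (fun x => (u x - c)%:E).
  by apply/measurable_EFinP; exact: measurable_funB.
have e0 : (\int[P]_(x in A) `|(u x - c)%:E| = 0)%E.
  rewrite (eq_integral (fun x => (u x - c)%:E)); last first.
    by move=> x /set_mem Ax; rewrite gee0_abs// lee_fin subr_ge0 ltW ?gt.
  rewrite -[LHS]fineK ?[fine _]cA//; apply: integrable_fin_num => //.
  exact: (integrableB mA (iu _ mA) (ic _ mA)).
have := (ae_eq_integral_abs P mA (measurable_funTS muc)).1 e0.
move=> [N [mN PN sub]].
have AN : A `<=` N.
  move=> x Ax; apply: sub => /= H; have := H Ax => -[] /eqP.
  by rewrite subr_eq0 => /eqP e; have := gt x Ax; rewrite e ltxx.
have : (P A <= P N)%E by apply: le_measure => //; rewrite in_setE.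
by rewrite PA PN lee_fin ler10.
Qed.

Section thresholds.
Context d (Y : measurableType d) (R : realType) (N : nat).
Variable s : Y -> 'I_N.+1 -> R.
Hypotheses (ms : forall j, measurable_fun setT (s ^~ j)).
Hypotheses (s0 : forall y j, 0 <= s y j) (s1 : forall y, \sum_j s y j = 1).

Definition cumul y (m : nat) : R := \sum_(j < N.+1 | (j < m)%N) s y j.

(** Inverse transform for a finite law: the seed selects the action whose interval of cumulated
    probabilities contains it. *)
Definition thr (j : 'I_N.+1) (p : Y * R) : bool := cumul p.1 j <= p.2 < cumul p.1 j.+1.

Lemma cumulS y (j : 'I_N.+1) : cumul y j.+1 = cumul y j + s y j.
Proof.
rewrite /cumul (bigD1 j)//= addrC; congr (_ + _); apply: eq_bigl => i.
by rewrite ltnS ltn_neqAle andbC.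
Qed.

Lemma cumul0 y : cumul y 0 = 0. Proof. by rewrite /cumul big1. Qed.

Lemma cumul_top y : cumul y N.+1 = 1.
Proof. by rewrite /cumul -[RHS](s1 y); apply: eq_bigl => j; rewrite ltn_ord. Qed.

Lemma cumul_ge0 y m : 0 <= cumul y m. Proof. exact: sumr_ge0. Qed.

Lemma cumul_le1 y m : cumul y m <= 1.
Proof.
rewrite -(s1 y) [in X in _ <= X](bigID (fun j : 'I_N.+1 => (j < m)%N))/= lerDl.
exact: sumr_ge0.
Qed.

Lemma cumul_nd y m m' : (m <= m')%N -> cumul y m <= cumul y m'.
Proof.
move=> mm; rewrite /cumul [X in _ <= X](bigID (fun j : 'I_N.+1 => (j < m)%N))/=.
rewrite [X in _ <= X + _](_ : _ = \sum_(j < N.+1 | (j < m)%N) s y j); last first.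
  by apply: eq_bigl => j; case: (ltnP j m) => jm; rewrite ?andbF// andbT (leq_trans jm).
by rewrite lerDl; exact: sumr_ge0.
Qed.

Lemma thr_unique i j p : thr i p -> thr j p -> i = j.
Proof.
rewrite /thr => /andP[i1 i2] /andP[j1 j2]; apply/val_inj/eqP.
rewrite eqn_leq; apply/andP; split; rewrite leqNgt; apply/negP => lt.
  by have := le_lt_trans (le_trans (cumul_nd p.1 lt) i1) j2; rewrite ltxx.
by have := le_lt_trans (le_trans (cumul_nd p.1 lt) j1) i2; rewrite ltxx.
Qed.

Lemma thr_exists p : 0 <= p.2 < 1 -> exists j, thr j p.
Proof.
move=> /andP[p0 p1].
have ex : exists m, p.2 < cumul p.1 m by exists N.+1; rewrite cumul_top.
have [m mlt mmin] := ex_minnP ex.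
case: m => [|m] in mlt mmin *; first by have := lt_le_trans mlt (lexx _); rewrite cumul0 ltNge p0.
have mN : (m < N.+1)%N by apply: mmin; rewrite cumul_top.
exists (Ordinal mN); rewrite /thr /= mlt andbT leNgt; apply/negP => /mmin.
by rewrite ltnn.
Qed.

Lemma measurable_cumul m : measurable_fun setT (fun y => cumul y m).
Proof.
rewrite (_ : (fun _ => _) = fun y => \sum_(j < N.+1) (if (j < m)%N then s y j else 0)).
  by apply: measurable_sum => j; case: (j < m)%N; [exact: ms|exact: measurable_cst].
by apply/funext => y; rewrite /cumul [LHS]big_mkcond.
Qed.

Lemma measurable_thr j : measurable [set p | thr j p].
Proof.
have mc m : measurable_fun setT (fun p : Y * R => cumul p.1 m).
  exact: (measurableT_comp (measurable_cumul m) measurable_fst).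
have m1 : measurable_fun setT (fun p : Y * R => cumul p.1 j <= p.2).
  by apply: measurable_fun_ler => //; exact: measurable_snd.
have m2 : measurable_fun setT (fun p : Y * R => p.2 < cumul p.1 j.+1).
  by apply: measurable_fun_ltr => //; exact: measurable_snd.
have := measurable_and m1 m2 => /(_ measurableT [set true] I); rewrite setTI.
by congr measurable; apply/seteqP; split.
Qed.

Lemma thr_mean y j : \int[unif01]_v \1_[set p | thr j p] (y, v) = s y j.
Proof.
rewrite (_ : Rintegral _ _ _ = \int[unif01]_v \1_`[cumul y j, cumul y j.+1[ v); last first.
  by apply: eq_Rintegral => v _; rewrite !indicE; congr (_%:R); apply: congr1;
     apply/idP/idP; rewrite !in_setE /thr /= in_itv.
transitivity (fine (unif01 `[cumul y j, cumul y j.+1[%classic)).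
  by apply: Rintegral_indic; exact: measurable_itv.
rewrite unif01_itv ?cumul_ge0 ?cumul_le1 ?cumul_nd//=.
by rewrite cumulS addrC addKr.
Qed.

End thresholds.

Section derandomization.
Variables (R : realType) (n : nat) (d0 : measure_display) (Om : measurableType d0).
Variables (dY : 'I_n -> measure_display) (Y : forall k, measurableType (dY k)).
Variables (mu : probability (Om * prodY Y)%type R) (N : nat).
Variable H : {ffun 'I_n -> 'I_N.+1} -> Om -> R.
Hypotheses (mH : forall a, measurable_fun setT (H a)) (H01 : forall a w, 0 <= H a w <= 1).

Definition randomized (s : forall k, Y k -> 'I_N.+1 -> R) := forall k,
  [/\ forall j, measurable_fun setT (fun y => s k y j), forall y j, 0 <= s k y j <= 1 &
    forall y, \sum_j s k y j <= 1].

(** The multilinear extension of [H] to independent randomized actions. *)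
Definition mixed_cost (s : forall k, Y k -> 'I_N.+1 -> R) (x : Om * prodY Y) : R :=
  \sum_(a : {ffun 'I_n -> 'I_N.+1}) H a x.1 * \prod_k s k (x.2 k) (a k).

Lemma mixed_cost01 s x : randomized s -> 0 <= mixed_cost s x <= 1.
Proof.
move=> rs; have p01 (a : {ffun 'I_n -> 'I_N.+1}) : 0 <= \prod_k s k (x.2 k) (a k) <= 1.
  by apply: prod01 => k; have [_ + _] := rs k; apply.
apply/andP; split.
  by apply: sumr_ge0 => a _; case/andP: (mul01 (H01 a x.1) (p01 a)).
apply: (@le_trans _ _ (\sum_(a : {ffun 'I_n -> 'I_N.+1}) \prod_k s k (x.2 k) (a k))).
  by apply: ler_sum => a _; have /andP[? ?] := p01 a; have /andP[_ ?] := H01 a x.1; rewrite ler_piMl.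
rewrite -(bigA_distr_bigA (fun k j => s k (x.2 k) j)).
apply: prodr_ile1 => k _; have [_ s01 s1] := rs k.
by rewrite s1 sumr_ge0// => j _; case/andP: (s01 (x.2 k) j).
Qed.

Lemma measurable_mixed_cost s : randomized s -> measurable_fun setT (mixed_cost s).
Proof.
move=> rs; apply: measurable_sum => a; apply: measurable_funM.
  exact: (measurableT_comp (mH a) measurable_fst).
apply: (measurable_prod_proj measurable_snd (u := fun k y => s k y (a k)) predT) => k.
by have [ms _ _] := rs k; exact: ms.
Qed.

Definition pure k (th : Y k -> 'I_N.+1) (y : Y k) (j : 'I_N.+1) : R := (th y == j)%:R.

Lemma mixed_cost_dfwith s k0 (t : Y k0 -> 'I_N.+1 -> R) x :
  mixed_cost (eqtype.dfwith s t) x = \sum_(a : {ffun 'I_n -> 'I_N.+1})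
    (H a x.1 * \prod_(k | k != k0) s k (x.2 k) (a k)) * t (x.2 k0) (a k0).
Proof.
apply: eq_bigr => a _; rewrite -mulrA; congr (_ * _).
rewrite (bigD1 k0)//= dfwith_in mulrC; congr (_ * _).
by apply: eq_bigr => k kk0; rewrite dfwith_out// eq_sym.
Qed.

Lemma dfwith_same s k0 : eqtype.dfwith s (s k0) = s :> (forall k, Y k -> 'I_N.+1 -> R).
Proof.
apply: functional_extensionality_dep => k.
by have [<-|kk0] := eqVneq k0 k; [rewrite dfwith_in|rewrite dfwith_out].
Qed.

Lemma randomized_dfwith s k0 (t : Y k0 -> 'I_N.+1 -> R) : randomized s ->
  (forall j, measurable_fun setT (fun y => t y j)) -> (forall y j, 0 <= t y j <= 1) ->
  (forall y, \sum_j t y j <= 1) -> randomized (eqtype.dfwith s t).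
Proof.
move=> rs mt t01 t1 k; have [<-|kk0] := eqVneq k0 k; first by rewrite dfwith_in.
by rewrite dfwith_out.
Qed.

(** The cost is linear in the rule of player [k0], and over a uniform seed the threshold policies
    average to that rule; some seed in [0, 1[ does no worse than the average. *)
Lemma derandomize_player s k0 : randomized s -> (forall y, \sum_j s k0 y j = 1) ->
  exists th : Y k0 -> 'I_N.+1, (forall j, measurable (th @^-1` [set j])) /\
    \int[mu]_x mixed_cost (eqtype.dfwith s (pure th)) x <= \int[mu]_x mixed_cost s x.
Proof.
move=> rs s1; have [ms s01 _] := rs k0.
have s0 y j : 0 <= s k0 y j by case/andP: (s01 y j).
pose t v (y : Y k0) j : R := \1_[set p | thr (s k0) j p] (y, v).
have mthr j : measurable [set p | thr (s k0) j p] by exact: measurable_thr.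
have mt v j : measurable_fun setT (fun y => t v y j).
  exact: (measurableT_comp (@measurable_indic _ _ R setT _ (mthr j)) (pair2_measurable v)).
have t1 v y : \sum_j t v y j <= 1.
  have [[j0 tj0]|no] := pselect (exists j, thr (s k0) j (y, v)).
    rewrite (bigD1 j0)//= big1 ?addr0.
      by case/andP: (@indic01 _ R [set p | thr (s k0) j0 p] (y, v)).
    move=> j jj0; rewrite /t indicE memNset//= => tj.
    by rewrite (thr_unique s0 tj tj0) eqxx in jj0.
  rewrite big1// => j _; rewrite /t indicE memNset//= => tj.
  by apply: no; exists j.
have rt v : randomized (eqtype.dfwith s (t v)).
  by apply: randomized_dfwith => // y j; exact: indic01.
pose G (q : (Om * prodY Y) * R) := mixed_cost (eqtype.dfwith s (t q.2)) q.1.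
have G01 q : 0 <= G q <= 1 by exact: mixed_cost01.
have mG : measurable_fun setT G.
  rewrite (_ : G = fun q => \sum_(a : {ffun 'I_n -> 'I_N.+1})
    (H a q.1.1 * \prod_(k | k != k0) s k (q.1.2 k) (a k)) * \1_[set p | thr (s k0) (a k0) p] (q.1.2 k0, q.2)); last first.
    by apply/funext => q; rewrite /G mixed_cost_dfwith.
  have m12 := measurableT_comp (@measurable_snd _ _ Om (prodY Y))
    (@measurable_fst _ _ (Om * prodY Y)%type R).
  apply: measurable_sum => a; apply: measurable_funM; first apply: measurable_funM.
  - exact: (measurableT_comp (mH a) (measurableT_comp (@measurable_fst _ _ Om (prodY Y))
       (@measurable_fst _ _ (Om * prodY Y)%type R))).
  - apply: (measurable_prod_proj m12 (u := fun k y => s k y (a k)) (predC1 k0)) => k.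
    by have [h _ _] := rs k; exact: h.
  - have m3 := measurable_fun_pair (measurableT_comp (@measurable_proj _ _ Y k0) m12)
      (@measurable_snd _ _ (Om * prodY Y)%type R).
    exact: (measurableT_comp (@measurable_indic _ _ R setT _ (mthr (a k0))) m3).
have mu1 : measurable_fun setT (fun v => \int[mu]_x G (x, v)) by exact: measurable_Rint2.
have mGv v : measurable_fun setT (fun x => G (x, v)) by exact: measurableT_comp mG (pair2_measurable v).
have u01 v : 0 <= \int[mu]_x G (x, v) <= 1.
  have /andP[-> h] := Rintegral01 mu measurableT (mGv v) (fun x => G01 (x, v)).
  by rewrite (le_trans h)// probability_setT.
have PA : unif01 (`[0, 1[%classic : set R) = 1%E by rewrite unif01_itv// subr0.
have [v v01 vle] := exists_le_mean (measurable_itv `[0, 1[ : measurable (`[0, 1[%classic : set R)) PA mu1 u01.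
rewrite -(Rfubini2 mu unif01 mG G01) (Rfubini1 mu unif01 mG G01) in vle.
have mean x : \int[unif01]_v G (x, v) = mixed_cost s x.
  rewrite -[in RHS](dfwith_same s k0) mixed_cost_dfwith.
  have mA (a : {ffun 'I_n -> 'I_N.+1}) : measurable [set v | thr (s k0) (a k0) (x.2 k0, v)].
    have := measurable_xsection (x.2 k0) (mthr (a k0)).
    by congr measurable; apply/seteqP; split => z; rewrite /xsection/= in_setE.
  have [_ E] := Rintegral_lincomb unif01 (index_enum {ffun 'I_n -> 'I_N.+1})
    (fun a => H a x.1 * \prod_(k | k != k0) s k (x.2 k) (a k)) mA.
  transitivity (\int[unif01]_v (\sum_(a : {ffun 'I_n -> 'I_N.+1})
     (H a x.1 * \prod_(k | k != k0) s k (x.2 k) (a k)) * \1_[set v | thr (s k0) (a k0) (x.2 k0, v)] v)).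
    by apply: eq_Rintegral => z _; rewrite /G mixed_cost_dfwith; apply: eq_bigr => a _; rewrite /t !indicE.
  rewrite E; apply: eq_bigr => a _; congr (_ * _).
  transitivity (\int[unif01]_z (\1_[set v | thr (s k0) (a k0) (x.2 k0, v)] z : R)).
    by apply/esym/Rintegral_indic.
  transitivity (\int[unif01]_z (\1_[set p | thr (s k0) (a k0) p] (x.2 k0, z) : R)).
    by apply: eq_Rintegral => z _; rewrite !indicE.
  exact: thr_mean.
(* As [v] lies in [0, 1[, some action is always selected and the default is never taken. *)
pose th y : 'I_N.+1 := odflt ord0 [pick j | thr (s k0) j (y, v)].
have v01' : 0 <= v < 1 by move: v01; rewrite /= in_itv.
have thE y j : (th y == j) = thr (s k0) j (y, v).
  rewrite /th; case: pickP => [i ti|no] /=.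
    apply/eqP/idP => [<-//|tj]; exact: (thr_unique s0 ti tj).
  by have [i ti] := @thr_exists _ _ _ _ _ s1 (y, v) v01'; rewrite no in ti.
exists th; split.
  move=> j; rewrite (_ : _ @^-1` _ = [set y | thr (s k0) j (y, v)]).
    have := measurable_ysection v (mthr j).
    by congr measurable; apply/seteqP; split => z; rewrite /ysection/= in_setE.
  by apply/seteqP; split => y /=; rewrite -thE => /eqP.
have -> : pure th = t v.
  apply/funext => y; apply/funext => j; rewrite /pure /t thE indicE.
  case: (boolP (thr _ _ _)) => h; first by rewrite mem_set.
  by rewrite memNset//=; apply/negP.
apply: le_trans vle _; rewrite le_eqVlt; apply/orP; left; apply/eqP.
by apply: eq_Rintegral => x _; rewrite mean.
Qed.

Lemma derandomize s : randomized s -> (forall k y, \sum_j s k y j = 1) ->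
  exists th : forall k, Y k -> 'I_N.+1, (forall k j, measurable (th k @^-1` [set j])) /\
    \int[mu]_x H [ffun k => th k (x.2 k)] x.1 <= \int[mu]_x mixed_cost s x.
Proof.
move=> rs s1.
(* The first [j] players are already deterministic. *)
have : forall j, (j <= n)%N -> exists s' : forall k, Y k -> 'I_N.+1 -> R,
  [/\ randomized s', forall k y, \sum_i s' k y i = 1,
     forall k : 'I_n, (k < j)%N -> exists2 th : Y k -> 'I_N.+1,
       forall i, measurable (th @^-1` [set i]) & s' k = pure th &
     \int[mu]_x mixed_cost s' x <= \int[mu]_x mixed_cost s x].
  elim=> [_|j IH jn]; first by exists s; split.
  have [s' [rs' s1' pure' le']] := IH (ltnW jn).
  pose k0 := Ordinal jn.
  have [th [mth thle]] := derandomize_player rs' (s1' k0).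
  have sum1 y : \sum_i pure th y i = 1.
    by rewrite (bigD1 (th y))//= /pure eqxx big1 ?addr0// => i /negPf; rewrite eq_sym => ->.
  exists (eqtype.dfwith s' (pure th)); split.
  - apply: randomized_dfwith => //.
    + move=> i; rewrite (_ : (fun y => _) = \1_(th @^-1` [set i])); first exact: measurable_indic.
      apply/funext => y; rewrite indicE /pure; case: eqP => h; first by rewrite mem_set.
      by rewrite memNset.
    + by move=> y i; rewrite /pure; case: eqP; rewrite ?lexx ?ler01.
    + by move=> y; rewrite sum1.
  - by move=> k; have [<-|kk0] := eqVneq k0 k; [rewrite dfwith_in|rewrite dfwith_out].
  - move=> k; rewrite ltnS leq_eqVlt => /orP[/eqP kj|kj].
      have <- : k0 = k by exact: val_inj.
      by exists th => //; rewrite dfwith_in.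
    have kk0 : k0 != k by apply/eqP => e; rewrite -e ltnn in kj.
    by rewrite dfwith_out//; exact: pure'.
  - exact: le_trans thle le'.
move=> /(_ n (leqnn n))[s' [rs' s1' pure' le']].
have pk k : exists th : Y k -> 'I_N.+1, (forall i, measurable (th @^-1` [set i])) /\ s' k = pure th.
  by have [th mth e] := pure' k (ltn_ord k); exists th.
pose th k := sval (cid (pk k)).
have mth k : (forall i, measurable (th k @^-1` [set i])) by case: (svalP (cid (pk k))).
have thE k : s' k = pure (th k) by case: (svalP (cid (pk k))).
exists th; split => //; apply: le_trans le'.
rewrite le_eqVlt; apply/orP; left; apply/eqP; apply: eq_Rintegral => x _.
rewrite /mixed_cost (bigD1 [ffun k => th k (x.2 k)])//= big1 ?mulr1.
  rewrite big1 ?addr0// => a aN.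
  have /existsP[k kN] : [exists k, a k != th k (x.2 k)].
    rewrite -negb_forall; apply: contra aN => /forallP h.
    by apply/eqP/ffunP => k; rewrite ffunE; exact/eqP.
  by rewrite (bigD1 k)//= thE /pure eq_sym (negPf kN) mul0r mulr0.
by move=> k _; rewrite ffunE thE /pure eqxx.
Qed.

End derandomization.

Lemma pker_fibers_sum d d' (X : measurableType d) (Z : measurableType d') (R : realType)
    (kap : R.-pker X ~> Z) (N : nat) (b : Z -> 'I_N.+1) x :
  (forall j, measurable (b @^-1` [set j])) ->
  \sum_j fine (kap x (b @^-1` [set j])) = 1.
Proof.
move=> mb; rewrite sum_fine; last by move=> j _; exact: pker_fin.
pose E i : set Z := [set z | nat_of_ord (b z) = i].
have EE (j : 'I_N.+1) : b @^-1` [set j] = E j.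
  by rewrite /E; apply/seteqP; split => z /=; [move=> ->|move=> ?; exact: val_inj].
have mE i : measurable (E i).
  have [iN|Ni] := ltnP i N.+1; first by have := mb (Ordinal iN); rewrite EE.
  rewrite (_ : E i = set0)//; apply/seteqP; split => z //= e.
  by have := ltn_ord (b z); rewrite e ltnNge Ni.
have tE : trivIset setT E by move=> i j _ _ [z [<- <-]].
rewrite (eq_bigr (fun j : 'I_N.+1 => kap x (E j))); last by move=> j _; rewrite EE.
rewrite -(@measure_bigsetU _ _ _ (kap x) E mE tE N.+1).
rewrite (_ : \big[setU/set0]_(i < N.+1) E i = setT); last first.
  by apply/seteqP; split => z // _; rewrite -bigcup_mkord; exists (b z) => //=.
exact: (congr1 fine (prob_kernel (s := kap) x)).
Qed.

(** * Finite-action play under a garbling *)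

Section garbled_play.
Variables (R : realType) (n : nat) (d0 : measure_display) (Om : measurableType d0).
Variables (dY : 'I_n -> measure_display) (Y : forall k, measurableType (dY k)).
Variables (mu nu : probability (Om * prodY Y)%type R) (N : nat).
Variable H : {ffun 'I_n -> 'I_N.+1} -> Om -> R.
Hypotheses (mH : forall a, measurable_fun setT (H a)) (H01 : forall a w, 0 <= H a w <= 1).
Variable b : forall k, Y k -> 'I_N.+1.
Hypothesis mb : forall k j, measurable (@b k @^-1` [set j]).

(** Acting by [b] on garbled signals is, for each common value [z], independent randomized play
    under [mu], and the cost under [nu] is the average over [z]. *)
Lemma garbled_play : correlated_garbling mu nu ->
  exists th : forall k, Y k -> 'I_N.+1, (forall k j, measurable (th k @^-1` [set j])) /\
  \int[mu]_x H [ffun k => th k (x.2 k)] x.1 <= \int[nu]_x H [ffun k => b (x.2 k)] x.1.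
Proof.
move=> [eta [Pi [_ gE]]].
pose s z k (y : Y k) j : R := fine (Pi k (y, z) (@b k @^-1` [set j])).
have s01 z k y j : 0 <= s z k y j <= 1 by exact: pker01.
have s1 z k y : \sum_j s z k y j = 1 by exact: pker_fibers_sum.
have msk k j : measurable_fun setT (fun p : Y k * prodRn R n => s p.2 k p.1 j).
  rewrite (_ : (fun _ => _) = fun p => fine (Pi k p (@b k @^-1` [set j]))).
    exact: measurable_pker.
  by apply/funext => -[].
have rs z : randomized (s z).
  move=> k; split => //; last by move=> y; rewrite s1.
  by move=> j; exact: (measurableT_comp (msk k j) (pair2_measurable z)).
pose X2 := (prodRn R n * (Om * prodY Y))%type.
pose M2 : probability X2 R := (eta \x mu)%E.
pose h2 (a : {ffun 'I_n -> 'I_N.+1}) (q : X2) : R := \prod_k s q.1 k (q.2.2 k) (a k).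
have h201 a q : 0 <= h2 a q <= 1 by apply: prod01 => k.
have mh2 a : measurable_fun setT (h2 a).
  apply: measurable_prod => k _.
  have m12 := measurableT_comp (@measurable_snd _ _ Om (prodY Y))
    (@measurable_snd _ _ (prodRn R n) (Om * prodY Y)%type).
  have m3 := measurable_fun_pair (measurableT_comp (@measurable_proj _ _ Y k) m12)
    (@measurable_fst _ _ (prodRn R n) (Om * prodY Y)%type).
  exact: (measurableT_comp (msk k (a k)) m3).
have me2 : measurable_fun setT (fun q : X2 => q.2.1).
  exact: (measurableT_comp (@measurable_fst _ _ Om (prodY Y))
    (@measurable_snd _ _ (prodRn R n) (Om * prodY Y)%type)).
pose B (a : {ffun 'I_n -> 'I_N.+1}) : set (Om * prodY Y) := [set x | forall k, (@b k @^-1` [set a k]) (x.2 k)].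
have mB a : measurable (B a).
  rewrite (_ : B a = setT `*` [set y : prodY Y | forall k, (@b k @^-1` [set a k]) (y k)]).
    by apply: measurableX => //; exact: (measurable_rect (B := fun k => @b k @^-1` [set a k])).
  by apply/seteqP; split => x //= -[].
(* For a fixed action profile the garbling formula on rectangles gives the two weighted laws of the
   state; [weighted_transfer] then integrates [H a]. *)
have step a : \int[nu]_x (\1_(B a) x * H a x.1) = \int[M2]_q (h2 a q * H a q.2.1).
  have mHf : measurable_fun setT (fun x : Om * prodY Y => H a x.1).
    exact: (measurableT_comp (mH a) measurable_fst).
  apply: EFin_inj; rewrite !EFin_Rintegral01//; last 4 first.
  - by apply: measurable_funM => //; exact: (measurableT_comp (mH a) me2).
  - by move=> q; exact: mul01.
  - by apply: measurable_funM => //; exact: measurable_indic.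
  - by move=> x; apply: mul01 => //; exact: indic01.
  suff E : (\int[nu]_x ((\1_(B a) x)%:E * (EFin \o H a) x.1) =
      \int[M2]_q ((h2 a q)%:E * (EFin \o H a) q.2.1))%E.
    transitivity (\int[nu]_x ((\1_(B a) x)%:E * (EFin \o H a) x.1))%E.
      by apply: eq_integral => x _; rewrite EFinM.
    by rewrite E; apply: eq_integral => q _; rewrite EFinM.
  apply: (weighted_transfer (M1 := nu) (M2 := M2) (e1 := fst) (e2 := (fun q : X2 => q.2.1))
    (h1 := \1_(B a)) (h2 := h2 a) measurable_fst me2 _ _ _ _ _ _ _) => //.
  - by move=> q; case/andP: (h201 a q).
  - move=> C mC.
    transitivity (nu (C `*` [set y : prodY Y | forall k, (@b k @^-1` [set a k]) (y k)])).
      have mCB : measurable (C `*` [set y : prodY Y | forall k, (@b k @^-1` [set a k]) (y k)]).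
        by apply: measurableX => //; exact: (measurable_rect (B := fun k => @b k @^-1` [set a k])).
      rewrite -[RHS](_ : (\int[nu]_x (\1_(C `*` [set y : prodY Y | forall k, (@b k @^-1` [set a k]) (y k)]) x)%:E)%E = _); last first.
        by rewrite integral_indic ?setIT.
      apply: eq_integral => x _; rewrite -EFinM; congr (_%:E).
      rewrite !indicE in_setX mulrC; case: (x.1 \in C); rewrite ?mul1r ?mul0r//=.
    etransitivity; first exact: (gE C (fun k => @b k @^-1` [set a k]) mC (fun k => @mb k (a k))).
    apply/esym.
    rewrite (fubini_tonelli1 (fun q : X2 => ((h2 a q)%:E * (\1_C q.2.1)%:E)%E)); last 2 first.
    + apply: emeasurable_funM; apply/measurable_EFinP => //.
      exact: (measurableT_comp (@measurable_indic _ _ R setT C mC) me2).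
    + by move=> q; apply: mule_ge0; rewrite lee_fin; [case/andP: (h201 a q)|case/andP: (@indic01 _ R C q.2.1)].
    apply: eq_integral => z _; apply: eq_integral => x _ /=.
    rewrite muleC; congr (_ * _)%E; rewrite /h2 -prodEFin; apply: eq_bigr => k _.
    by rewrite /s fineK//; exact: pker_fin.
  - by move=> w; rewrite lee_fin; case/andP: (H01 a w).
  - exact/measurable_EFinP.
have HE x : H [ffun k => b (x.2 k)] x.1 =
    \sum_(a : {ffun 'I_n -> 'I_N.+1}) \1_(B a) x * H a x.1.
  rewrite (bigD1 [ffun k => b (x.2 k)])//= indicE mem_set ?mul1r; last by move=> k /=; rewrite ffunE.
  rewrite big1 ?addr0// => a aN; rewrite indicE memNset ?mul0r// => xB.
  by move/eqP: aN; apply; apply/ffunP => k; rewrite ffunE; exact/esym/xB.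
have mc q : \sum_(a : {ffun 'I_n -> 'I_N.+1}) h2 a q * H a q.2.1 = mixed_cost H (s q.1) q.2.
  by apply: eq_bigr => a _; rewrite mulrC.
have mMC : measurable_fun setT (fun q : X2 => mixed_cost H (s q.1) q.2).
  rewrite (_ : (fun _ => _) = fun q => \sum_(a : {ffun 'I_n -> 'I_N.+1}) h2 a q * H a q.2.1).
    by apply: measurable_sum => a; apply: measurable_funM => //; exact: (measurableT_comp (mH a) me2).
  by apply/funext => q; rewrite mc.
have MC01 (q : X2) : 0 <= mixed_cost H (s q.1) q.2 <= 1 by exact: mixed_cost01.
have total : \int[nu]_x H [ffun k => b (x.2 k)] x.1 = \int[eta]_z \int[mu]_x mixed_cost H (s z) x.
  transitivity (\int[nu]_x \sum_(a : {ffun 'I_n -> 'I_N.+1}) \1_(B a) x * H a x.1).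
    by apply: eq_Rintegral => x _; rewrite HE.
  have [_ ->] := @Rintegral_sum01 _ _ _ nu _ (index_enum {ffun 'I_n -> 'I_N.+1}) (fun a x => \1_(B a) x * H a x.1)
     (fun a => measurable_funM (@measurable_indic _ _ R setT _ (mB a)) (measurableT_comp (mH a) measurable_fst))
     (fun a x => mul01 (@indic01 _ R (B a) x) (H01 a x.1)).
  rewrite (eq_bigr (fun a => \int[M2]_q (h2 a q * H a q.2.1))); last by move=> a _; exact: step.
  have [_ <-] := @Rintegral_sum01 _ _ _ M2 _ (index_enum {ffun 'I_n -> 'I_N.+1}) (fun a q => h2 a q * H a q.2.1)
     (fun a => measurable_funM (mh2 a) (measurableT_comp (mH a) me2))
     (fun a q => mul01 (h201 a q) (H01 a q.2.1)).
  transitivity (\int[M2]_q mixed_cost H (s q.1) q.2).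
    by apply: eq_Rintegral => q _; exact: mc.
  exact: (Rfubini1 eta mu mMC MC01).
have mint : measurable_fun setT (fun z => \int[mu]_x mixed_cost H (s z) x).
  exact: (measurable_Rint1 mu mMC MC01).
have int01 z : 0 <= \int[mu]_x mixed_cost H (s z) x <= 1.
  have /andP[-> h] := Rintegral01 mu measurableT (measurable_mixed_cost mH (rs z)) (fun x => MC01 (z, x)).
  by rewrite (le_trans h)// probability_setT.
(* The common randomness is frozen here; what remains given [z] is private randomization. *)
have [z _ zle] := exists_le_mean measurableT (probability_setT eta) mint int01.
have [th [mth thle]] := derandomize mu mH H01 (rs z) (s1 z).
by exists th; split => //; rewrite total; exact: le_trans zle.
Qed.

End garbled_play.

(** * Quantization of policies by finite nets *)

Lemma finite_net (R : realType) (U : pseudoPMetricType R) (r : R) : 0 < r ->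
  compact [set: U] -> exists s : seq U, forall u, has (fun a => `[< (ball a r)° u >]) s.
Proof.
move=> r0; rewrite compact_cover => /(_ U setT (fun a => (ball a r)°)).
case; first by move=> a _; exact: open_interior.
  by move=> u _; exists u => //; rewrite /interior; exact: nbhsx_ballx.
move=> D _ cov; exists (enum_fset D) => u; have [a aD au] := cov u Logic.I.
by apply/hasP; exists a => //; exact/asboolP.
Qed.

Lemma measurable_find d (X : measurableType d) (A : Type) (P : A -> X -> bool) (s : seq A) i :
  (forall a, measurable [set x | P a x]) -> measurable [set x | find (P^~ x) s = i].
Proof.
move=> mP; elim: s i => [|a s IH] i /=.
  have [<-|i0] := eqVneq 0%N i; first by rewrite (_ : [set _ | _] = setT)//; exact/seteqP.
  by rewrite (_ : [set _ | _] = set0)//; apply/seteqP; split => x //= e; move: i0; rewrite e eqxx.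
case: i => [|i].
  rewrite (_ : [set _ | _] = [set x | P a x])//.
  by apply/seteqP; split => x /=; case: (P a x).
rewrite (_ : [set _ | _] = ~` [set x | P a x] `&` [set x | find (P^~ x) s = i]).
  by apply: measurableI => //; exact: measurableC.
apply/seteqP; split => x /=; case: (P a x) => //; first by move=> [].
  by case=> /(_ isT).
by case=> _ ->.
Qed.

(** Each signal is sent to the first net point whose ball contains the action. The bound [N] is left
    free so that all the players can share one index type. *)
Lemma quantization (R : realType) (U : pseudoPMetricType R) (r : R) : 0 < r ->
  compact [set: U] -> exists s : seq U, forall N, (size s <= N)%N ->
  forall d (Y : measurableType d) (g : Y -> U),
    (forall O, open O -> measurable (g @^-1` O)) ->
  exists b : Y -> 'I_N.+1, (forall j, measurable (b @^-1` [set j])) /\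
    forall y, ball (nth point s (b y)) r (g y).
Proof.
move=> r0 cU; have [s hs] := finite_net r0 cU; exists s => N sN d Y g mg.
pose P a y := `[< (ball a r)° (g y) >].
have fN y : (find (P^~ y) s < N.+1)%N.
  by rewrite ltnS (leq_trans (find_size _ _)).
exists (fun y => inord (find (P^~ y) s)); split => [j|y].
  rewrite (_ : _ @^-1` _ = [set y | find (P^~ y) s = j]).
    apply: measurable_find => a; rewrite (_ : [set _ | _] = g @^-1` (ball a r)°).
      by apply: mg; exact: open_interior.
    by apply/seteqP; split => y /= /asboolP.
  apply/seteqP; split => y /=.
    by move=> /(congr1 val) /=; rewrite inordK.
  by move=> e; apply: val_inj; rewrite /= inordK.
rewrite inordK//.
have /asboolP := nth_find point (hs (g y)).
exact: interior_subset.
Qed.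

Lemma finite_valued_policy (R : realType) (n N : nat) (dY : 'I_n -> measure_display)
    (Y : forall k, measurableType (dY k)) (U : 'I_n -> pseudoPMetricType R)
    (u : forall k, 'I_N.+1 -> U k) (th : forall k, Y k -> 'I_N.+1) :
  (forall k j, measurable (th k @^-1` [set j])) -> team_policy (fun k y => u k (th k y)).
Proof.
move=> mth k O oO.
rewrite (_ : _ @^-1` O = [set y | forall j, (fun j y => th k y = j -> O (u k j)) j y]).
  apply: measurable_forall_countable => j /=; have [Ouj|NOuj] := pselect (O (u k j)).
    suff -> : (fun y => th k y = j -> O (u k j)) = setT by [].
    by apply/seteqP; split.
  suff -> : (fun y => th k y = j -> O (u k j)) = ~` (th k @^-1` [set j]) by exact: measurableC.
  by apply/seteqP; split => y /=; [move=> h e; exact/NOuj/h|].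
by apply/seteqP; split => y /=; [move=> h j <-|apply].
Qed.

Lemma prod_topology_cvg (R : realType) (n : nat) (U : 'I_n -> pseudoPMetricType R)
    (v : nat -> prod_topology U) (u : prod_topology U) :
  (forall k, (fun m => v m k) @ \oo --> u k) -> v @ \oo --> u.
Proof.
move=> vu; apply/cvg_sup => k A; rewrite nbhsE => -[B [[V oV <-] Vu] BA].
apply: (@filterS _ (v @ \oo) _ _ _ BA).
exact: (vu k V (open_nbhs_nbhs (conj oV Vu))).
Qed.

(** * Costs of quantized policies *)

Section team_costs.
Variables (R : realType) (n : nat) (d0 : measure_display) (Om : measurableType d0).
Variables (dY : 'I_n -> measure_display) (Y : forall k, measurableType (dY k)).
Variables (U : 'I_n -> pseudoPMetricType R) (c : Om -> (forall k, U k) -> R).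
Hypothesis mc : measurable_fun setT (fun p : (Om * prodU U)%type => c p.1 p.2).

Lemma measurable_policy_cost (g : forall k, Y k -> U k) : team_policy g ->
  measurable_fun setT (fun x : Om * prodY Y => c x.1 (fun k => g k (x.2 k))).
Proof.
move=> tg; pose G (x : Om * prodY Y) : prodU U := fun k => g k (x.2 k).
have mG : measurable_fun setT G.
  apply: (@measurability _ _ _ (prodU U) setT _ (cyl_gen (fun k => @open (U k)))) => //.
  move=> _ [_ [k [V oV ->]] <-].
  have m2 := measurableT_comp (@measurable_proj _ _ Y k) (@measurable_snd _ _ Om (prodY Y)).
  exact: (m2 measurableT _ (tg k V oV)).
exact: (measurableT_comp mc (measurable_fun_pair (@measurable_fst _ _ Om (prodY Y)) mG)).
Qed.

Lemma measurable_cost_at (u : forall k, U k) : measurable_fun setT (fun w => c w u).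
Proof.
have mu : measurable_fun setT (fun w : Om => (w, u) : Om * prodU U).
  exact: (measurable_fun_pair (@measurable_id _ Om setT) (@measurable_cst _ _ Om (prodU U) setT u)).
exact: (measurableT_comp mc mu).
Qed.

Variables (mu nu : probability (Om * prodY Y)%type R) (M : R).
Hypothesis cM : forall w u, `|c w u| <= M.

Lemma quantized_policy_le (N : nat) (u : forall k, 'I_N.+1 -> U k) (b : forall k, Y k -> 'I_N.+1) :
  correlated_garbling mu nu -> (forall k j, measurable (b k @^-1` [set j])) ->
  (Jstar c mu <= (\int[nu]_x c x.1 (fun k => u k (b k (x.2 k))))%:E)%E.
Proof.
move=> gar mb.
(* A strictly positive bound, so that [c] can be rescaled affinely into [0, 1]; the rescaling
   cancels at the end. *)
pose M' := `|M| + 1; have M'0 : 0 < M' by rewrite ltr_pwDr.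
have cM' w v : - M' <= c w v <= M'.
  by rewrite -ler_norml (le_trans (cM w v))// /M' (le_trans (ler_norm M))// lerDl.
pose H (a : {ffun 'I_n -> 'I_N.+1}) w := (c w (fun k => u k (a k)) + M') / (2 * M').
have H01 a w : 0 <= H a w <= 1.
  have /andP[? ?] := cM' w (fun k => u k (a k)).
  rewrite divr_ge0 ?ler_pdivrMr ?mul1r//; lra.
have mH a : measurable_fun setT (H a).
  apply: measurable_funM => //; apply: measurable_funD => //.
  exact: measurable_cost_at.
have [th [mth]] := garbled_play mH H01 mb gar.
have int (P : probability (Om * prodY Y)%type R) (t : forall k, Y k -> 'I_N.+1) :
    (forall k j, measurable (t k @^-1` [set j])) ->
    P.-integrable setT (EFin \o (fun x : Om * prodY Y => c x.1 (fun k => u k (t k (x.2 k))))) /\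
    \int[P]_x H [ffun k => t k (x.2 k)] x.1 =
    (2 * M')^-1 * (\int[P]_x c x.1 (fun k => u k (t k (x.2 k))) + M').
  move=> mt.
  have ic : P.-integrable setT (EFin \o (fun x : Om * prodY Y => c x.1 (fun k => u k (t k (x.2 k))))).
    apply: (@bounded_integrable _ _ _ P M _ _ measurableT) => [|x]; last exact: cM.
    exact: (measurable_policy_cost (finite_valued_policy u mt)).
  have iM : P.-integrable setT (EFin \o (fun x : Om * prodY Y => M')).
    apply: (@bounded_integrable _ _ _ P M' _ _ measurableT) => [|x]; first exact: measurable_cst.
    by rewrite gtr0_norm.
  have PT : \int[P]_(x in setT) M' = M'.
    by rewrite Rintegral_cst// (congr1 fine (probability_setT P)) mulr1.
  split => //; rewrite -[X in _ + X]PT -RintegralD// -RintegralZl//; last first.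
    exact: (integrableD measurableT ic iM).
  apply: eq_Rintegral => x _; rewrite /H mulrC; congr (_ * (c _ _ + _)).
  by apply: functional_extensionality_dep => k; rewrite ffunE.
have [imu ->] := int mu th mth; have [inu ->] := int nu b mb.
rewrite ler_pM2l ?invr_gt0 ?mulr_gt0// lerD2r => le.
apply: ge_ereal_inf; exists (\int[mu]_x c x.1 (fun k => u k (th k (x.2 k))))%:E; last by rewrite lee_fin.
exists (fun k y => u k (th k y)); first exact: finite_valued_policy.
by rewrite /Rintegral fineK//; exact: (integrable_fin_num measurableT imu).
Qed.

End team_costs.

(** * Garbling implies more informative *)

Section informative_of_garbling.
Variables (R : realType) (n : nat) (d0 : measure_display) (Om : measurableType d0).
Variables (dY : 'I_n -> measure_display) (Y : forall k, measurableType (dY k)).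
Variables (mu nu : probability (Om * prodY Y)%type R).
Variables (U : 'I_n -> pseudoPMetricType R) (c : Om -> (forall k, U k) -> R).

Lemma more_informative_of_garbling : correlated_garbling mu nu ->
  team_problem_in_E c -> (Jstar c mu <= Jstar c nu)%E.
Proof.
move=> gar [cU mc [M cM] cc]; apply: le_ereal_inf_tmp => _ [g tg <-].
(* Quantized versions of [g] at precision [1 / (m + 1)], each with a cost under [nu] at least the
   optimal cost under [mu]. *)
have appr m : exists v : forall k, Y k -> U k, [/\ team_policy v,
    (Jstar c mu <= (\int[nu]_x c x.1 (fun k => v k (x.2 k)))%:E)%E &
    forall k y, ball (v k y) m.+1%:R^-1 (g k y)].
  have r0 : 0 < m.+1%:R^-1 :> R by rewrite invr_gt0.
  pose s k := projT1 (cid (quantization r0 (proj1 (cU k)))).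
  pose N := (\max_k size (s k))%N.
  have sN k : (size (s k) <= N)%N by exact: (leq_bigmax k).
  pose E k := cid (projT2 (cid (quantization r0 (proj1 (cU k)))) N (sN k) _ (Y k) (g k) (tg k)).
  pose b k := projT1 (E k).
  have mb k j : measurable (b k @^-1` [set j]) by have [mbk _] := projT2 (E k); exact: mbk.
  exists (fun k y => nth point (s k) (b k y)); split.
  - exact: (finite_valued_policy (fun k j => nth point (s k) j) mb).
  - exact: (quantized_policy_le mc cM (fun k j => nth point (s k) j) gar mb).
  - by move=> k y; have [_] := projT2 (E k); apply.
have [v vP] := choice appr.
pose f_ m (x : Om * prodY Y) := (c x.1 (fun k => v m k (x.2 k)))%:E.
have mf (h : forall k, Y k -> U k) : team_policy h ->
    measurable_fun setT (fun x : Om * prodY Y => (c x.1 (fun k => h k (x.2 k)))%:E).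
  by move=> th; apply/measurable_EFinP; exact: (measurable_policy_cost mc th).
have ball_cvg k y : (fun m => v m k y) @ \oo --> g k y.
  move=> A /nbhs_ballP[e /= e0 eA].
  have [m0 _ m0e] := @near_infty_natSinv_lt R (PosNum e0).
  exists m0 => // m mm0; apply: eA; apply: ball_sym.
  have [_ _ vm] := vP m.
  exact: (le_ball (ltW (m0e m mm0)) (vm k y)).
have pt x : f_ ^~ x @ \oo --> (c x.1 (fun k => g k (x.2 k)))%:E.
  apply: cvg_EFin; first by apply: nearW.
  have := prod_topology_cvg (v := fun m k => v m k (x.2 k)) (fun k => ball_cvg k (x.2 k)).
  move=> /(continuous_cvg _ (cc x.1 _)); exact.
(* The quantized costs converge pointwise by continuity in the actions and are dominated by [M], so
   the inequality passes to [g]. *)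
have [_ _ cv] := dominated_convergence (mu := nu) measurableT (f_ := f_) (g := fun=> M%:E)
  (fun m => let: And3 tv _ _ := vP m in mf _ tv) (mf g tg)
  (aeW _ (fun x _ => pt x))
  (finite_measure_integrable_cst nu M measurableT) (aeW _ (fun x m _ => cM _ _)).
rewrite -(cvg_lim _ cv)//; apply: lime_ge; first by apply/cvg_ex; eexists; exact: cv.
apply: nearW => m; have [tv le _] := vP m; apply: (le_trans le).
rewrite /Rintegral fineK//.
apply: (integrable_fin_num measurableT).
apply: (@bounded_integrable _ _ _ nu M _ _ measurableT) => [|x]; last exact: cM.
exact: (measurable_policy_cost mc tv).
Qed.

End informative_of_garbling.


Unset Implicit Arguments.

Theorem theorem6 (R : realType) (d0 : measure_display) (Om : measurableType d0)
  (n : nat) (dY : 'I_n -> measure_display) (Y : forall k, measurableType (dY k))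
  (zeta : probability Om R) (mu nu : probability (Om * prodY Y)%type R) :
  standard_borel R Om ->
  (forall k, standard_borel R (Y k)) ->
  has_marginal mu zeta ->
  has_marginal nu zeta ->
  (exists (mu0 : probability Om R) (Q : forall k, probability (Y k) R)
          (P : probability (prodY Y) R),
      is_product_prob Q P /\ mu `<< product_measure1 mu0 P) ->
  ((forall (U : 'I_n -> pseudoPMetricType R) (c : Om -> (forall k, U k) -> R),
       team_problem_in_E c -> (Jstar c mu <= Jstar c nu)%E)
   <-> correlated_garbling mu nu).
Proof.
move=> sbO sbY mum num dom; split => [info|gar U c]; last exact: more_informative_of_garbling.
exact: (garbling_of_more_informative (zeta := zeta) sbO sbY mum num dom info).
Qed.
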